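(* Let $m\ge 1$, let $c=(c_1,\dots,c_m)$ be a vector of positive integers, and let $M$ be a proper $c$-multicomplex. Then the Murai sphere $\mathrm{Bier}_c(M)$ is flag if and only if it is polytopal with the corresponding simple polytope $P_{M,c}$ being (up to combinatorial equivalence) a flag nestohedron of one of the following types: (1) $P_{M,c}=I^n$ for $n\ge 1$; (2) $P_{M,c}=I^n\times P_5$ for $n\ge 0$; (3) $P_{M,c}=I^n\times P_6$ for $n\ge 0$; (4) $P_{M,c}=I^n\times Q_2^3$ for $n\ge 0$.
   Context: A $c$-monomial is a monomial $x^a=x_1^{a_1}\cdots x_m^{a_m}$ with $0\le a_i\le c_i$ for all $i$. A $c$-multicomplex is a non-empty set $M$ of $c$-monomials closed under taking divisors; it is proper if it is not the set of all $c$-monomials. Write $|c|=c_1+\dots+c_m$. Let $\tilde X_i=\{x_i^{(0)},\dots,x_i^{(c_i)}\}$ and $\tilde X=\tilde X_1\sqcup\dots\sqcup\tilde X_m$ (formal symbols). For a $c$-monomial $x^a$ put $F_c(x^a)=\tilde X\setminus\{x_1^{(a_1)},\dots,x_m^{(a_m)}\}$. For a proper $c$-multicomplex $M$ the Murai sphere (generalized Bier sphere) $\mathrm{Bier}_c(M)$ is the simplicial complex on $\tilde X$ whose set of maximal faces is $$\{F_c(x^a)\setminus\{x_i^{(j)}\} : x^a\in M,\ 1\le i\le m,\ a_i<j\le c_i,\ x^a x_i^{-a_i+j}\notin M\}.$$ It is a simplicial sphere of dimension $|c|-2$; some elements of $\tilde X$ may be ghost vertices (not belonging to any face). A simplicial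 complex is flag if all its minimal non-faces (inclusion-minimal subsets of the ground set that are not faces) have cardinality $\le 2$ (ghost vertices are allowed). It is polytopal if it is isomorphic (disregarding ghost vertices) to the boundary complex of a simplicial polytope $Q$; if $\mathrm{Bier}_c(M)$ is polytopal, $P_{M,c}$ denotes the simple polytope dual to $Q$ (so $\mathrm{Bier}_c(M)=\partial P_{M,c}^*$), up to combinatorial equivalence. A simple polytope is flag if the boundary complex of its dual simplicial polytope is flag. $I^n$ is the $n$-cube; $P_k$ is the $k$-gon; $Q_2^3$ is the simple 3-polytope obtained from the 3-cube $I^3$ by two adjacent edge cuts: if $F_1,F_2,F_3$ are three facets of $I^3$ sharing a vertex, one first cuts off the edge $F_1\cap F_2$ by a hyperplane in general position, and then cuts off the (remaining part of the) edge $F_2\cap F_3$. A building set on $[n+1]=\{1,\dots,n+1\}$ is a collection $\mathcal B$ of nonempty subsets of $[n+1]$ containing all singletons and such that $S,T\in\mathcal B$, $S\cap T\ne\varnothing$ imply $S\cup T\in\mathcal B$; it is connected if $[n+1]\in\mathcal B$. An $n$-dimensional nestohedron is a polytope combinatorially equivalent to the Minkowski sum $\sum_{S\in\mathcal B}\mathrm{conv}\{e_i : i\in S\}\subset\mathbb R^{n+1}$ for a connected building set $\mathcal B$ on $[n+1]$ (it is a simple polytope).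
   Formalization: The formal statement adds |c| ≥ 2, which excludes only m = 1, c = (1), M = {1}; there Bier_c(M) = {∅} is flag, but the corresponding polytope is the point I^0, which is in none of the four types, so the claim as stated fails. *)

(* Defs.v *)
From HB Require Import structures.
From mathcomp Require Import all_boot all_order all_algebra finmap.
From mathcomp Require Import boolp classical_sets functions cardinality reals.
From mathcomp Require Import convex.

Set Implicit Arguments.
Unset Strict Implicit.
Unset Printing Implicit Defensive.

Import Order.TTheory GRing.Theory Num.Theory.

Local Open Scope classical_set_scope.
Local Open Scope card_scope.
Local Open Scope ring_scope.

Definition flag_complex (T : finType) (K : {set {set T}}) : Prop :=
  forall A : {set T}, minset [pred B : {set T} | B \notin K] A ->
    (#|A| <= 2)%N.

Definition complex_vertices (T : finType) (K : {set {set T}}) : {set T} :=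
  [set x | [set x]%SET \in K]%SET.

(* Values of phi at ghost vertices of K are irrelevant. *)
Definition complex_iso (T U : finType) (K : {set {set T}}) (L : {set {set U}})
    : Prop :=
  exists phi : T -> U,
    [/\ {in complex_vertices K &, injective phi},
        (phi @: complex_vertices K)%SET = complex_vertices L &
        forall A : {set T}, A \subset complex_vertices K ->
          (A \in K) = ((phi @: A)%SET \in L)].

(* The c-monomial x^a is represented by its exponent vector a. *)
Definition cmonomial (m : nat) (c : 'I_m -> nat) : finType :=
  {dffun forall i : 'I_m, 'I_(c i).+1}.

(* Tagged _ j with j : 'I_(c i).+1 stands for the symbol x_i^(j). *)
Definition csymbol (m : nat) (c : 'I_m -> nat) : finType :=
  {i : 'I_m & 'I_(c i).+1}.

Section Murai.
Variables (m : nat) (c : 'I_m -> nat).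

Definition cdivides (a b : cmonomial c) : Prop :=
  forall i, (a i <= b i)%N.

Definition multicomplex (M : {set cmonomial c}) : Prop :=
  M != finset.set0 /\
  forall a b : cmonomial c, b \in M -> cdivides a b -> a \in M.

Definition proper_multicomplex (M : {set cmonomial c}) : Prop :=
  multicomplex M /\ M != finset.setT.

Definition Fc (a : cmonomial c) : {set csymbol c} :=
  (~: [set Tagged (fun i => 'I_(c i).+1) (a i) | i : 'I_m])%SET.

(* For p = x_i^(j), the monomial x^a x_i^(- a_i + j). *)
Definition cupdate (a : cmonomial c) (p : csymbol c) : cmonomial c :=
  [ffun k => dfwith a (tagged p) k].

Definition murai_facets (M : {set cmonomial c}) : {set {set csymbol c}} :=
  [set G | [exists a : cmonomial c, exists p : csymbol c,
     [&& a \in M, (a (tag p) < tagged p)%N, cupdate a p \notin M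
       & G == (Fc a :\ p)%SET]]]%SET.

Definition murai_sphere (M : {set cmonomial c}) : {set {set csymbol c}} :=
  [set A : {set csymbol c} | [exists G in murai_facets M, A \subset G]]%SET.

End Murai.

Section Polytopes.
Variable R : realType.

Definition conv_hull (d : nat) (A : set 'rV[R]_d) : set 'rV[R]_d :=
  smallest (@convex_set R 'rV[R]_d) A.

Definition polytope (d : nat) (P : set 'rV[R]_d) : Prop :=
  exists A : set 'rV[R]_d, [/\ finite_set A, A !=set0 & P = conv_hull A].

(* u = 0 gives the two improper faces: P itself (b = 0) and set0 (b = 1). *)
Definition face (d : nat) (P F : set 'rV[R]_d) : Prop :=
  exists (u : 'cV[R]_d) (b : R),
    (forall x, P x -> (x *m u) 0 0 <= b) /\
    F = P `&` [set x | (x *m u) 0 0 = b].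

Definition facet (d : nat) (P F : set 'rV[R]_d) : Prop :=
  [/\ face P F, F `<` P &
      forall G, face P G -> G `<` P -> F `<=` G -> G = F].

Definition vertices (d : nat) (P : set 'rV[R]_d) : set 'rV[R]_d :=
  [set x | face P [set x]].

Definition comb_equiv (d e : nat) (P : set 'rV[R]_d) (Q : set 'rV[R]_e) : Prop :=
  exists f : set 'rV[R]_d -> set 'rV[R]_e,
    set_bij (face P) (face Q) f /\
    forall F G, face P F -> face P G -> (f F `<=` f G <-> F `<=` G).

Definition comb_dual (d e : nat) (P : set 'rV[R]_d) (Q : set 'rV[R]_e) : Prop :=
  exists f : set 'rV[R]_d -> set 'rV[R]_e,
    set_bij (face P) (face Q) f /\
    forall F G, face P F -> face P G -> (f F `<=` f G <-> G `<=` F).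

Definition affinely_independent (d k : nat) (v : 'I_k -> 'rV[R]_d) : Prop :=
  forall w : 'I_k -> R,
    \sum_i w i = 0 -> \sum_i w i *: v i = 0 -> forall i, w i = 0.

(* k = 0 gives the empty simplex. *)
Definition simplex (d : nat) (F : set 'rV[R]_d) : Prop :=
  exists (k : nat) (v : 'I_k -> 'rV[R]_d),
    affinely_independent v /\ F = conv_hull (range v).

Definition simplicial_polytope (d : nat) (Q : set 'rV[R]_d) : Prop :=
  polytope Q /\ forall F, face Q F -> F `<` Q -> simplex F.

(* The ground set is the finite type of the vertices of Q; fset_set is only
   meaningful on finite sets, and a polytope has finitely many vertices. *)
Definition boundary_complex (d : nat) (Q : set 'rV[R]_d) :
    {set {set fset_set (vertices Q)}} :=
  [set A : {set fset_set (vertices Q)} |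
     `[< exists F, [/\ face Q F, F `<` Q &
           forall v : fset_set (vertices Q), v \in A <-> F (val v)] >]]%SET.

(* P is a simple polytope with K = bd(P^* ), up to ghost vertices of K; such a
   P exists exactly when K is polytopal. *)
Definition simple_polytope_of (T : finType) (K : {set {set T}})
    (d : nat) (P : set 'rV[R]_d) : Prop :=
  polytope P /\
  exists (e : nat) (Q : set 'rV[R]_e),
    [/\ simplicial_polytope Q, complex_iso K (boundary_complex Q)
      & comb_dual P Q].

Definition flag_polytope (d : nat) (P : set 'rV[R]_d) : Prop :=
  polytope P /\
  exists (e : nat) (Q : set 'rV[R]_e),
    [/\ simplicial_polytope Q, comb_dual P Q
      & flag_complex (boundary_complex Q)].

Definition cube (n : nat) : set 'rV[R]_n :=
  [set x | forall i, 0 <= x 0 i <= 1].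

(* Meant for 3 <= k, in which case G is necessarily 2-dimensional. *)
Definition polygon (k : nat) (G : set 'rV[R]_2) : Prop :=
  polytope G /\ vertices G #= `I_k.

Definition polytope_prod (p q : nat) (P : set 'rV[R]_p) (Q : set 'rV[R]_q) :
    set 'rV[R]_(p + q) :=
  [set x | P (lsubmx x) /\ Q (rsubmx x)].

(* P' is obtained from P by cutting off its face G by a hyperplane. *)
Definition face_cut (d : nat) (P G P' : set 'rV[R]_d) : Prop :=
  exists (u : 'cV[R]_d) (b : R),
    [/\ forall v, vertices P v -> G v -> b < (v *m u) 0 0,
        forall v, vertices P v -> ~ G v -> (v *m u) 0 0 < b &
        P' = P `&` [set x | (x *m u) 0 0 <= b]].

Definition Q23 (Q : set 'rV[R]_3) : Prop :=
  exists F1 F2 F3 P1 : set 'rV[R]_3,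
    [/\ [/\ facet (@cube 3) F1, facet (@cube 3) F2 & facet (@cube 3) F3],
        [/\ F1 <> F2, F1 <> F3 & F2 <> F3],
        exists2 v, vertices (@cube 3) v & (F1 `&` F2 `&` F3) v,
        face_cut (@cube 3) (F1 `&` F2) P1 &
        face_cut P1 (F2 `&` F3 `&` P1) Q].

Definition building_set (n : nat) (B : {set {set 'I_n.+1}}) : Prop :=
  [/\ finset.set0 \notin B,
      forall i, [set i]%SET \in B &
      forall S T : {set 'I_n.+1}, S \in B -> T \in B ->
        (S :&: T)%SET != finset.set0 -> (S :|: T)%SET \in B].

Definition connected_building_set (n : nat) (B : {set {set 'I_n.+1}}) : Prop :=
  building_set B /\ finset.setT \in B.

Definition coord_simplex (n : nat) (S : {set 'I_n.+1}) : set 'rV[R]_n.+1 :=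
  conv_hull [set x | exists2 i, i \in S & x = delta_mx 0 i].

Definition minkowski_sum (n : nat) (B : {set {set 'I_n.+1}}) :
    set 'rV[R]_n.+1 :=
  [set x | exists y : {set 'I_n.+1} -> 'rV[R]_n.+1,
     (forall S, S \in B -> coord_simplex S (y S)) /\ x = \sum_(S in B) y S].

Definition nestohedron (d : nat) (P : set 'rV[R]_d) : Prop :=
  polytope P /\
  exists (n : nat) (B : {set {set 'I_n.+1}}),
    connected_building_set B /\ comb_equiv P (minkowski_sum B).

End Polytopes.

Arguments cube R n : clear implicits.

(* Main.v *)
(* Geometry.  If p v is a point of P at which d - codim inequalities valid on P
   are tight, and each of them can be relaxed along an edge towards another such
   point, then a functional maximal at p v is an explicit nonnegative combination
   of the inequalities tight there.  Hence the nonempty faces of P are the sets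
   cut out by the subsets of the tight sets, however P is described, and the polar
   dual is simplicial with the tight sets as facets.  Polytopes with the same
   abstract tight sets are thus combinatorially equivalent: this compares the
   cubes, their products with P_5, P_6 and Q_2^3, and the nestohedra.

   Combinatorics.  A set A is a face of Bier_c(M) iff some g in M and some h
   outside M both avoid A.  So Bier_c(M) is flag only if the minimal non-members
   of M have degree at most 2, dually for the maximal members, and for c_k > 1
   either x_k^2 is not in M or dually.  Up to duality this leaves 14 possibilities
   for M on its essential coordinates (an x_l on which M does not depend has
   c_l = 1 and contributes a factor I), and the flag complex Bier_c(M) is then
   recognized from its graph of non-edges. *)
Require Import Defs.
From mathcomp Require Import all_boot all_order all_algebra finmap.
From mathcomp Require Import boolp classical_sets functions cardinality.
From mathcomp Require Import reals convex interval_inference.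
From mathcomp Require Import ring lra zify.

Set Implicit Arguments.
Unset Strict Implicit.
Unset Printing Implicit Defensive.

Import Order.TTheory GRing.Theory Num.Theory.

Local Open Scope classical_set_scope.
Local Open Scope ring_scope.

(** * Convex hulls *)

(** No convex hull and no Minkowski sum is ever shown equal to the solution set of its inequalities.
    At a simple vertex the edge directions form a basis of the directions of the affine hull, dual
    up to scaling to the tight normals, and this alone produces the certificates of optimality. What
    remains to be known of a concrete polytope is a finite table of integers, checked by
    computation.

    The converse implication does not look at the list of polytopes: [simple_polytope_of] and
    [flag_polytope] each bring their own simplicial dual, and flagness is carried from one to the
    other through the face lattice.

    The bound 2 on degrees is a counting argument. A non-face is hit by every member of M or by
    every non-member; if only two symbols are involved, moving one exponent up or down soon escapes
    both.

    An inessential x_l has c_l = 1 because its symbols contribute the boundary of a simplex as a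
    join factor, with a minimal non-face of c_l + 1 elements. *)

Section Convexity.
Variables (R : realType) (d : nat).
Implicit Types (P : set 'rV[R]_d) (x y : 'rV[R]_d) (u : 'cV[R]_d).

Definition dot x u : R := (x *m u) 0 0.

Lemma dotDl x y u : dot (x + y) u = dot x u + dot y u.
Proof. by rewrite /dot mulmxDl mxE. Qed.
Lemma dotZl a x u : dot (a *: x) u = a * dot x u.
Proof. by rewrite /dot -scalemxAl mxE. Qed.
Lemma dotNl x u : dot (- x) u = - dot x u.
Proof. by rewrite /dot mulNmx mxE. Qed.
Lemma dotDr x u v : dot x (u + v) = dot x u + dot x v.
Proof. by rewrite /dot mulmxDr mxE. Qed.
Lemma dotZr a x u : dot x (a *: u) = a * dot x u.
Proof. by rewrite /dot -scalemxAr mxE. Qed.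
Lemma dotNr x u : dot x (- u) = - dot x u.
Proof. by rewrite /dot mulmxN mxE. Qed.
Lemma dot0l u : dot 0 u = 0.
Proof. by rewrite /dot mul0mx mxE. Qed.
Lemma dot0r x : dot x 0 = 0.
Proof. by rewrite /dot mulmx0 mxE. Qed.
Lemma dot_suml I (r : seq I) (Pr : pred I) F u :
  dot (\sum_(i <- r | Pr i) F i) u = \sum_(i <- r | Pr i) dot (F i) u.
Proof. by rewrite /dot mulmx_suml summxE. Qed.
Lemma dot_sumr I (r : seq I) (Pr : pred I) x F :
  dot x (\sum_(i <- r | Pr i) F i) = \sum_(i <- r | Pr i) dot x (F i).
Proof. by rewrite /dot mulmx_sumr summxE. Qed.

Lemma convex_setP P :
  (forall x y (a : R), 0 <= a <= 1 -> P x -> P y ->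
     P (a *: x + (1 - a) *: y)) <-> convex_set P.
Proof.
split=> [H x y l /set_mem Px /set_mem Py|H x y a /andP[a0 a1] Px Py].
  by apply: mem_set; apply: (H) => //; apply/andP; split; [apply: ge0|apply: le1].
have := H x y (Itv01 a0 a1) (mem_set Px) (mem_set Py).
by move=> /set_mem.
Qed.

Lemma convex_conv_hull P : convex_set (conv_hull P).
Proof.
apply/convex_setP => x y a a01 Hx Hy C [/convex_setP cC PC].
have CS z : conv_hull P z -> C z by apply; split=> //; apply/convex_setP.
by apply: cC => //; apply: CS.
Qed.

Lemma sub_conv_hull P x : P x -> conv_hull P x.
Proof. by move=> Px C [_]; apply. Qed.

Lemma conv_hull_sub P C x : convex_set C -> P `<=` C -> conv_hull P x -> C x.
Proof. by move=> cC PC; apply. Qed.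

Lemma convex_halfspace u b : convex_set [set x | dot x u <= b].
Proof.
apply/convex_setP => x y a /andP[a0 a1] /= Hx Hy.
rewrite dotDl !dotZl; nra.
Qed.

Lemma conv_hull_le P u b x :
  (forall y, P y -> dot y u <= b) -> conv_hull P x -> dot x u <= b.
Proof. by move=> H hx; exact: (conv_hull_sub (@convex_halfspace u b) H hx). Qed.

End Convexity.

(** * Face lattices of simple polytopes *)

Section TightComplex.
Variables V T : finType.
Implicit Types (inc : V -> {set T}) (K : {set {set T}}).

Definition flips inc : Prop := forall v t, t \in inc v ->
  exists v', inc v :\ t \subset inc v' /\ t \notin inc v'.

(** For a simple polytope this is the boundary complex of the simplicial dual: facets turn into
    vertices, and each vertex [v] into the facet [inc v]. *)
Definition tight_complex inc : {set {set T}} :=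
  [set S : {set T} | [exists v, S \subset inc v]]%SET.

Lemma tight_complexP inc (S : {set T}) :
  reflect (exists v, S \subset inc v) (S \in tight_complex inc).
Proof. by rewrite inE; apply: existsP. Qed.

(** If [t] were missing from [S], flipping [t] away at a vertex through [S] would keep [S] and lose
    [t]. Hence different sets of the complex cut out different faces. *)
Lemma flips_absorb inc (S : {set T}) t : flips inc -> S \in tight_complex inc ->
  (forall v, S \subset inc v -> t \in inc v) -> t \in S.
Proof.
move=> fl /tight_complexP[v Sv] H; apply: contraT => tS.
have [v' [sub]] := fl v t (H v Sv).
rewrite H//; apply/fintype.subsetP => s sS; apply: (fintype.subsetP sub).
by rewrite !inE (fintype.subsetP Sv) // andbT; apply: contraNneq tS => <-.
Qed.

End TightComplex.

Section FaceLattice.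
Variable R : realType.

(** The map [h] reverses inclusion, the empty set standing for the whole polytope. The empty face is
    kept apart since no set of [K] yields it. *)
Definition realizes (T : finType) (K : {set {set T}}) (d : nat)
    (P : set 'rV[R]_d) : Prop :=
  exists h : {set T} -> set 'rV[R]_d,
    [/\ forall F, face P F <-> F = set0 \/ exists2 S, S \in K & F = h S,
        forall S, S \in K -> h S !=set0 &
        forall S S', S \in K -> S' \in K ->
          (h S `<=` h S' <-> S' \subset S)].

(* The points p v are the vertices of P, the inequalities l t <= beta t its
   facets, and C cuts out the affine hull; each p v is a simple vertex, since
   exactly d - \rank C inequalities are tight there and each of them can be
   relaxed along an edge.  P itself may be given in any form, as a convex hull,
   by inequalities or as a Minkowski sum. *)
Record presents (V T : finType) (d : nat) (P : set 'rV[R]_d)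
    (p : V -> 'rV[R]_d) (l : T -> 'cV[R]_d) (beta : T -> R)
    (inc : V -> {set T}) r (C : 'M[R]_(d, r)) : Prop := Presents {
  pres_pt : forall v, P (p v);
  pres_le : forall t x, P x -> dot x (l t) <= beta t;
  pres_tight : forall v t, (dot (p v) (l t) == beta t) = (t \in inc v);
  pres_flip : flips inc;
  pres_aff : forall x y, P x -> P y -> x *m C = y *m C;
  pres_rank : forall v, (#|inc v| + \rank C)%N = d }.

Section Presented.
Variables (V T : finType) (d : nat) (P : set 'rV[R]_d).
Variables (p : V -> 'rV[R]_d) (l : T -> 'cV[R]_d) (beta : T -> R).
Variables (inc : V -> {set T}) (r : nat) (C : 'M[R]_(d, r)).
Hypothesis pres : presents P p l beta inc C.

Lemma tight_le v t : dot (p v) (l t) <= beta t.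
Proof. exact: (pres_le pres) (pres_pt pres v). Qed.

(** The direction towards the flipped vertex lowers one tight inequality and keeps the others tight,
    so these vectors are dual, up to scaling, to the normals at [p v]. *)
Lemma edges v : exists e : T -> 'rV[R]_d,
  (forall t, t \in inc v ->
     [/\ exists v', e t = p v' - p v, dot (e t) (l t) < 0
       & forall s, s \in inc v -> s != t -> dot (e t) (l s) = 0]).
Proof.
have H t : exists e : 'rV[R]_d, t \in inc v ->
    [/\ exists v', e = p v' - p v, dot e (l t) < 0
       & forall s, s \in inc v -> s != t -> dot e (l s) = 0].
  have [tv|tv] := boolP (t \in inc v); last by exists 0.
  have [v' [sub ntv']] := pres_flip pres tv.
  exists (p v' - p v) => _; split; first by exists v'.
    rewrite dotDl dotNl subr_lt0.
    move: (tv); rewrite -(pres_tight pres) => /eqP ->.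
    by rewrite lt_neqAle tight_le andbT (pres_tight pres).
  move=> s sv st; have sv' : s \in inc v'.
    by apply: (fintype.subsetP sub); rewrite !inE st.
  rewrite dotDl dotNl; move: sv sv'; rewrite -!(pres_tight pres).
  by move=> /eqP -> /eqP ->; rewrite subrr.
by have [e He] := choice H; exists e.
Qed.

(** Pairing the edges with the tight normals gives a diagonal matrix, so they are independent. They
    lie in the kernel of [C], whose dimension is the number of tight inequalities by the rank
    condition, so they span it. The same pairing reads off the coefficients. *)
Lemma edge_span v (e : T -> 'rV[R]_d) :
  (forall t, t \in inc v ->
     [/\ exists v', e t = p v' - p v, dot (e t) (l t) < 0
       & forall s, s \in inc v -> s != t -> dot (e t) (l s) = 0]) ->
  forall x, x *m C = p v *m C ->
  x - p v = \sum_(t in inc v)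
    ((dot x (l t) - beta t) / dot (e t) (l t)) *: e t.
Proof.
move=> He x Hx.
have dotE (w : 'rV_#|inc v|) i :
    dot (\sum_j w 0 j *: e (enum_val j)) (l (enum_val i)) =
    w 0 i * dot (e (enum_val i)) (l (enum_val i)).
  rewrite dot_suml (bigD1 i) //= dotZl big1 ?addr0// => j ji.
  rewrite dotZl; have [_ _ ->] := He _ (enum_valP j); rewrite ?mulr0 ?enum_valP//.
  by apply: contraNneq ji => /enum_val_inj ->.
pose E := \matrix_(i < #|inc v|) e (enum_val i).
have mulE (w : 'rV_#|inc v|) : w *m E = \sum_j w 0 j *: e (enum_val j).
  by rewrite mulmx_sum_row; apply: eq_bigr => j _; rewrite rowK.
have freeE : row_free E.
  apply: inj_row_free => w; rewrite mulE => w0; apply/rowP => i.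
  have := dotE w i; rewrite w0 dot0l => /esym/eqP; rewrite mulf_eq0 mxE.
  have [_ lt _] := He _ (enum_valP i).
  by rewrite (lt_eqF lt) orbF => /eqP.
have EC : (E <= kermx C)%MS.
  apply/sub_kermxP/row_matrixP => i; rewrite row_mul rowK row0.
  have [[v' ->] _ _] := He _ (enum_valP i).
  by rewrite mulmxBl (pres_aff pres (pres_pt pres v') (pres_pt pres v)) subrr.
have CE : (kermx C <= E)%MS.
  rewrite -(geq_leqif (mxrank_leqif_sup EC)) mxrank_ker (eqP freeE).
  by rewrite -{1}(pres_rank pres v) addnK.
have : (x - p v <= E)%MS.
  by apply: submx_trans CE; apply/sub_kermxP; rewrite mulmxBl Hx subrr.
case/submxP => w; rewrite mulE => xE; rewrite xE.
rewrite [RHS]big_enum_val /=; apply: eq_bigr => i _; congr (_ *: _).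
have [_ lt _] := He _ (enum_valP i).
have := dotE w i; rewrite -xE dotDl dotNl.
have /eqP -> : dot (p v) (l (enum_val i)) == beta (enum_val i).
  by rewrite (pres_tight pres) enum_valP.
by move=> ->; rewrite mulfK// lt_eqF.
Qed.

(* Local optimality of u at the simple vertex p v makes it a nonnegative
   combination of the inequalities tight there, hence globally optimal. *)
Lemma local_farkas v u : (forall v', dot (p v') u <= dot (p v) u) ->
  exists lam : T -> R, (forall t, t \in inc v -> 0 <= lam t) /\
    forall x, x *m C = p v *m C ->
    dot (p v) u - dot x u =
      \sum_(t in inc v) lam t * (beta t - dot x (l t)).
Proof.
move=> umax; have [e He] := edges v.
(* The slope of [u] along an edge divided by the slope of the inequality being relaxed: the first is
   nonpositive at a maximum, the second negative. *)
exists (fun t => dot (e t) u / dot (e t) (l t)); split.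
  move=> t tv; have [[v' ->] lt _] := He t tv.
  rewrite mulr_le0 ?invr_le0 ?(ltW lt)//.
  by rewrite dotDl dotNl subr_le0.
move=> x Hx; rewrite -opprB -dotNl -dotDl (edge_span He Hx) dot_suml -sumrN.
apply: eq_bigr => t tv; rewrite dotZl; ring.
Qed.

(** This independence makes the proper faces of the polar dual simplices. *)
Lemma tight_free v (w : T -> R) :
  \sum_(t in inc v) w t *: l t = 0 -> forall t, t \in inc v -> w t = 0.
Proof.
move=> w0 t tv; have [e He] := edges v; have [_ lt H] := He t tv.
have : dot (e t) (\sum_(t in inc v) w t *: l t) = 0 by rewrite w0 dot0r.
rewrite dot_sumr (bigD1 t) //= big1 ?addr0 => [|s /andP[sv st]].
  by rewrite dotZr => /eqP; rewrite mulf_eq0 (lt_eqF lt) orbF => /eqP.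
by rewrite dotZr H ?mulr0.
Qed.

Definition tight_face (S : {set T}) : set 'rV[R]_d :=
  P `&` [set x | forall t, t \in S -> dot x (l t) = beta t].

(** The sum of the inequalities in [S] is a single valid inequality, with equality only where each
    summand is an equality. *)
Lemma tight_face_face S : face P (tight_face S).
Proof.
exists (\sum_(t in S) l t), (\sum_(t in S) beta t); split.
  by move=> x Px; rewrite -/(dot _ _) dot_sumr; apply: ler_sum => t _; apply: (pres_le pres).
apply/seteqP; split => x [Px] /= H; split => //.
  by rewrite -/(dot _ _) dot_sumr; apply: eq_bigr => t /H.
move=> t tS; apply/eqP; rewrite eq_sym -subr_eq0; apply/eqP; move: t tS.
have : \sum_(t in S) (beta t - dot x (l t)) = 0.
  by rewrite big_split sumrN /= -dot_sumr /dot H subrr.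
by apply: psumr_eq0P => t _; rewrite subr_ge0; apply: (pres_le pres).
Qed.

Lemma tight_face_pt (S : {set T}) v : S \subset inc v -> tight_face S (p v).
Proof.
move=> Sv; split; first exact: (pres_pt pres).
by move=> t /(fintype.subsetP Sv); rewrite -(pres_tight pres) => /eqP.
Qed.

(** The functional is maximized over the finitely many [p v] only. The certificate at the best one
    shows that its value is already the bound [b], and the face consists of the points tight
    wherever the multiplier is nonzero. *)
Lemma face_tight (v0 : V) F : face P F -> F !=set0 ->
  exists2 S, S \in tight_complex inc & F = tight_face S.
Proof.
move=> [u [b [ub ->]]] [x [Px /= ux]].
pose v := [arg max_(v > v0) dot (p v) u]%O.
have umax v' : dot (p v') u <= dot (p v) u.
  by rewrite /v; case: arg_maxP => //= i _; apply.
have [lam [lam0 lamE]] := local_farkas umax.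
have affx y : P y -> y *m C = p v *m C.
  by move=> Py; apply: (pres_aff pres) Py (pres_pt pres v).
have pos y : P y -> forall t, t \in inc v -> 0 <= lam t * (beta t - dot y (l t)).
  by move=> Py t tv; rewrite mulr_ge0 ?lam0// subr_ge0; apply: (pres_le pres).
have uv : dot (p v) u = b.
  apply/eqP; rewrite eq_le (ub _ (pres_pt pres v)) /=.
  rewrite -ux -/(dot x u) -subr_ge0 lamE ?affx//.
  by apply: sumr_ge0 => t tv; apply: pos.
exists ([set t in inc v | lam t != 0]%SET).
  by apply/tight_complexP; exists v; apply/fintype.subsetP => t; rewrite inE => /andP[].
apply/seteqP; split => y [Py] /= H; split => //.
  move=> t; rewrite !inE => /andP[tv lt].
  have s0 : \sum_(t in inc v) lam t * (beta t - dot y (l t)) = 0.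
    by rewrite -lamE ?affx// uv /dot H subrr.
  have /eqP := psumr_eq0P (pos y Py) s0 tv.
  by rewrite mulf_eq0 (negPf lt) /= subr_eq0 => /eqP.
have := lamE y (affx y Py); rewrite big1 => [/eqP|t tv].
  by rewrite uv subr_eq0 => /eqP.
have [->|lt] := eqVneq (lam t) 0; first by rewrite mul0r.
by rewrite (H t) ?subrr ?mulr0// inE tv.
Qed.

Lemma tight_face_sub S S' : S \in tight_complex inc ->
  tight_face S `<=` tight_face S' <-> S' \subset S.
Proof.
move=> SK; split => [H|H].
  apply/fintype.subsetP => t tS'; apply: (flips_absorb (pres_flip pres) SK).
  by move=> v /tight_face_pt /H [_ /(_ t tS')] /eqP; rewrite (pres_tight pres).
by move=> x [Px Hx]; split => // t /(fintype.subsetP H); apply: Hx.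
Qed.

Lemma presents_realizes (v0 : V) : realizes (tight_complex inc) P.
Proof.
exists tight_face; split.
- move=> F; split => [FF|[->|[S _ ->]]]; last exact: tight_face_face.
    have [->|/set0P F0] := eqVneq F set0; [by left|right; exact: face_tight].
  exists 0, 1; split; first by move=> x _; rewrite -/(dot _ _) dot0r.
  apply/seteqP; split => // x [_] /=; rewrite -/(dot _ _) dot0r.
  by move/eqP; rewrite eq_sym oner_eq0.
- by move=> S /tight_complexP[v Sv]; exists (p v); apply: tight_face_pt.
- by move=> S S' SK _; apply: tight_face_sub.
Qed.

Lemma tight_face_vertex v : tight_face (inc v) = [set p v].
Proof.
apply/seteqP; split => [x [Px Hx]|x ->]; last exact: tight_face_pt.
have [e He] := edges v.
have := edge_span He (pres_aff pres Px (pres_pt pres v)).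
rewrite big1 => [/eqP|t tv]; first by rewrite subr_eq0 => /eqP.
by rewrite (Hx t tv) subrr mul0r scale0r.
Qed.

Lemma presents_vertices (v0 : V) : vertices P = range p.
Proof.
apply/seteqP; split => [x xF|_ [v _ <-]]; last first.
  by rewrite /vertices /= -tight_face_vertex; apply: tight_face_face.
have [|S /tight_complexP[v Sv] xS] := face_tight v0 xF; first by exists x.
by exists v => //; have := tight_face_pt Sv; rewrite -xS.
Qed.

Lemma presents_facet (v0 : V) v t : t \in inc v ->
  facet P (P `&` [set x | dot x (l t) = beta t]).
Proof.
move=> tv; have tE : P `&` [set x | dot x (l t) = beta t] = tight_face [set t]%SET.
  apply/seteqP; split => x [Px] /= H; split => //.
    by move=> s; rewrite inE => /eqP ->.
  by apply: H; rewrite inE.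
have tK : [set t]%SET \in tight_complex inc.
  by apply/tight_complexP; exists v; rewrite finset.sub1set.
rewrite tE; split; first exact: tight_face_face.
  split; first by move=> x [].
  have [v' [_ tv']] := pres_flip pres tv => /(_ _ (pres_pt pres v')) [_].
  by move=> /(_ t); rewrite inE eqxx => /(_ isT)/eqP; rewrite (pres_tight pres) (negPf tv').
move=> G Gf GP tG.
have [|S SK GE] := face_tight v0 Gf.
  by exists (p v); apply: tG; apply: tight_face_pt; rewrite finset.sub1set.
move: tG; rewrite GE tight_face_sub// finset.subset1 => /orP[/eqP->//|/eqP S0].
by case: GP => _; case; rewrite GE S0 => x Px; split => // s; rewrite inE.
Qed.

(** Replacing P by the hull of the points keeps all tight sets and makes P a polytope by
    construction. *)
Lemma presents_conv (v0 : V) : presents (conv_hull (range p)) p l beta inc C.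
Proof.
split.
- by move=> v; apply: sub_conv_hull; exists v.
- by move=> t x; apply: conv_hull_le => _ [v _ <-]; apply: tight_le.
- exact: (pres_tight pres).
- exact: (pres_flip pres).
- have H x : conv_hull (range p) x -> x *m C = p v0 *m C.
    apply: (@conv_hull_sub _ _ _ [set z | z *m C = p v0 *m C]).
      apply/convex_setP => y z a _ /= yC zC.
      by rewrite mulmxDl -!scalemxAl yC zC -scalerDl addrC subrK scale1r.
    by move=> _ [v _ <-]; apply: (pres_aff pres); apply: (pres_pt pres).
  by move=> x y /H -> /H ->.
- exact: (pres_rank pres).
Qed.

End Presented.

Lemma polytope_conv (V : finType) d (p : V -> 'rV[R]_d) (v0 : V) :
  polytope (conv_hull (range p)).
Proof.
exists (range p); split => //; last by exists (p v0), v0.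
exact: (@finite_image _ _ setT p finite_finset).
Qed.

End FaceLattice.

Section FaceMaps.
Variable R : realType.

(** The order [le] is a parameter so that the same choice argument yields combinatorial equivalences
    and, with inclusion reversed, dualities. *)
Lemma face_map d e (P : set 'rV[R]_d) (Q : set 'rV[R]_e)
    (le : set 'rV[R]_e -> set 'rV[R]_e -> Prop)
    (rel : set 'rV[R]_d -> set 'rV[R]_e -> Prop) :
  (forall G, le G G) -> (forall G G', le G G' -> le G' G -> G = G') ->
  (forall F, face P F -> exists2 G, face Q G & rel F G) ->
  (forall G, face Q G -> exists2 F, face P F & rel F G) ->
  (forall F F' G G', rel F G -> rel F' G' -> (le G G' <-> F `<=` F')) ->
  exists f : set 'rV[R]_d -> set 'rV[R]_e,
    set_bij (face P) (face Q) f /\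
    forall F F', face P F -> face P F' -> (le (f F) (f F') <-> F `<=` F').
Proof.
move=> lerefl leanti tot surj mono.
have H F : exists G, face P F -> face Q G /\ rel F G.
  have [/tot[G QG FG]|] := pselect (face P F); first by exists G.
  by exists set0.
have [f Hf] := choice H; exists f.
have mf F F' : face P F -> face P F' -> (le (f F) (f F') <-> F `<=` F').
  by move=> /Hf[_ r1] /Hf[_ r2]; apply: mono.
split => //; split.
- by move=> F /Hf[].
- move=> F F' /set_mem PF /set_mem PF' ff; apply/seteqP.
  by split; apply/mf => //; rewrite ff.
- move=> G QG; have [F PF FG] := surj G QG; exists F => //.
  have [_ Ff] := Hf F PF.
  by apply: leanti; apply/mono; eauto.
Qed.

Lemma realizes_comb_equiv (T : finType) (K : {set {set T}}) d e
    (P : set 'rV[R]_d) (Q : set 'rV[R]_e) :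
  realizes K P -> realizes K Q -> comb_equiv P Q.
Proof.
move=> [h [hf h0 hs]] [k [kf k0 ks]].
apply: (@face_map _ _ P Q (fun G G' => G `<=` G') (fun F G =>
  (F = set0 /\ G = set0) \/ exists2 S, S \in K & F = h S /\ G = k S)) => //.
- by move=> G; apply: subset_refl.
- by move=> G G' ? ?; apply/seteqP.
- move=> F /(iffLR (hf F))[->|[S SK ->]]; first by exists set0; [apply/kf|]; left.
  by exists (k S); [apply/kf|]; right; exists S.
- move=> F /(iffLR (kf F))[->|[S SK ->]]; first by exists set0; [apply/hf|]; left.
  by exists (h S); [apply/hf|]; right; exists S.
- move=> F F' G G' [[-> ->]|[S SK [-> ->]]] [[-> ->]|[S' SK' [-> ->]]].
  + by split=> _; apply: subset_refl.
  + by split=> _; apply: sub0set.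
  + have [x hx] := h0 S SK; have [y ky] := k0 S SK.
    by rewrite !classical_sets.subset0; split => E; [move: ky|move: hx]; rewrite E.
  + by rewrite ks// hs.
Qed.

(** The face lattice of a simplicial polytope with boundary complex [K]: now the empty set stands
    for the empty face, and it is [Q] itself that is kept apart. *)
Definition corealizes (T : finType) (K : {set {set T}}) (d : nat)
    (Q : set 'rV[R]_d) : Prop :=
  exists h : {set T} -> set 'rV[R]_d,
    [/\ forall F, face Q F <-> F = Q \/ exists2 S, S \in K & F = h S,
        forall S, S \in K -> h S `<` Q &
        forall S S', S \in K -> S' \in K ->
          (h S `<=` h S' <-> S \subset S')].

Lemma realizes_comb_dual (T : finType) (K : {set {set T}}) d e
    (P : set 'rV[R]_d) (Q : set 'rV[R]_e) :
  realizes K P -> corealizes K Q -> comb_dual P Q.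
Proof.
move=> [h [hf h0 hs]] [k [kf k0 ks]].
have [f [bf mf]] : exists f : set 'rV[R]_d -> set 'rV[R]_e,
    set_bij (face P) (face Q) f /\
    forall F F', face P F -> face P F' -> (f F' `<=` f F <-> F `<=` F').
  apply: (@face_map _ _ P Q (fun G G' => G' `<=` G) (fun F G =>
    (F = set0 /\ G = Q) \/ exists2 S, S \in K & F = h S /\ G = k S)) => //.
  - by move=> G; apply: subset_refl.
- by move=> G G' ? ?; apply/seteqP.
  - move=> F /(iffLR (hf F))[->|[S SK ->]]; first by exists Q; [apply/kf|]; left.
    by exists (k S); [apply/kf|]; right; exists S.
  - move=> F /(iffLR (kf F))[->|[S SK ->]]; first by exists set0; [apply/hf|]; left.
    by exists (h S); [apply/hf|]; right; exists S.
  - move=> F F' G G' [[-> ->]|[S SK [-> ->]]] [[-> ->]|[S' SK' [-> ->]]].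
    + by split=> _; apply: subset_refl.
    + by split=> _; [apply: sub0set|case: (k0 S' SK')].
    + rewrite classical_sets.subset0; split=> [|E]; first by case: (k0 S SK) => _ nQ /nQ.
      by have [x] := h0 S SK; rewrite E.
    + by rewrite ks// hs.
by exists f; split => // F F' PF PF'; rewrite mf.
Qed.

End FaceMaps.

(** * Simplicial duals *)

Section ConvHullFaces.
Variables (R : realType) (d : nat).

Lemma face_conv_hull (A : set 'rV[R]_d) u b :
  (forall y, A y -> dot y u <= b) ->
  conv_hull A `&` [set x | dot x u = b] =
  conv_hull (A `&` [set x | dot x u = b]).
Proof.
move=> Ab; set B := A `&` _.
have Bb x : conv_hull B x -> dot x u = b.
  move=> Bx; apply/eqP; rewrite eq_le (conv_hull_le _ Bx) => [|y [/Ab]//].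
  rewrite -lerN2 -dotNr; apply: (conv_hull_le _ Bx) => y [_ /= yb].
  by rewrite dotNr yb.
apply/seteqP; split => [x [Ax /= xb]|x Bx].
  (* The open half-space below the hyperplane together with the hull of [B] is convex and contains
     every generator, hence the whole hull. *)
  have : [set x | dot x u < b \/ conv_hull B x] x; last by case=> //; rewrite xb ltxx.
  apply: conv_hull_sub Ax => [|y Ay]; last first.
    have := Ab y Ay; rewrite le_eqVlt => /orP[/eqP yb|]; [right|by left].
    by apply: sub_conv_hull.
  apply/convex_setP => y z a a01; rewrite /=.
  have [->|a0] := eqVneq a 0; first by rewrite scale0r add0r subr0 scale1r.
  have [->|a1] := eqVneq a 1; first by rewrite scale1r subrr scale0r addr0.
  move: a01 => /andP[ap aq].
  have {a0}ap : 0 < a by rewrite lt_neqAle eq_sym a0.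
  have {a1}aq : 0 < 1 - a by rewrite subr_gt0 lt_neqAle a1.
  move=> [yb|By] [zb|Bz]; [left|left|left|right]; last first.
    by move/convex_setP: (@convex_conv_hull _ _ B); apply => //; apply/andP; split; lra.
  - by rewrite dotDl !dotZl (Bb y By); nra.
  - by rewrite dotDl !dotZl (Bb z Bz); nra.
  - by rewrite dotDl !dotZl; nra.
split; last exact: Bb.
by apply: conv_hull_sub Bx; [apply: convex_conv_hull|move=> y [Ay _]; apply: sub_conv_hull].
Qed.

Lemma dot_tr_eq0 (u : 'cV[R]_d) : dot u^T u <= 0 -> u = 0.
Proof.
rewrite /dot mxE => H.
have pos i : true -> 0 <= u^T 0 i * u i 0 by move=> _; rewrite mxE -expr2 sqr_ge0.
have s0 : \sum_i u^T 0 i * u i 0 = 0.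
  by apply/eqP; rewrite eq_le H sumr_ge0// => i _; apply: pos.
apply/colP => i; have /eqP := psumr_eq0P pos s0 (erefl true : true) (i := i).
by rewrite mxE mulf_eq0 orbb mxE => /eqP.
Qed.

End ConvHullFaces.

Section Duality.
Variable R : realType.
Variables (V T : finType) (d : nat) (P : set 'rV[R]_d).
Variables (p : V -> 'rV[R]_d) (l : T -> 'cV[R]_d) (beta : T -> R).
Variables (inc : V -> {set T}).
Hypothesis pres : presents P p l beta inc (0 : 'M[R]_(d, 0)).
Variables (v0 : V) (t0 : T).
Hypothesis cover : forall t, exists v, t \in inc v.

Let K := tight_complex inc.
(** The barycentre of the vertices satisfies every inequality strictly. [Q] is the polar dual of P
    about it: [q t] is the normal of the facet [t] divided by its slack at this point. *)
Let center : 'rV[R]_d := #|V|%:R^-1 *: \sum_v p v.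
Let slack t : R := beta t - dot center (l t).
Let q t : 'rV[R]_d := (slack t)^-1 *: (l t)^T.
Let Q : set 'rV[R]_d := conv_hull (range q).
Let h (S : {set T}) : set 'rV[R]_d := conv_hull [set q t | t in [set` S]].

Let slack_gt0 t : 0 < slack t.
Proof.
have V0 : (0 : R) < #|V|%:R by rewrite ltr0n; apply/card_gt0P; exists v0.
rewrite subr_gt0 dotZl dot_suml mulrC ltr_pdivrMr// mulr_natr.
have -> : beta t *+ #|V| = \sum_(v : V) beta t by rewrite sumr_const.
have [w tw] : exists w, t \notin inc w.
  have [v tv] := cover t; have [v' [_ tv']] := pres_flip pres tv.
  by exists v'.
rewrite (bigD1 w) //= [X in _ < X](bigD1 w) //=; apply: ltr_leD.
  by rewrite lt_neqAle (tight_le pres) andbT (pres_tight pres).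
by apply: ler_sum => v _; apply: (tight_le pres).
Qed.

Let dotq t w : dot (q t) w = dot w^T (l t) / slack t.
Proof.
rewrite dotZl mulrC; congr (_ / _).
by rewrite /dot -[in LHS](trmxK w) -trmx_mul mxE.
Qed.

(** The vertex [p v] seen from the center becomes a functional on [Q] with maximum 1, reached among
    the generators exactly at the [q t] with [t] tight at [v]. *)
Let a v : 'cV[R]_d := (p v - center)^T.

Let dotqa t v : dot (q t) (a v) = 1 - (beta t - dot (p v) (l t)) / slack t.
Proof.
have s0 := lt0r_neq0 (slack_gt0 t).
rewrite dotq trmxK dotDl dotNl; apply: (mulIf s0).
by rewrite divfK// mulrBl mul1r divfK// /slack; ring.
Qed.

Let dotqa_le t v : dot (q t) (a v) <= 1.
Proof.
rewrite dotqa gerBl divr_ge0 ?(ltW (slack_gt0 _))// subr_ge0.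
exact: (tight_le pres).
Qed.

Let dotqa_eq t v : (dot (q t) (a v) == 1) = (t \in inc v).
Proof.
have s0 := lt0r_neq0 (slack_gt0 t).
rewrite dotqa -subr_eq0 addrAC subrr add0r oppr_eq0 mulf_eq0 invr_eq0.
by rewrite (negPf s0) orbF subr_eq0 eq_sym (pres_tight pres).
Qed.

Let faceQ w b : (forall t, dot (q t) w <= b) ->
  Q `&` [set x | dot x w = b] = h [set t | dot (q t) w == b]%SET.
Proof.
move=> wb; rewrite face_conv_hull; last by move=> _ [t _ <-].
congr conv_hull; apply/seteqP; split => [_ [[t _ <-]] /= tb|_ [t /= tb <-]].
  by exists t => //=; rewrite inE tb.
by split; [exists t|move: tb; rewrite inE => /eqP].
Qed.

(** Averaging, up to a factor, over all vertices through the face [S]: equality at [q t] means that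
    [t] is tight at all of them, and then [flips_absorb] puts [t] in [S]. *)
Let support (S : {set T}) := \sum_(v | S \subset inc v) a v.
Let mult (S : {set T}) : R := \sum_(v | S \subset inc v) 1.

Let support_le S t : dot (q t) (support S) <= mult S.
Proof. by rewrite dot_sumr; apply: ler_sum => v _; apply: dotqa_le. Qed.

Let support_eq (S : {set T}) t : S \in K ->
  (dot (q t) (support S) == mult S) = (t \in S).
Proof.
move=> SK; apply/eqP/idP => [E|tS]; last first.
  rewrite dot_sumr; apply: eq_bigr => v Sv; apply/eqP.
  by rewrite dotqa_eq (fintype.subsetP Sv).
apply: (flips_absorb (pres_flip pres) SK) => v Sv.
have pos w : S \subset inc w -> 0 <= 1 - dot (q t) (a w).
  by move=> _; rewrite subr_ge0 dotqa_le.
have s0 : \sum_(w | S \subset inc w) (1 - dot (q t) (a w)) = 0.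
  by rewrite big_split sumrN -dot_sumr /= [dot _ _]E subrr.
by have := psumr_eq0P pos s0 Sv => /eqP; rewrite subr_eq0 eq_sym dotqa_eq.
Qed.

Let h_eq S : S \in K -> h S = Q `&` [set x | dot x (support S) = mult S].
Proof.
move=> SK; rewrite faceQ; last exact: support_le.
by congr h; apply/setP => t; rewrite inE support_eq.
Qed.

Let h_face S : S \in K -> face Q (h S).
Proof.
move=> SK; exists (support S), (mult S); split; last exact: h_eq.
by move=> x Qx; apply: (conv_hull_le _ Qx) => _ [t _ <-]; apply: support_le.
Qed.

Let mem_h S t : S \in K -> h S (q t) <-> t \in S.
Proof.
move=> SK; rewrite h_eq// -(support_eq t SK); split=> [[_ /eqP]//|/eqP E].
by split => //; apply: sub_conv_hull; exists t.
Qed.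

Let h_sub S S' : S \in K -> S' \in K -> h S `<=` h S' <-> S \subset S'.
Proof.
move=> SK SK'; split => [H|H].
  by apply/fintype.subsetP => t /(mem_h t SK)/H/(mem_h t SK').
move=> x; apply: conv_hull_sub; first exact: convex_conv_hull.
by move=> _ [t /= tS <-]; apply/mem_h => //; apply: (fintype.subsetP H).
Qed.

(** If [h S] were all of [Q], every inequality would be tight at one vertex; a flip would produce a
    vertex with fewer tight inequalities, against the constant rank. *)
Let h_proper S : S \in K -> h S `<` Q.
Proof.
move=> SK; split; first by rewrite h_eq// => x [].
case/tight_complexP: (SK) => v Sv QS.
have full : inc v = [set: T]%SET.
  apply/setP => t; rewrite [RHS]inE; apply: (fintype.subsetP Sv).
  by apply/mem_h => //; apply: QS; apply: sub_conv_hull; exists t.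
have [|v' [_ tv']] := pres_flip pres (_ : t0 \in inc v); first by rewrite full inE.
have : (#|inc v'| < #|inc v|)%N.
  by rewrite full; apply: proper_card; rewrite properT; apply: contraNneq tv' => ->; rewrite inE.
have := pres_rank pres v; have := pres_rank pres v'.
by rewrite mxrank0 !addn0 => -> ->; rewrite ltnn.
Qed.

Let face_h F : face Q F -> F = Q \/ exists2 S, S \in K & F = h S.
Proof.
move=> [w [b [Qb ->]]]; have {Qb}qb t : dot (q t) w <= b.
  by apply: Qb; apply: sub_conv_hull; exists t.
have aff x v : x *m (0 : 'M[R]_(d, 0)) = p v *m 0 by rewrite !mulmx0.
have argmax u : exists v, forall v', dot (p v') u <= dot (p v) u.
  exists [arg max_(v > v0) dot (p v) u]%O.
  by case: arg_maxP => //= i _ H v'; apply: H.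
(* For [b <= 0] no tight normal at a vertex maximal for [w] has a positive product with [w]. The
   certificate at that vertex, evaluated at the vertex moved by [w], gives |w|^2 <= 0, so the face
   is [Q]. *)
have [b0|b0] := ltrP 0 b; last first.
  have [v vmax] := argmax w.
  have [lam [lam0 /(_ (p v + w^T) (aff _ v)) lamE]] := local_farkas pres vmax.
  have w0 : w = 0.
    apply: dot_tr_eq0; rewrite -oppr_ge0.
    have -> : - dot w^T w = dot (p v) w - dot (p v + w^T) w by rewrite dotDl; ring.
    rewrite lamE; apply: sumr_ge0 => t tv; apply: mulr_ge0; first exact: lam0.
    move: (tv); rewrite -(pres_tight pres) dotDl => /eqP ->.
    rewrite opprD addrA subrr add0r oppr_ge0.
    have -> : dot w^T (l t) = dot (q t) w * slack t.
      by rewrite dotq divfK// lt0r_neq0.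
    by rewrite pmulr_lle0// (le_trans (qb t)).
  have b00 : b = 0.
    by apply: le_anti; rewrite b0 -[X in X <= _](dot0r (q t0)) -w0 qb.
  left; apply/seteqP; split => [x []//|x Qx]; split => //=.
  by rewrite b00 w0 -/(dot _ _) dot0r.
right; exists [set t | dot (q t) w == b]%SET; last first.
  by rewrite -(faceQ qb).
set S := [set t | _]%SET.
(* The pole of the hyperplane [dot x w = b]. It satisfies all inequalities, with equality exactly on
   [S], but it is not known to lie in P. *)
pose x : 'rV[R]_d := center + b^-1 *: w^T.
have xl t : dot x (l t) = beta t - slack t * (1 - dot (q t) w / b).
  have s0 := lt0r_neq0 (slack_gt0 t).
  have -> : dot (q t) w / b = b^-1 * dot w^T (l t) / slack t by rewrite dotq; ring.
  rewrite dotDl (dotZl b^-1) mulrBr mulr1 [slack t * _]mulrC divfK// /slack.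
  by ring.
(* A vertex maximizing the sum of the normals in [S] does at least as well as the pole, by its
   certificate; so all of [S] is tight there. *)
have [v vmax] := argmax (\sum_(t in S) l t).
have [lam [lam0 /(_ x (aff _ v)) lamE]] := local_farkas pres vmax.
have xS : dot x (\sum_(t in S) l t) = \sum_(t in S) beta t.
  rewrite dot_sumr; apply: eq_bigr => t; rewrite inE xl => /eqP ->.
  by rewrite divff ?lt0r_neq0// subrr mulr0 subr0.
have vS : \sum_(t in S) beta t <= dot (p v) (\sum_(t in S) l t).
  rewrite -xS -subr_ge0 lamE; apply: sumr_ge0 => t tv.
  apply: mulr_ge0; first exact: lam0.
  rewrite xl opprB addrC subrK mulr_ge0 ?(ltW (slack_gt0 t))// subr_ge0.
  by rewrite ler_pdivrMr// mul1r.
apply/tight_complexP; exists v; apply/fintype.subsetP => t tS.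
have pos s : s \in S -> 0 <= beta s - dot (p v) (l s).
  by move=> _; rewrite subr_ge0 (tight_le pres).
have s0 : \sum_(s in S) (beta s - dot (p v) (l s)) = 0.
  apply/eqP; rewrite eq_le sumr_ge0// andbT big_split sumrN -dot_sumr /=.
  by rewrite subr_le0.
have /eqP := psumr_eq0P pos s0 tS.
by rewrite subr_eq0 eq_sym (pres_tight pres).
Qed.

(** The generators of [h S] are positive multiples of normals tight at one vertex, hence independent
    even linearly. *)
Let simplex_h S : S \in K -> simplex (h S).
Proof.
move=> /tight_complexP[v Sv].
exists #|S|, (fun i => q (enum_val i)); split.
  move=> w _ w0 i.
  pose w' t : R := \sum_(j | enum_val j == t) w j / slack t.
  have : \sum_(t in inc v) w' t *: l t = 0.
    rewrite (eq_bigr (fun t => \sum_(j < #|S| | enum_val j == t)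
        (w j / slack t) *: l t)) => [|t _]; last by rewrite scaler_suml.
    rewrite (exchange_big_dep predT) //=.
    rewrite -[RHS]trmx0 -[in RHS]w0 linear_sum; apply: eq_bigr => j _ /=.
    rewrite (big_pred1 (enum_val j)) => [|t]; last first.
      rewrite /= [in RHS]eq_sym; case: eqP => [<-|]; rewrite ?andbF// andbT.
      by rewrite (fintype.subsetP Sv) ?enum_valP.
    by rewrite linearZ linearZ /= trmxK scalerA.
  move=> /(tight_free pres)/(_ (enum_val i)).
  rewrite (fintype.subsetP Sv) ?enum_valP// => /(_ isT).
  rewrite /w' (big_pred1 i) => [|j]; last by rewrite /= (inj_eq enum_val_inj).
  by move/eqP; rewrite mulf_eq0 invr_eq0 (negPf (lt0r_neq0 (slack_gt0 _))) orbF => /eqP.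
congr conv_hull; apply/seteqP; split => [_ [t /= tS <-]|_ [i _ <-]].
  by exists (enum_rank_in tS t) => //; rewrite enum_rankK_in.
by exists (enum_val i) => //=; apply: enum_valP.
Qed.

Let set1K t : [set t]%SET \in K.
Proof. by have [v tv] := cover t; apply/tight_complexP; exists v; rewrite finset.sub1set. Qed.

Let h0 : h finset.set0 = set0.
Proof.
apply/seteqP; split => // x; apply: (@conv_hull_sub _ _ _ set0); last by move=> y [t /=]; rewrite inE.
by apply/convex_setP.
Qed.

Let h1 t : h [set t]%SET = [set q t].
Proof.
apply/seteqP; split => [|_ ->]; last by apply/(mem_h _ (set1K t)); rewrite inE.
move=> x; apply: (@conv_hull_sub _ _ _ [set q t]); last by move=> _ [s /= /[!inE]/eqP -> <-].
by apply/convex_setP => y z c _ /= -> ->; rewrite -scalerDl addrC subrK scale1r.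
Qed.

Let verticesQ : vertices Q = range q.
Proof.
apply/seteqP; split => [x|_ [t _ <-]]; last by rewrite /vertices /= -h1; apply: h_face.
case/face_h => [xQ|[S SK xS]].
  by exists t0 => //; have : Q (q t0) by [apply: sub_conv_hull; exists t0]; rewrite -xQ.
have [S0|[t tS]] := set_0Vmem S.
  by move: xS; rewrite S0 h0 => /seteqP[/(_ x erefl)].
by exists t => //; have := (mem_h t SK).2 tS; rewrite -xS.
Qed.

Lemma presents_dual : exists Q : set 'rV[R]_d,
  [/\ simplicial_polytope Q, corealizes K Q & complex_iso K (boundary_complex Q)].
Proof.
exists Q; split.
- split; first exact: (polytope_conv q t0).
  by move=> F /face_h[->|[S SK ->] _]; [case|exact: simplex_h].
- exists h; split; [|exact: h_proper|exact: h_sub].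
  move=> F; split; first exact: face_h.
  move=> [->|[S SK ->]]; last exact: h_face.
  exists 0, 0; split; first by move=> x _; rewrite -/(dot _ _) dot0r.
  by apply/seteqP; split => [x Qx|x []//]; split => //=; rewrite -/(dot _ _) dot0r.
have fin : finite_set (vertices Q).
  by rewrite verticesQ; apply: (@finite_image _ _ setT q finite_finset).
have mem_fset y : (y \in fset_set (vertices Q)) = (y \in range q).
  by rewrite in_fset_set// verticesQ.
have memq t : q t \in fset_set (vertices Q).
  by rewrite mem_fset; apply: mem_set; exists t.
pose phi t : fset_set (vertices Q) := [` memq t]%fset.
have phi_surj z : exists t, z = phi t.
  have := valP z; rewrite mem_fset => /set_mem[t _ zt].
  by exists t; apply: val_inj.
have vK t : t \in complex_vertices K by rewrite inE set1K.
have phi_inj : injective phi.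
  move=> s t /(congr1 val) /= qst.
  have := (mem_h s (set1K t)).1; rewrite qst inE => H.
  by apply/eqP/H/mem_h => //; rewrite inE.
have phi_iso A : (A \in K) = ((phi @: A)%SET \in boundary_complex Q).
  rewrite [in RHS]inE; apply/idP/asboolP => [AK|[F [Ff FQ FA]]].
    exists (h A); split; [exact: h_face|exact: h_proper|move=> z].
    by have [t ->] := phi_surj z; rewrite (mem_h t AK) mem_imset.
  have [FE|[S SK FE]] := face_h Ff; first by case: FQ; rewrite FE.
  suff -> : A = S by [].
  apply/setP => t; apply/idP/idP => [tA|tS].
    by apply/(mem_h _ SK); rewrite -FE; apply: (FA (phi t)).1; rewrite mem_imset.
  rewrite -(mem_imset _ _ phi_inj); apply: (FA (phi t)).2.
  by rewrite FE; apply/mem_h.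
exists phi; split.
- by move=> s t _ _; apply: phi_inj.
- apply/setP => z; have [t ->] := phi_surj z.
  by rewrite mem_imset// vK inE -imset_set1 -phi_iso set1K.
- by move=> A _; apply: phi_iso.
Qed.

End Duality.

(** * Isomorphisms of complexes and of face lattices *)

Section ComplexIso.

Lemma complex_iso_trans (T U W : finType) (K : {set {set T}})
    (L : {set {set U}}) (N : {set {set W}}) :
  complex_iso K L -> complex_iso L N -> complex_iso K N.
Proof.
move=> [f [finj fv fK]] [g [ginj gv gL]].
have fvP x : x \in complex_vertices K -> f x \in complex_vertices L.
  by rewrite -fv; apply: imset_f.
exists (g \o f); split.
- by move=> x y xK yK /= /ginj E; apply: finj => //; apply: E; apply: fvP.
- by rewrite imset_comp fv gv.
- move=> A AK; rewrite imset_comp (fK A AK); apply: gL.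
  by rewrite -fv; apply: imsetS.
Qed.

(** In a minimal non-face with more than two elements every singleton is a face. It therefore
    contains no ghost vertex and is transported by the isomorphism, while ghost vertices only create
    minimal non-faces of size one. *)
Lemma complex_iso_flagP (T U : finType) (K : {set {set T}})
    (L : {set {set U}}) :
  complex_iso K L -> flag_complex K <-> flag_complex L.
Proof.
move=> [f [finj fv fK]].
have big (W : finType) (N : {set {set W}}) (A : {set W}) :
    minset [pred B : {set W} | B \notin N] A -> (2 < #|A|)%N ->
    A \subset complex_vertices N.
  move=> /minsetP[_ Amin] A2; apply/fintype.subsetP => x xA; rewrite inE.
  apply: contraT => /Amin; rewrite finset.sub1set => /(_ xA) E.
  by rewrite -E cards1 in A2.
have imset_card (A : {set T}) : A \subset complex_vertices K -> #|(f @: A)%SET| = #|A|.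
  move=> AK; apply: card_in_imset => x y xA yA.
  by apply: finj; apply: (fintype.subsetP AK).
have lift (B : {set U}) : B \subset complex_vertices L ->
    exists2 A : {set T}, A \subset complex_vertices K & B = (f @: A)%SET.
  move=> BL; exists (complex_vertices K :&: f @^-1: B)%SET; first exact: subsetIl.
  apply/setP => y; apply/idP/imsetP => [yB|[x /setIP[_ /[!inE] xB] ->//]].
  have := fintype.subsetP BL y yB; rewrite -fv => /imsetP[x xK yx].
  by exists x => //; rewrite !inE -yx yB andbT; rewrite inE in xK.
have subK (A B : {set T}) : A \subset complex_vertices K ->
    B \subset complex_vertices K -> (f @: A \subset f @: B)%SET -> A \subset B.
  move=> AK BK AB; apply/fintype.subsetP => x xA.
  have /imsetP[y yB /finj ->] := fintype.subsetP AB _ (imset_f f xA) => //.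
    exact: (fintype.subsetP AK).
  exact: (fintype.subsetP BK).
split=> H A Amin; rewrite leqNgt; apply/negP => A2; have AV := big _ _ _ Amin A2.
  have [A' A'K AE] := lift _ AV.
  suff /H : minset [pred B : {set T} | B \notin K] A'.
    by rewrite -imset_card// -AE leqNgt A2.
  have /minsetP[AN Am] := Amin; apply/minsetP; split=> [/=|B /= BK BA].
    by rewrite fK -?AE.
  have BV := fintype.subset_trans BA A'K.
  apply/eqP; rewrite finset.eqEsubset BA; apply: subK => //; rewrite -AE.
  by rewrite -(Am (f @: B)%SET) /= -?fK// AE imsetS.
suff /H : minset [pred B : {set U} | B \notin L] (f @: A)%SET.
  by rewrite imset_card// leqNgt A2.
have /minsetP[AN Am] := Amin; apply/minsetP; split=> [/=|B /= BL BA].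
  by rewrite -fK.
have [|B' B'K BE] := lift B.
  by apply: fintype.subset_trans BA _; rewrite -fv; apply: imsetS.
suff -> : B = (f @: A)%SET by []; rewrite BE; suff -> : B' = A by [].
by apply: Am; [rewrite /= fK -?BE|apply: subK => //; rewrite -BE].
Qed.

End ComplexIso.

Section FaceIso.
Variable R : realType.

Lemma finite_vertices d (Q : set 'rV[R]_d) : polytope Q -> finite_set (vertices Q).
Proof.
move=> [A [finA _ ->]]; apply: sub_finite_set finA => x [u [b [ub]]].
rewrite -/(conv_hull A `&` [set x | dot x u = b]) face_conv_hull => [xE|y Ay]; last first.
  by apply: ub; apply: sub_conv_hull.
have [E|/set0P[y yB]] := eqVneq (A `&` [set x | dot x u = b]) set0.
  have : [set x] x by []. rewrite xE E.
  by move/(@conv_hull_sub _ _ _ set0); case=> //; apply/convex_setP.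
have : [set x] y by rewrite xE; apply: sub_conv_hull.
by move=> <-; case: yB.
Qed.

(* The point of F farthest from the origin is exposed. *)
Lemma face_has_vertex d (Q : set 'rV[R]_d) F :
  polytope Q -> face Q F -> F !=set0 -> exists2 x, F x & vertices Q x.
Proof.
move=> [A [finA _ ->]] [u [b [ub ->]]].
rewrite -/(conv_hull A `&` [set x | dot x u = b]).
have uA y : A y -> dot y u <= b by move=> Ay; apply: ub; apply: sub_conv_hull.
rewrite face_conv_hull // => -[x0 x0F].
have [s As] : exists s : seq 'rV[R]_d, A = [set` s] by apply/finite_seqP.
pose B := [seq y <- s | dot y u == b].
have [a aB amax] : exists2 a, a \in B & forall y, y \in B -> dot y y^T <= dot a a^T.
  have: exists y, y \in B.
    apply: contrapT => nB.
    have : set0 x0; last by [].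
    apply: conv_hull_sub x0F; first by apply/convex_setP.
    move=> y [Ay /= yb]; apply: nB; exists y; rewrite mem_filter yb eqxx /=.
    by move: Ay; rewrite As.
  elim: B => [[y]//|y B IH _].
  have [[z zB]|nB] := pselect (exists z, z \in B); last first.
    exists y; rewrite ?inE ?eqxx// => z; rewrite inE => /orP[/eqP->//|zB].
    by case: nB; exists z.
  have [|a aB am] := IH; first by exists z.
  have [ya|ya] := lerP (dot y y^T) (dot a a^T).
    by exists a; rewrite ?inE ?aB ?orbT// => w; rewrite inE => /orP[/eqP->//|/am].
  exists y; rewrite ?inE ?eqxx// => w; rewrite inE => /orP[/eqP->//|/am].
  by move=> /le_trans; apply; apply: ltW.
have /andP[/eqP ab sa] : (dot a u == b) && (a \in s) by move: aB; rewrite mem_filter.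
have Aa : A a by rewrite As.
exists a; first by apply: sub_conv_hull.
(* Large enough for [lam *: u] to outweigh the functional of [a] on every generator off the face.
   The sum bounds each of its terms, and a generator on the face contributes 0, as its quotient is a
   division by zero. *)
pose lam := 1 + \sum_(y <- s) `|dot y a^T - dot a a^T| / (b - dot y u).
have slackA y : A y -> 0 <= b - dot y u by rewrite subr_ge0; apply: uA.
have lamP y : A y -> dot y u < b -> dot y a^T - dot a a^T < lam * (b - dot y u).
  move=> Ay yb; have d0 : 0 < b - dot y u by rewrite subr_gt0.
  have sy : y \in s by move: Ay; rewrite As.
  rewrite -ltr_pdivrMr//; apply: le_lt_trans (_ : `|dot y a^T - dot a a^T| / (b - dot y u) < _).
    by rewrite ler_pM2r ?invr_gt0// ler_norm.
  rewrite /lam (perm_big _ (perm_to_rem sy)) big_cons /= ltr_pwDl// lerDl.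
  rewrite big_seq sumr_ge0// => z /mem_rem zs; rewrite divr_ge0// slackA//.
  by rewrite As.
(* Expanding |y - a|^2 >= 0 and using that [a] is farthest from the origin among the generators on
   the face. *)
have far y : A y -> dot y u = b -> dot y a^T <= dot a a^T ?= iff (y == a).
  move=> Ay yb; have yB : y \in B.
    by rewrite mem_filter yb eqxx /=; move: Ay; rewrite As.
  have := amax y yB.
  have E : dot (y - a) (y - a)^T = dot y y^T + dot a a^T - dot y a^T *+ 2.
    rewrite linearB /= dotDl !dotDr !dotNl !dotNr.
    have -> : dot a y^T = dot y a^T by rewrite /dot -{1}(trmxK a) -trmx_mul mxE.
    by rewrite mulr2n; ring.
  have pos (z : 'rV[R]_d) : 0 <= dot z z^T.
    by rewrite /dot mxE sumr_ge0// => i _; rewrite mxE -expr2 sqr_ge0.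
  have := pos (y - a); rewrite E mulr2n => h1 h2; split; first by lra.
  apply/eqP/eqP => [h3|->//].
  have : dot ((y - a)^T)^T (y - a)^T <= 0 by rewrite trmxK E mulr2n; lra.
  by move/dot_tr_eq0/(congr1 trmx); rewrite trmxK trmx0 => /eqP; rewrite subr_eq0 => /eqP.
pose w := lam *: u + a^T; pose c := lam * b + dot a a^T.
have wA y : A y -> dot y w <= c ?= iff (y == a).
  move=> Ay; rewrite /w /c dotDr dotZr.
  have := uA y Ay; rewrite le_eqVlt => /orP[/eqP yb|yb].
    by have [h1 h2] := far y Ay yb; rewrite yb; split; [rewrite lerD2l|rewrite (inj_eq (addrI _))].
  have := lamP y Ay yb; rewrite mulrBr => h.
  have h' : lam * dot y u + dot y a^T < lam * b + dot a a^T by lra.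
  split; first exact: ltW.
  rewrite (lt_eqF h'); apply/esym/negbTE; apply: contraTneq yb => ->.
  by rewrite ab ltxx.
exists w, c; split.
  by move=> y Qy; apply: (conv_hull_le _ Qy) => z /wA[].
rewrite -/(conv_hull A `&` [set x | dot x w = c]) face_conv_hull; last by move=> y /wA[].
have -> : A `&` [set x | dot x w = c] = [set a].
  apply/seteqP; split => [y [Ay /= /eqP]|_ ->]; first by rewrite wA// => /eqP.
  by split=> //=; apply/eqP; rewrite wA.
apply/seteqP; split => [_ ->|]; first exact: sub_conv_hull.
move=> x; apply: (@conv_hull_sub _ _ _ [set a]) => //.
by apply/convex_setP => y z e _ /= -> ->; rewrite -scalerDl addrC subrK scale1r.
Qed.

(** Vertices are the minimal nonempty faces. The face matched with {v} is nonempty, so it contains a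
    vertex [w]; the face matched with {w} is a nonempty part of {v}. *)
Lemma iso_vertex_image d e (Q1 : set 'rV[R]_d) (Q2 : set 'rV[R]_e)
    (rel : set 'rV[R]_d -> set 'rV[R]_e -> Prop) :
  polytope Q2 ->
  (forall G, face Q1 G -> exists2 G', face Q2 G' & rel G G') ->
  (forall G', face Q2 G' -> exists2 G, face Q1 G & rel G G') ->
  (forall G H G' H', rel G G' -> rel H H' -> (G `<=` H <-> G' `<=` H')) ->
  forall v, vertices Q1 v -> exists2 w, vertices Q2 w & rel [set v] [set w].
Proof.
move=> pol tot surj mono v vQ.
have face0 c (Q : set 'rV[R]_c) : face Q set0.
  exists 0, 1; split; first by move=> x _; rewrite -/(dot _ _) dot0r.
  apply/seteqP; split => // x [_] /=; rewrite -/(dot _ _) dot0r.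
  by move/eqP; rewrite eq_sym oner_eq0.
have [G Gf vG] := tot _ vQ.
have [w Gw wQ] : exists2 w, G w & vertices Q2 w.
  apply: face_has_vertex => //; apply/set0P/eqP => G0.
  have [N Nf N0] := tot _ (face0 _ Q1).
  suff /(_ v erefl) : [set v] `<=` set0 by [].
  by apply/(mono _ _ _ _ vG N0); rewrite G0; apply: sub0set.
have [H Hf Hw] := surj _ wQ.
have Hv : H `<=` [set v] by apply/(mono _ _ _ _ Hw vG) => _ ->.
exists w => //; suff -> : [set v] = H by [].
apply/seteqP; split=> // _ ->; apply: contrapT => nHv.
have [N Nf N0] := surj _ (face0 _ Q2).
have HN : H `<=` N by move=> x Hx; case: nHv; rewrite -(Hv x Hx).
by have /(_ w erefl) := (mono _ _ _ _ Hw N0).1 HN.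
Qed.

(** Both face lattices are that of [P] reversed, so they are matched with each other. Vertices go to
    vertices, and a vertex lying in a face is a relation of the lattice, so the boundary complexes
    correspond. *)
Lemma comb_dual_boundary a d e (P : set 'rV[R]_a) (Q1 : set 'rV[R]_d)
    (Q2 : set 'rV[R]_e) : polytope Q1 -> polytope Q2 ->
  comb_dual P Q1 -> comb_dual P Q2 ->
  complex_iso (boundary_complex Q1) (boundary_complex Q2).
Proof.
move=> pol1 pol2 [f [[f1 f2 f3] mf]] [g [[g1 g2 g3] mg]].
pose rel G G' := exists2 F, face P F & G = f F /\ G' = g F.
have tot G : face Q1 G -> exists2 G', face Q2 G' & rel G G'.
  by move=> /f3[F PF <-]; exists (g F); [exact: g1|exists F].
have surj G' : face Q2 G' -> exists2 G, face Q1 G & rel G G'.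
  by move=> /g3[F PF <-]; exists (f F); [exact: f1|exists F].
have mono G H G' H' : rel G G' -> rel H H' -> (G `<=` H <-> G' `<=` H').
  by move=> [F PF [-> ->]] [F' PF' [-> ->]]; rewrite mf// mg.
have uniq2 G H H' : rel G H -> rel G H' -> H = H'.
  by move=> r1 r2; apply/seteqP; split; apply/(mono _ _ _ _ r1 r2) || apply/(mono _ _ _ _ r2 r1).
have uniq1 G G' H : rel G H -> rel G' H -> G = G'.
  by move=> r1 r2; apply/seteqP; split; apply/(mono _ _ _ _ r1 r2) || apply/(mono _ _ _ _ r2 r1).
have whole c (Q : set 'rV[R]_c) : face Q Q.
  exists 0, 0; split; first by move=> x _; rewrite -/(dot _ _) dot0r.
  by apply/seteqP; split => [x Qx|x []//]; split => //=; rewrite -/(dot _ _) dot0r.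
have face_sub c (Q F : set 'rV[R]_c) : face Q F -> F `<=` Q.
  by move=> [u [b [_ ->]]] x [].
have relQ : rel Q1 Q2.
  have [G Gf GQ] := tot _ (whole _ Q1); suff <- : G = Q2 by [].
  have [H Hf HQ] := surj _ (whole _ Q2).
  apply/seteqP; split; first exact: face_sub.
  by apply/(mono _ _ _ _ HQ GQ); apply: face_sub.
have fin1 := finite_vertices pol1; have fin2 := finite_vertices pol2.
have mem1 z : z \in fset_set (vertices Q1) <-> vertices Q1 z.
  by rewrite in_fset_set//; split; [move/set_mem|move/mem_set].
have mem2 z : z \in fset_set (vertices Q2) <-> vertices Q2 z.
  by rewrite in_fset_set//; split; [move/set_mem|move/mem_set].
have H (v : fset_set (vertices Q1)) :
    exists w : fset_set (vertices Q2), rel [set val v] [set val w].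
  have /mem1 vQ := valP v.
  have [w /mem2 wQ vw] := iso_vertex_image pol2 tot surj mono vQ.
  by exists [` wQ]%fset.
have [phi Hphi] := choice H.
have phi_surj (w : fset_set (vertices Q2)) : exists v, w = phi v.
  have /mem2 wQ := valP w.
  have [||||v /mem1 vQ vw] := @iso_vertex_image _ _ Q2 Q1 (fun G H => rel H G) _ _ _ _ _ wQ => //.
    by move=> G H0 G' H' r1 r2; rewrite (mono _ _ _ _ r1 r2).
  exists [` vQ]%fset; apply: val_inj.
  have := uniq2 _ _ _ vw (Hphi [` vQ]%fset) => /seteqP[/(_ _ erefl)].
  by [].
have phi_inj : injective phi.
  move=> v v' E; apply: val_inj; have := Hphi v'; rewrite -E => r.
  by have /seteqP[/(_ _ erefl)] := uniq1 _ _ _ (Hphi v) r.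
have memrel G G' v : rel G G' -> G (val v) <-> G' (val (phi v)).
  move=> r; have := mono _ _ _ _ (Hphi v) r => -[h1 h2]; split=> Gv.
    by apply: h1 => // _ ->.
  by apply: h2 => // _ ->.
have phiK A : (A \in boundary_complex Q1) = ((phi @: A)%SET \in boundary_complex Q2).
  rewrite !inE; apply/asboolP/asboolP => -[F [Ff FQ FA]].
    have [G Gf r] := tot _ Ff; exists G; split=> //.
      split; first exact: face_sub.
      by move=> /(mono _ _ _ _ relQ r); case: FQ.
    move=> z; have [v ->] := phi_surj z.
    by rewrite mem_imset// FA (memrel _ _ _ r).
  have [G Gf r] := surj _ Ff; exists G; split=> //.
    split; first exact: face_sub.
    by move=> /(mono _ _ _ _ relQ r); case: FQ.
  by move=> v; rewrite (memrel _ _ _ r) -FA mem_imset.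
exists phi; split.
- by move=> v v' _ _; apply: phi_inj.
- apply/setP => z; have [v ->] := phi_surj z.
  by rewrite mem_imset// [LHS]inE [RHS]inE -imset_set1 -phiK.
- by move=> A _; apply: phiK.
Qed.

Lemma flag_polytope_flag_complex (T : finType) (K : {set {set T}}) d
    (P : set 'rV[R]_d) :
  simple_polytope_of K P -> flag_polytope P -> flag_complex K.
Proof.
move=> [_ [e [Q [[polQ _] KQ PQ]]]] [_ [e' [Q' [[polQ' _] PQ' flagQ']]]].
apply/(complex_iso_flagP KQ).
by apply/(complex_iso_flagP (comb_dual_boundary polQ polQ' PQ PQ')).
Qed.

End FaceIso.

(** * Products and polytopes in coordinates *)

Section Products.
Variable R : realType.

(** Tight sets of a product are disjoint unions, so the tight complex of a product is a join. *)
Definition prod_inc (V1 V2 T1 T2 : finType) (inc1 : V1 -> {set T1})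
    (inc2 : V2 -> {set T2}) (v : V1 * V2) : {set T1 + T2} :=
  (inl @: inc1 v.1 :|: inr @: inc2 v.2)%SET.

Lemma in_prod_inc (V1 V2 T1 T2 : finType) (inc1 : V1 -> {set T1})
    (inc2 : V2 -> {set T2}) v t : (t \in prod_inc inc1 inc2 v) =
  match t with inl t => t \in inc1 v.1 | inr t => t \in inc2 v.2 end.
Proof.
rewrite finset.in_setU; case: t => t.
  rewrite mem_imset; last by move=> ? ? [].
  by rewrite orbC; case: imsetP => // -[].
rewrite [X in _ || X]mem_imset; last by move=> ? ? [].
by case: imsetP => // -[].
Qed.

Lemma card_prod_inc (V1 V2 T1 T2 : finType) (inc1 : V1 -> {set T1})
    (inc2 : V2 -> {set T2}) v :
  #|prod_inc inc1 inc2 v| = (#|inc1 v.1| + #|inc2 v.2|)%N.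
Proof.
rewrite cardsU !card_imset; try by move=> ? ? [].
rewrite [X in (_ - X)%N](_ : _ = 0)%N ?subn0//; apply/eqP; rewrite cards_eq0.
by apply/eqP/setP => t; rewrite !inE; apply/negP => /andP[/imsetP[? _ ->] /imsetP[]].
Qed.

Lemma flips_prod (V1 V2 T1 T2 : finType) (inc1 : V1 -> {set T1})
    (inc2 : V2 -> {set T2}) :
  flips inc1 -> flips inc2 -> flips (prod_inc inc1 inc2).
Proof.
move=> f1 f2 [v1 v2] [t|t]; rewrite in_prod_inc /=.
  move=> /f1[v' [sub tv']]; exists (v', v2); rewrite in_prod_inc /=; split=> //.
  apply/fintype.subsetP => -[s|s]; rewrite finset.in_setD1 !in_prod_inc//=.
  by move=> /andP[st sv]; apply: (fintype.subsetP sub); rewrite finset.in_setD1 sv andbT.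
move=> /f2[v' [sub tv']]; exists (v1, v'); rewrite in_prod_inc /=; split=> //.
apply/fintype.subsetP => -[s|s]; rewrite finset.in_setD1 !in_prod_inc//=.
by move=> /andP[st sv]; apply: (fintype.subsetP sub); rewrite finset.in_setD1 sv andbT.
Qed.

Definition prod_dir (d1 d2 : nat) (T1 T2 : finType) (l1 : T1 -> 'cV[R]_d1)
    (l2 : T2 -> 'cV[R]_d2) (t : T1 + T2) : 'cV[R]_(d1 + d2) :=
  match t with inl t => col_mx (l1 t) 0 | inr t => col_mx 0 (l2 t) end.

Definition prod_bound (T1 T2 : finType) (b1 : T1 -> R) (b2 : T2 -> R)
    (t : T1 + T2) : R := match t with inl t => b1 t | inr t => b2 t end.

Lemma presents_prod (V1 V2 T1 T2 : finType) (d1 d2 : nat)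
    (P1 : set 'rV[R]_d1) (P2 : set 'rV[R]_d2) p1 p2 l1 l2 b1 b2
    (inc1 : V1 -> {set T1}) (inc2 : V2 -> {set T2}) :
  presents P1 p1 l1 b1 inc1 (0 : 'M_(d1, 0)) ->
  presents P2 p2 l2 b2 inc2 (0 : 'M_(d2, 0)) ->
  presents (polytope_prod P1 P2) (fun v => row_mx (p1 v.1) (p2 v.2))
    (prod_dir l1 l2) (prod_bound b1 b2) (prod_inc inc1 inc2)
    (0 : 'M_(d1 + d2, 0)).
Proof.
move=> pr1 pr2.
have dotE x1 x2 t : dot (row_mx x1 x2) (prod_dir l1 l2 t) =
    match t with inl t => dot x1 (l1 t) | inr t => dot x2 (l2 t) end.
  by rewrite /dot; case: t => t /=; rewrite mul_row_col mulmx0 ?addr0 ?add0r.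
split.
- by move=> v; split; rewrite ?row_mxKl ?row_mxKr; [apply: (pres_pt pr1)|apply: (pres_pt pr2)].
- move=> t x [x1 x2]; rewrite -[x]hsubmxK dotE.
  by case: t => t /=; [apply: (pres_le pr1)|apply: (pres_le pr2)].
- move=> v t; rewrite dotE in_prod_inc.
  by case: t => t /=; [apply: (pres_tight pr1)|apply: (pres_tight pr2)].
- exact: flips_prod (pres_flip pr1) (pres_flip pr2).
- by move=> x y _ _; rewrite !mulmx0.
- move=> v; rewrite card_prod_inc mxrank0 addn0.
  have := pres_rank pr1 v.1; have := pres_rank pr2 v.2.
  by rewrite !mxrank0 !addn0 => -> ->.
Qed.

(** The index (i, true) is the facet x_i = 1 and (i, false) the facet x_i = 0; the tight complex is
    the boundary of the cross-polytope. *)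
Definition cube_inc (n : nat) (f : {ffun 'I_n -> bool}) : {set 'I_n * bool} :=
  [set t | f t.1 == t.2]%SET.

Definition cube_vertex (n : nat) (f : {ffun 'I_n -> bool}) : 'rV[R]_n :=
  \row_j (f j)%:R.

Definition cube_dir (n : nat) (t : 'I_n * bool) : 'cV[R]_n :=
  (if t.2 then 1 else -1) *: delta_mx t.1 0.

Definition cube_bound (n : nat) (t : 'I_n * bool) : R := t.2%:R.

Lemma dot_delta n (x : 'rV[R]_n) j : dot x (delta_mx j 0) = x 0 j.
Proof. by rewrite /dot -colE mxE. Qed.

Lemma card_cube_inc n (f : {ffun 'I_n -> bool}) : #|cube_inc f| = n.
Proof.
have -> : cube_inc f = [set (j, f j) | j : 'I_n]%SET.
  apply/setP => -[j b]; rewrite inE /=; apply/eqP/imsetP => [<-|[i _ [-> ->]]//].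
  by exists j.
by rewrite card_imset ?card_ord// => i j [].
Qed.

Lemma flips_cube n : flips (@cube_inc n).
Proof.
move=> f [j b]; rewrite inE /= => /eqP fj.
exists [ffun i => if i == j then ~~ b else f i]; split.
  apply/fintype.subsetP => -[i c]; rewrite !inE /= ffunE xpair_eqE.
  by case: eqP => [->|] //=; rewrite fj; case: b c {fj} => -[].
by rewrite inE /= ffunE eqxx; case: b {fj}.
Qed.

Lemma presents_cube n :
  presents (cube R n) (@cube_vertex n) (@cube_dir n) (@cube_bound n)
    (@cube_inc n) (0 : 'M_(n, 0)).
Proof.
split.
- by move=> f i; rewrite mxE; case: (f i); rewrite ?lexx ler01.
- move=> [j b] x /(_ j)/andP[x0 x1]; rewrite dotZr dot_delta /cube_bound /=.
  by case: b; rewrite ?mul1r// mulN1r oppr_le0.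
- move=> f [j b]; rewrite dotZr dot_delta /cube_bound !inE /= mxE.
  case: b; case: (f j); rewrite ?mul1r ?mulN1r ?oppr0 ?eqxx//.
    by rewrite eq_sym oner_eq0.
  by rewrite oppr_eq0 oner_eq0.
- exact: flips_cube.
- by move=> x y _ _; rewrite !mulmx0.
- by move=> f; rewrite card_cube_inc mxrank0 addn0.
Qed.

End Products.

(* A full-dimensional simple polytope in coordinates: the vertices are
   [xpts / xscale], the facets [xdirs x <= xbnds], and [xinc] lists the facets
   through each vertex. *)
Record polydata := PolyData {
  xdim : nat; xinc : seq (seq nat);
  xscale : nat; xpts : seq (seq int); xdirs : seq (seq int); xbnds : seq int }.

Definition xsize (X : polydata) : nat := size (xdirs X).
Definition xverts (X : polydata) : nat := size (xinc X).

Definition dotz (k : nat) (u w : seq int) : int :=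
  foldr (fun i a => u`_i * w`_i + a) 0 (iota 0 k).

(** Besides sizes: each facet through a vertex can be flipped away, and each inequality holds at
    each vertex, with equality exactly on the listed facets. Coordinates are integers over a common
    denominator so that all this can be computed. *)
Definition polydata_ok (X : polydata) : bool :=
  [&& (0 < xscale X)%N, (0 < xverts X)%N,
   all (fun I => [&& uniq I, size I == xdim X & all (gtn (xsize X)) I]) (xinc X),
   all (fun I => all (fun t => has (fun J => (t \notin J) &&
     all (fun s => (s == t) || (s \in J)) I) (xinc X)) I) (xinc X) &
   all (fun v => all (fun t =>
     let a := dotz (xdim X) (nth [::] (xpts X) v) (nth [::] (xdirs X) t) in
     let b := (xscale X)%:Z * (xbnds X)`_t in
     (a <= b) && ((a == b) == (t \in nth [::] (xinc X) v)))
     (iota 0 (xsize X))) (iota 0 (xverts X))].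

Section PolyDataGeometry.
Variables (R : realType) (X : polydata).
Hypothesis Xok : polydata_ok X.

Definition xincs (v : 'I_(xverts X)) : {set 'I_(xsize X)} :=
  [set t : 'I_(xsize X) | val t \in nth [::] (xinc X) v]%SET.
Definition xpt (v : 'I_(xverts X)) : 'rV[R]_(xdim X) :=
  \row_i (((nth [::] (xpts X) v)`_i)%:~R / (xscale X)%:R).
Definition xdir (t : 'I_(xsize X)) : 'cV[R]_(xdim X) :=
  \col_i ((nth [::] (xdirs X) t)`_i)%:~R.
Definition xbnd (t : 'I_(xsize X)) : R := ((xbnds X)`_t)%:~R.

Lemma dot_xpt v t : dot (xpt v) (xdir t) =
  (dotz (xdim X) (nth [::] (xpts X) v) (nth [::] (xdirs X) t))%:~R / (xscale X)%:R.
Proof.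
rewrite /dot mxE; set u := nth _ _ v; set w := nth _ _ t.
rewrite (eq_bigr (fun i : 'I__ => (u`_i * w`_i)%:~R / (xscale X)%:R)) => [|i _]; last first.
  by rewrite !mxE intrM mulrAC.
rewrite -mulr_suml -rmorph_sum /=; congr (_%:~R / _).
by rewrite -(big_mkord xpredT (fun i => u`_i * w`_i)) unlock /index_iota subn0.
Qed.

Lemma xscale_gt0 : (0 : R) < (xscale X)%:R.
Proof. by rewrite ltr0n; case/and5P: Xok. Qed.

Lemma xdata_dot v t :
  (dot (xpt v) (xdir t) <= xbnd t) /\
  (dot (xpt v) (xdir t) == xbnd t) = (t \in xincs v).
Proof.
have /and5P[_ _ _ _ /allP/(_ (val v))] := Xok.
rewrite mem_iota /= ltn_ord => /(_ isT)/allP/(_ (val t)).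
rewrite mem_iota /= ltn_ord => /(_ isT)/andP[h1 /eqP h2].
rewrite dot_xpt ler_pdivrMr ?xscale_gt0// inE -h2 /xbnd.
have -> : ((xbnds X)`_t)%:~R * (xscale X)%:R = ((xscale X)%:Z * (xbnds X)`_t)%:~R :> R.
  by rewrite intrM mulrC.
split; first by rewrite ler_int.
rewrite -(inj_eq (mulIf (lt0r_neq0 xscale_gt0))) divfK ?lt0r_neq0 ?xscale_gt0//.
have -> : ((xbnds X)`_t)%:~R * (xscale X)%:R = ((xscale X)%:Z * (xbnds X)`_t)%:~R :> R.
  by rewrite intrM mulrC.
by rewrite eqr_int.
Qed.

Let nth_inc (v : 'I_(xverts X)) : nth [::] (xinc X) v \in xinc X.
Proof. exact: mem_nth. Qed.

Lemma card_xincs v : #|xincs v| = xdim X.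
Proof.
have /and5P[_ _ /allP/(_ _ (nth_inc v))/and3P[uI /eqP sI /allP aI] _ _] := Xok.
rewrite -sI cardE -(size_map val); apply/perm_size/uniq_perm => //.
  by rewrite map_inj_uniq ?enum_uniq//; apply: val_inj.
move=> i; apply/mapP/idP => [[t]|iI]; first by rewrite mem_enum inE => tI ->.
by exists (Ordinal (aI i iI)) => //; rewrite mem_enum inE.
Qed.

Lemma flips_xincs : flips xincs.
Proof.
move=> v t; rewrite inE => tv.
have /and5P[_ _ _ /allP/(_ _ (nth_inc v))/allP/(_ _ tv)/hasP[J JX /andP[tJ /allP sub]] _] := Xok.
have Jn : (index J (xinc X) < xverts X)%N by rewrite index_mem.
exists (Ordinal Jn); rewrite inE /= nth_index//; split=> //.
apply/fintype.subsetP => s; rewrite !inE /= nth_index// => /andP[st /sub].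
by rewrite (negPf st : (val s == val t) = false).
Qed.

Lemma presents_polydata (P : set 'rV[R]_(xdim X)) :
  (forall v, P (xpt v)) ->
  (forall t x, P x -> dot x (xdir t) <= xbnd t) ->
  presents P xpt xdir xbnd xincs (0 : 'M_(xdim X, 0)).
Proof.
move=> Pp Pl; split=> //.
- by move=> v t; have [_] := xdata_dot v t.
- exact: flips_xincs.
- by move=> x y _ _; rewrite !mulmx0.
- by move=> v; rewrite card_xincs mxrank0 addn0.
Qed.

Lemma presents_polydata_conv :
  presents (conv_hull (range xpt)) xpt xdir xbnd xincs (0 : 'M_(xdim X, 0)).
Proof.
apply: presents_polydata => [v|t x]; first by apply: sub_conv_hull; exists v.
by apply: conv_hull_le => _ [v _ <-]; have [] := xdata_dot v t.
Qed.

End PolyDataGeometry.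

(** * Nestohedra *)

(** [nbase] lists the proper members of a connected building set on {0..k}, one for each facet and
    in the same order. [nord] ranks {0..k} for each vertex, which is the sum over the members S of
    e_i with i the top of S. *)
Record nestdata := NestData { nbase : seq (seq nat); nord : seq (seq nat) }.

Definition topmost (o : seq nat) (S : seq nat) (i : nat) : bool :=
  all (fun i' => nth 0%N o i' <= nth 0%N o i)%N S.

Definition subl (S S' : seq nat) : bool := all (mem S') S.

(** The facet of a member S bounds the sum of the x_i over S from below by the number of members
    inside S. At the point of a ranking it is tight iff every member with its top in S lies inside
    S; the last check compares this with the tight sets of [X]. For k = 0 the only singleton is the
    full set, which [nbase] omits. *)
Definition nestdata_ok (X : polydata) (Y : nestdata) : bool :=
  let k := xdim X in
  let full := iota 0 k.+1 in
  let base := nbase Y in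
  [&& size base == xsize X,
   all (fun S => [&& S != [::], subl S full & ~~ subl full S]) base,
   (k == 0)%N || all (fun i => has (fun S => subl S [:: i]) base) full,
   all (fun S => all (fun S' => has (mem S') S ==>
      has (fun U => subl U (S ++ S') && subl (S ++ S') U) (full :: base)) base) base &
   all (fun o => all (geq k) o) (nord Y) &&
   all (fun w => let o := nth [::] (nord Y) w in
     all (fun t => let S := nth [::] base t in
       if t \in nth [::] (xinc X) w then
         all (fun S' => all (fun i => topmost o S' i ==> (i \in S) ==> subl S' S) S')
           (full :: base)
       else
         has (fun S' => all (fun i => topmost o S' i ==> (i \in S)) S' && ~~ subl S' S)
           (full :: base)) (iota 0 (xsize X))) (iota 0 (xverts X))].

Section Nestohedron.
Variables (X : polydata) (Y : nestdata) (n : nat).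
Hypothesis Xok : polydata_ok X.
Hypothesis Yok : nestdata_ok X Y.

Notation k := (xdim X).
Notation N := (n + xdim X)%N.
Notation T := ('I_n * bool + 'I_(xsize X))%type.
Notation V := ({ffun 'I_n -> bool} * 'I_(xverts X))%type.

Let base t : seq nat := nth [::] (nbase Y) t.
Let ordr w : seq nat := nth [::] (nord Y) w.
Definition nest_seg j : {set 'I_N.+1} := [set i : 'I_N.+1 | i <= k + j]%N%SET.
Let seg := nest_seg.

(* Adding to a building set on {0..k} the element k+1+j and the segment
   {0..k+j}, for each j < n, multiplies its nestohedron by an n-cube. *)
Definition nest_set (t : T) : {set 'I_N.+1} :=
  match t with
  | inl (j, b) => if b then [set i : 'I_N.+1 | i == (k + j).+1 :> nat]%SET
                  else nest_seg j
  | inr a => [set i : 'I_N.+1 | (i : nat) \in nth [::] (nbase Y) a]%SET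
  end.

Definition nest_building : {set {set 'I_N.+1}} :=
  ([set: 'I_N.+1] |: [set nest_set t | t : T])%SET.

Let B := nest_building.

(** Elements of {0..k} have keys between n and n + k. The added element k+1+j is ranked below all of
    them when its singleton is to be tight, and above every earlier element when the segment
    {0..k+j} is to be tight. *)
Let key (v : V) (i : nat) : nat :=
  if (i <= k)%N then (n + nth 0%N (ordr v.2) i)%N
  else match insub (i - k.+1)%N with
       | Some j => if v.1 j then (j : nat) else (n + k.+1 + j)%N
       | None => 0%N end.

Let mem_full y : (y \in iota 0 k.+1) = (y <= k)%N.
Proof. by rewrite mem_iota. Qed.

Let base_mem a : (a < xsize X)%N -> base a \in nbase Y.
Proof. by case/and5P: Yok => /eqP <- _ _ _ _ aX; apply: mem_nth. Qed.

Let base_ok a : (a < xsize X)%N ->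
  [/\ base a != [::], forall i, i \in base a -> (i <= k)%N
    & exists2 i, (i <= k)%N & i \notin base a].
Proof.
case/and5P: Yok => _ /allP H _ _ _ /base_mem/H/and3P[-> /allP h1 /allPn[i]].
rewrite mem_full => /= ik ib; split=> //; last by exists i.
by move=> j /h1; rewrite inE mem_full.
Qed.

Let seg_B j : (j <= n)%N -> seg j \in B.
Proof.
rewrite leq_eqVlt => /orP[/eqP->|jn]; rewrite !inE.
  by apply/orP; left; apply/eqP/setP => i; rewrite !inE; have := ltn_ord i; lia.
by apply/orP; right; apply/imsetP; exists (inl (Ordinal jn, false)).
Qed.

Let segT : seg n = [set: 'I_N.+1]%SET.
Proof. by apply/setP => i; rewrite !inE; have := ltn_ord i; lia. Qed.

Let baseset a : {set 'I_N.+1} := [set i : 'I_N.+1 | (i : nat) \in base a]%SET.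
Let single (j : nat) : {set 'I_N.+1} := [set i : 'I_N.+1 | i == (k + j).+1 :> nat]%SET.

Let in_B S : S \in B ->
  [\/ exists2 j, (j <= n)%N & S = seg j, exists2 a, (a < xsize X)%N & S = baseset a
    | exists2 j, (j < n)%N & S = single j].
Proof.
rewrite !inE => /orP[/eqP ->|/imsetP[[[j []]|a] _ ->]].
- by apply: Or31; exists n; rewrite ?segT.
- by apply: Or33; exists j.
- by apply: Or31; exists j => //; apply: ltnW.
- by apply: Or32; exists a.
Qed.

Let baseset_B a : (a < xsize X)%N -> baseset a \in B.
Proof. by move=> aX; rewrite !inE; apply/orP; right; apply/imsetP; exists (inr (Ordinal aX)). Qed.

Let single_B j : (j < n)%N -> single j \in B.
Proof. by move=> jn; rewrite !inE; apply/orP; right; apply/imsetP; exists (inl (Ordinal jn, true)). Qed.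

Let elt i : (i <= k)%N -> (i < N.+1)%N.
Proof. by move=> ik; rewrite ltnS (leq_trans ik)// leq_addl. Qed.

(** Every base set lies in every segment, and a singleton meeting a segment lies in it, so a union
    with a segment is again a segment. Only two base sets that meet need the tabulated check. *)
Lemma nest_building_connected : connected_building_set B.
Proof.
split; last by rewrite !inE eqxx.
split.
- apply/negP => /in_B[[j _ /setP/(_ ord0)]|[a aX]|[j jn]].
  + by rewrite !inE.
  + have [] := base_ok aX; case E: (base a) => [|i s] // _ /(_ i (mem_head _ _)) ik _.
    by move=> /setP/(_ (Ordinal (elt ik))); rewrite !inE /= E mem_head.
  + have jN : ((k + j).+1 < N.+1)%N by rewrite ltnS addnC ltn_add2r.
    by move=> /setP/(_ (Ordinal jN)); rewrite !inE /= eqxx.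
- move=> i; have [ik|ki] := leqP i k; last first.
    have jn : (i - k.+1 < n)%N by have := ltn_ord i; lia.
    suff -> : [set i]%SET = single (i - k.+1) by apply: single_B.
    by apply/setP => j; rewrite !inE -val_eqE /=; congr (_ == _); lia.
  have /and5P[/eqP sb _ /orP[/eqP k0|/allP H] _ _] := Yok.
    suff -> : [set i]%SET = seg 0 by apply: seg_B.
    by apply/setP => j; rewrite !inE -val_eqE /= addn0; lia.
  have /H/hasP[S SY /allP Si] : (i : nat) \in iota 0 k.+1 by rewrite mem_full.
  have aX : (index S (nbase Y) < xsize X)%N by rewrite -sb index_mem.
  suff -> : [set i]%SET = baseset (index S (nbase Y)) by apply: baseset_B.
  have [S0 _ _] := base_ok aX; rewrite /base nth_index// in S0.
  apply/setP => j; rewrite !inE /base nth_index// -val_eqE /=.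
  have {}Si l : l \in S -> l = i by move=> /Si; rewrite !inE => /eqP.
  apply/eqP/idP => [->|/Si//]; case: S S0 Si {SY aX} => // l S _ Si.
  by rewrite -(Si l) mem_head.
- have meet_seg j S : (j <= n)%N -> S \in B -> (seg j :&: S)%SET != finset.set0 ->
      (seg j :|: S)%SET \in B.
    move=> jn SB /set0Pn[x /setIP[xj xS]].
    case/in_B: SB xS => [[j' jn' ->]|[a aX ->]|[j' jn' ->]] xS.
    + have [jj|jj] := leqP j j'.
        suff -> : (seg j :|: seg j')%SET = seg j' by apply: seg_B.
        by apply/finset.setUidPr/fintype.subsetP => i; rewrite !inE; lia.
      suff -> : (seg j :|: seg j')%SET = seg j by apply: seg_B.
      by apply/finset.setUidPl/fintype.subsetP => i; rewrite !inE; lia.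
    + suff -> : (seg j :|: baseset a)%SET = seg j by apply: seg_B.
      apply/finset.setUidPl/fintype.subsetP => i; rewrite !inE.
      by have [_ H _] := base_ok aX => /H; lia.
    + suff -> : (seg j :|: single j')%SET = seg j by apply: seg_B.
      by apply/finset.setUidPl/fintype.subsetP => i; move: xS xj; rewrite !inE; lia.
  move=> S S' SB S'B; case/in_B: (SB) => [[j jn ->]|[a aX SE]|[j jn SE]].
  + exact: meet_seg.
  + case/in_B: (S'B) => [[j jn ->]|[a' a'X S'E]|[j jn S'E]].
    * by rewrite finset.setIC finset.setUC; apply: meet_seg.
    * move=> /set0Pn[x]; rewrite SE S'E => /finset.setIP[]; rewrite [x \in _]inE => xa; rewrite [x \in _]inE => xa'.
      have /and5P[/eqP sb _ _ /allP/(_ _ (base_mem aX))/allP/(_ _ (base_mem a'X)) H _] := Yok.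
      have aa' : has (mem (base a')) (base a) by apply/hasP; exists (x : nat).
      have /hasP[U UY /andP[/allP US /allP SU]] := implyP H aa'.
      have E (i : 'I_N.+1) : (i \in baseset a :|: baseset a')%SET = ((i : nat) \in U).
        rewrite !inE -mem_cat; apply/idP/idP; [exact: SU|exact: US].
      move: UY; rewrite inE => /orP[/eqP UE|UY].
        suff -> : (baseset a :|: baseset a')%SET = seg 0 by apply: seg_B.
        by apply/setP => i; rewrite E UE mem_iota !inE addn0 ltnS.
      suff -> : (baseset a :|: baseset a')%SET = baseset (index U (nbase Y)).
        by apply: baseset_B; rewrite -sb index_mem.
      by apply/setP => i; rewrite E !inE /base nth_index.
    * move=> /set0Pn[x]; rewrite SE S'E => /finset.setIP[]; rewrite [x \in _]inE => xa; rewrite [x \in _]inE => /eqP xj.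
      by have [_ /(_ _ xa) H _] := base_ok aX; lia.
  + case/in_B: (S'B) => [[j' jn' ->]|[a' a'X S'E]|[j' jn' S'E]].
    * by rewrite finset.setIC finset.setUC; apply: meet_seg.
    * move=> /set0Pn[x]; rewrite SE S'E => /finset.setIP[]; rewrite [x \in _]inE => /eqP xj; rewrite [x \in _]inE => xa.
      by have [_ /(_ _ xa) H _] := base_ok a'X; lia.
    * move=> /set0Pn[x]; rewrite SE S'E => /finset.setIP[]; rewrite [x \in _]inE => /eqP xj; rewrite [x \in _]inE => /eqP xj'.
      have -> : j' = j by lia.
      by rewrite finset.setUid; apply: single_B.
Qed.

Let topkey (v : V) (S : {set 'I_N.+1}) (i : 'I_N.+1) :=
  i \in S /\ forall i' : 'I_N.+1, i' \in S -> (key v i' <= key v i)%N.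

Let key_base v i : (i <= k)%N -> key v i = (n + nth 0%N (ordr v.2) i)%N.
Proof. by rewrite /key => ->. Qed.

Let key_base_bounds v i : (i <= k)%N -> (n <= key v i <= n + k)%N.
Proof.
move=> ik; rewrite key_base// leq_addr leq_add2l /=.
have /and5P[_ _ _ _ /andP[/allP H _]] := Yok.
have [io|io] := ltnP i (size (ordr v.2)); last by rewrite nth_default.
have [wo|wo] := ltnP v.2 (size (nord Y)).
  by have /allP := H _ (mem_nth [::] wo); apply; apply: mem_nth.
by rewrite /ordr (nth_default _ wo) nth_nil.
Qed.

Let key_high v (j : 'I_n) :
  key v (k + j).+1 = if v.1 j then (j : nat) else (n + k.+1 + j)%N.
Proof.
rewrite /key ltnNge leq_addr /= subSS addKn.
by rewrite (_ : insub _ = Some j) //; apply: valK.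
Qed.

Let key_lt v (j : 'I_n) i : (i <= k + j)%N -> (key v i < n + k.+1 + j)%N.
Proof.
have [ik _|ki ij] := leqP i k; first by have := key_base_bounds v ik; lia.
have jn : (i - k.+1 < n)%N by have := ltn_ord j; lia.
have -> : i = (k + Ordinal jn).+1 :> nat by rewrite /=; lia.
by rewrite key_high; case: ifP => _ /=; have := ltn_ord j; lia.
Qed.

Let base_check (w : 'I_(xverts X)) (a : 'I_(xsize X)) :
  let full := iota 0 k.+1 in let o := ordr w in
  if a \in xincs w then
     forall S', S' \in full :: nbase Y -> forall i, i \in S' ->
       topmost o S' i -> i \in base a -> subl S' (base a)
  else exists2 S', S' \in full :: nbase Y & 
     (forall i, i \in S' -> topmost o S' i -> i \in base a) /\ ~~ subl S' (base a).
Proof.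
have wX : val w \in iota 0 (xverts X) by rewrite mem_iota ltn_ord.
have aX : val a \in iota 0 (xsize X) by rewrite mem_iota ltn_ord.
have /and5P[_ _ _ _ /andP[_ /allP/(_ _ wX)/allP/(_ _ aX)]] := Yok.
move=> H full o; move: H; rewrite inE; case: ifP => _.
  move=> H S' S'f i iS ti ia.
  by move: (allP H _ S'f) => /allP/(_ i iS); rewrite ti ia.
move=> /hasP[S' S'f /andP[/allP H nS]]; exists S' => //; split=> // i iS ti.
by have := H i iS; rewrite ti.
Qed.

(* [nest_tight] is the tightness of the inequality of [nest_set t] at the point
   sum_S e_(top S), for the tops taken with respect to [key v]. *)
Let nest_tight v t S i : t \in prod_inc (@cube_inc n) (@xincs X) v ->
  S \in B -> topkey v S i -> i \in nest_set t -> S \subset nest_set t.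
Proof.
case: v => f w; rewrite in_prod_inc; case: t => [[j b]|a] /=; last first.
  move=> aw SB [iS imax]; rewrite inE => ia; have := base_check w a.
  have [_ basek [x xk xa]] := base_ok (ltn_ord a); have ik := basek _ ia.
  rewrite aw => H; case/in_B: (SB) => [[l ln SE]|[a' a'X SE]|[l ln SE]].
  - suff /allP/(_ x) : subl (iota 0 k.+1) (base a).
      by rewrite mem_full => /(_ xk); rewrite /= (negPf xa).
    apply: (H _ _ i) => //; rewrite ?mem_head ?mem_full//.
    apply/allP => y; rewrite mem_full => yk.
    have := imax (Ordinal (elt yk)); rewrite SE !inE /= (leq_trans yk (leq_addr _ _)).
    by move=> /(_ isT); rewrite !key_base// leq_add2l.
  - have a'i : (i : nat) \in base a' by move: iS; rewrite SE inE.
    have /allP sub : subl (base a') (base a).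
      apply: (H _ _ i) => //; first by rewrite inE base_mem// orbT.
      apply/allP => y yb; have [_ /(_ _ yb) yk _] := base_ok a'X.
      have := imax (Ordinal (elt yk)); rewrite SE !inE /= => /(_ yb).
      by rewrite !key_base// leq_add2l.
    by apply/fintype.subsetP => y; rewrite SE !inE => /sub.
  - by move: iS; rewrite SE inE => /eqP; lia.
rewrite inE /= => /eqP fj SB [iS imax]; case: b fj => fj it.
  move: it; rewrite inE => /eqP it.
  have kj : key (f, w) i = j by rewrite it key_high /= fj.
  case/in_B: (SB) => [[l ln SE]|[a' a'X SE]|[l ln SE]].
  - have := imax ord0; rewrite SE inE /= leq0n kj => /(_ isT).
    have /andP[nk _] := key_base_bounds (f, w) (leq0n k).
    by move=> /(leq_trans nk); rewrite leqNgt ltn_ord.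
  - by move: iS; rewrite SE inE => ia; have [_ /(_ _ ia)] := base_ok a'X; lia.
  - move: iS; rewrite SE inE it => /eqP E; apply/fintype.subsetP => y.
    by rewrite !inE E.
move: it; rewrite inE => it.
case/in_B: (SB) => [[l ln SE]|[a' a'X SE]|[l ln SE]].
- have [lj|jl] := leqP l j; first by apply/fintype.subsetP => y; rewrite SE !inE; lia.
  have jN : ((k + j).+1 < N.+1)%N by have := ltn_ord j; lia.
  have jl' : (k + j < k + l)%N by lia.
  have := imax (Ordinal jN); rewrite SE inE /= key_high /= fj => /(_ jl').
  by rewrite leqNgt key_lt.
- apply/fintype.subsetP => y; rewrite SE !inE => yb.
  by have [_ /(_ _ yb)] := base_ok a'X; lia.
- by apply/fintype.subsetP => y; move: iS; rewrite SE !inE => /eqP E /eqP ->; rewrite -E.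
Qed.

Let nest_loose v t : t \notin prod_inc (@cube_inc n) (@xincs X) v ->
  exists2 S, S \in B &
    (forall i, topkey v S i -> i \in nest_set t) /\ ~~ (S \subset nest_set t).
Proof.
case: v => f w; rewrite in_prod_inc; case: t => [[j b]|a] /=; last first.
  move=> naw; have := base_check w a; cbv zeta; rewrite (negPf naw) => -[S'].
  rewrite inE => /orP[/eqP ->|SY] [H nS].
    exists (seg 0); first exact: seg_B.
    split=> [i [iS imax]|].
      move: iS; rewrite !inE addn0 => ik; apply: H; first by rewrite mem_full.
      apply/allP => y; rewrite mem_full => yk.
      have := imax (Ordinal (elt yk)); rewrite !inE /= addn0 yk => /(_ isT).
      by rewrite !key_base// leq_add2l.
    apply: contra nS => /fintype.subsetP sub; apply/allP => y; rewrite mem_full => yk.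
    by have := sub (Ordinal (elt yk)); rewrite !inE addn0; apply.
  have /and5P[/eqP sb _ _ _ _] := Yok.
  have aX : (index S' (nbase Y) < xsize X)%N by rewrite -sb index_mem.
  have aE : base (index S' (nbase Y)) = S' by rewrite /base nth_index.
  have [_ S'k _] := base_ok aX; rewrite aE in S'k.
  exists (baseset (index S' (nbase Y))); first exact: baseset_B.
  split=> [i [iS imax]|].
    move: iS; rewrite !inE aE => iS; have ik := S'k _ iS; apply: H => //.
    apply/allP => y yS; have yk := S'k _ yS.
    have := imax (Ordinal (elt yk)); rewrite !inE /= aE => /(_ yS).
    by rewrite !key_base// leq_add2l.
  apply: contra nS => /fintype.subsetP sub; apply/allP => y yS; have yk := S'k _ yS.
  by have := sub (Ordinal (elt yk)); rewrite !inE /= aE; apply.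
(* The segment ending with the added element k+1+j: that element is its top when [f j] is false, and
   some earlier element is when [f j] is true. *)
rewrite inE /= => fj; exists (seg j.+1); first by apply: seg_B.
have jN : ((k + j).+1 < N.+1)%N by have := ltn_ord j; lia.
split=> [i [iS imax]|].
  have := imax (Ordinal jN); move: iS; rewrite !inE /= addnS leqnn key_high /=.
  move=> ij /(_ isT) jmax; case: b fj => fj; rewrite inE; last first.
    apply: contraT => nij; have iE : (i : nat) = (k + j).+1 by lia.
    have := imax ord0; rewrite inE /= leq0n iE key_high /= => /(_ isT).
    have -> : f j by case: (f j) fj.
    have /andP[nk _] := key_base_bounds (f, w) (leq0n k).
    by move=> /(leq_trans nk); rewrite leqNgt ltn_ord.
  apply: contraT => nij; have iE : (i <= k + j)%N by lia.
  move: jmax; have -> : f j = false by case: (f j) fj.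
  by rewrite leqNgt key_lt.
apply/negP => /fintype.subsetP sub; case: b fj sub => _ sub.
  by have := sub ord0; rewrite !inE => /(_ isT).
by have := sub (Ordinal jN); rewrite !inE /= addnS leqnn => /(_ isT); rewrite ltnn.
Qed.

Variable R : realType.

(** The facets of a nestohedron are lower bounds on partial coordinate sums, whereas [presents]
    expects upper bounds; hence the sign. *)
Let nest_dir (t : T) : 'cV[R]_N.+1 := - \sum_(i in nest_set t) delta_mx i 0.
Let nest_bound (t : T) : R := - \sum_(S in B) (S \subset nest_set t)%:R.

Let coord_simplex_facts (S : {set 'I_N.+1}) (x : 'rV[R]_N.+1) :
  coord_simplex S x ->
  [/\ forall i, 0 <= x 0 i & forall A : {set 'I_N.+1}, S \subset A ->
     \sum_(i in A) x 0 i = 1].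
Proof.
apply: (@conv_hull_sub _ _ _ [set x : 'rV[R]_N.+1 | [/\ forall i, 0 <= x 0 i &
   forall A : {set 'I_N.+1}, S \subset A -> \sum_(i in A) x 0 i = 1]]).
  apply/convex_setP => y z a /andP[a0 a1] [y0 y1] [z0 z1]; split=> [i|A SA].
    by rewrite !mxE addr_ge0// mulr_ge0// subr_ge0.
  under eq_bigr do rewrite !mxE.
  by rewrite big_split -!mulr_sumr /= y1// z1// !mulr1 addrC subrK.
move=> _ [i iS ->]; split=> [j|A SA]; first by rewrite mxE eqxx ler0n.
rewrite (bigD1 i) ?(fintype.subsetP SA)//= big1 => [|j /andP[_ ji]].
  by rewrite mxE !eqxx addr0.
by rewrite mxE eqxx (negPf ji).
Qed.

Let dot_nest_dir x t : dot x (nest_dir t) = - \sum_(i in nest_set t) x 0 i.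
Proof.
by rewrite dotNr dot_sumr; under eq_bigr do rewrite dot_delta.
Qed.

(** The bound holds summand by summand, since a simplex inside [nest_set t] contributes 1 and any
    other at least 0; so it is tight iff it is tight in each summand. The coordinates of every point
    add up to the number of members, whence the single column of ones. *)
Lemma presents_nestohedron : exists p l beta,
  presents (@minkowski_sum R N B) p l beta (prod_inc (@cube_inc n) (@xincs X))
    (const_mx 1 : 'cV[R]_N.+1).
Proof.
have Htop (vS : V * {set 'I_N.+1}) : exists i, vS.2 \in B -> topkey vS.1 vS.2 i.
  case: vS => v S; have [SB|nSB] /= := boolP (S \in B); last by exists ord0.
  have /set0Pn[i0 i0S] : S != finset.set0.
    by case: nest_building_connected => [[+ _ _] _]; apply: contraNneq => <-.
  have [i iS imax] := @arg_maxnP _ i0 (mem S) (fun i => key v i) i0S.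
  by exists i => _; split.
have [top' topP'] := choice Htop.
pose top v S := top' (v, S).
have topP v S : S \in B -> topkey v S (top v S) by move=> SB; apply: (topP' (v, S)).
pose p v : 'rV[R]_N.+1 := \sum_(S in B) delta_mx 0 (top v S).
exists p, nest_dir, nest_bound.
have dot_p v t : dot (p v) (nest_dir t) =
    - \sum_(S in B) (top v S \in nest_set t)%:R.
  rewrite dot_nest_dir; congr (- _); rewrite /p.
  under eq_bigr do rewrite summxE.
  rewrite exchange_big /=; apply: eq_bigr => S SB.
  have [tS|tS] := boolP (top v S \in nest_set t).
    rewrite (bigD1 (top v S)) //= big1 => [|j /andP[_ ji]].
      by rewrite mxE !eqxx addr0.
    by rewrite mxE eqxx (negPf ji).
  rewrite big1 // => j jt; rewrite mxE eqxx /=.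
  by have /negPf-> : j != top v S by apply: contraNneq tS => <-.
have top_le v t S : S \in B ->
    ((S \subset nest_set t)%:R : R) <= (top v S \in nest_set t)%:R.
  move=> /(topP v)[tS _]; rewrite ler_nat.
  by case: (boolP (S \subset _)) => // /fintype.subsetP ->.
split.
- move=> v; exists (fun S => delta_mx 0 (top v S)); split=> // S /(topP v)[tS _].
  by apply: sub_conv_hull; exists (top v S).
- move=> t x [y [ySimp ->]]; rewrite dot_nest_dir /nest_bound lerN2.
  under [X in _ <= X]eq_bigr do rewrite summxE.
  rewrite exchange_big /=; apply: ler_sum => S SB.
  have [y0 y1] := coord_simplex_facts (ySimp S SB).
  by case: (boolP (S \subset _)) => [/y1->//|_]; apply: sumr_ge0.
- move=> v t; rewrite dot_p /nest_bound eqr_opp.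
  apply/eqP/idP => [E|tv]; last first.
    apply: eq_bigr => S SB; congr (nat_of_bool _)%:R.
    have [tS tmax] := topP v S SB; apply/idP/idP=> [tt|/fintype.subsetP->//].
    by apply: (nest_tight tv SB (topP v S SB)).
  apply: contraT => /nest_loose[S SB [tt nS]].
  have s0 : \sum_(S in B) ((top v S \in nest_set t)%:R - (S \subset nest_set t)%:R : R) = 0.
    by rewrite big_split sumrN /= E subrr.
  have /eqP := psumr_eq0P (fun S SB => etrans (subr_ge0 _ _) (top_le v t S SB)) s0 SB.
  by rewrite (tt _ (topP v S SB)) (negPf nS) subr0 oner_eq0.
- apply: flips_prod; [exact: flips_cube|exact: flips_xincs Xok].
- suff H x : @minkowski_sum R N B x -> x *m (const_mx 1 : 'cV_N.+1) = const_mx (\sum_(S in B) 1).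
    by move=> x y /H -> /H ->.
  move=> [y [ySimp ->]]; rewrite mulmx_suml; apply/matrixP => i j.
  rewrite summxE mxE; apply: eq_bigr => S SB; rewrite mxE.
  have [_ /(_ [set: _]%SET (finset.subsetT _))] := coord_simplex_facts (ySimp S SB).
  by move=> E1; rewrite -[RHS]E1 ord1; apply: eq_big => l; rewrite ?inE// => _; rewrite [const_mx _ _ _]mxE mulr1.
- move=> v; rewrite card_prod_inc card_cube_inc card_xincs//.
  rewrite -mxrank_tr trmx_const rank_rV.
  have -> : (const_mx 1 : 'rV[R]_N.+1) != 0; last by rewrite addn1.
  by apply/eqP => /rowP/(_ ord0)/eqP; rewrite !mxE oner_eq0.
Qed.

End Nestohedron.

(** * Products with cubes as flag complexes *)

Fixpoint sublists (s : seq nat) : seq (seq nat) :=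
  if s is x :: s' then map (cons x) (sublists s') ++ sublists s' else [:: [::]].

Lemma filter_sublists (a : pred nat) s : [seq x <- s | a x] \in sublists s.
Proof.
elim: s => //= x s IH; rewrite mem_cat; case: (a x); last by rewrite IH orbT.
by rewrite map_f.
Qed.

(** Disjointness of two facets: the graph of non-edges of the dual boundary complex. *)
Definition xadj (X : polydata) (a b : nat) : bool :=
  ~~ has (fun I => (a \in I) && (b \in I)) (xinc X).

(** Flagness by exhaustion over all sets of facets: pairwise meeting facets share a vertex. *)
Definition polyflag_ok (X : polydata) : bool :=
  all (fun t => ~~ xadj X t t) (iota 0 (xsize X)) &&
  all (fun s => all (fun a => all (fun b => ~~ xadj X a b) s) s ==>
         has (subl s) (xinc X)) (sublists (iota 0 (xsize X))).

Section CubeTimesPoly.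
Variables (X : polydata) (n : nat).
Hypothesis Xok : polydata_ok X.
Hypothesis Xflag : polyflag_ok X.
Notation T := ('I_n * bool + 'I_(xsize X))%type.

Definition prod_adj (s t : T) : bool :=
  match s, t with
  | inl (i, b), inl (j, b') => (i == j) && (b != b')
  | inr a, inr b => xadj X a b
  | _, _ => false
  end.

Definition prod_complex : {set {set T}} :=
  tight_complex (prod_inc (@cube_inc n) (@xincs X)).

(** In the cube factor a set without opposite facets extends to a vertex by choosing a side for each
    direction; in [X] a common vertex comes from the exhaustive check. *)
Lemma prod_complexP (A : {set T}) :
  reflect (forall s t, s \in A -> t \in A -> ~~ prod_adj s t) (A \in prod_complex).
Proof.
apply: (iffP (tight_complexP _ _)) => [[[f w] Av] s t sA tA|indep].
  have := fintype.subsetP Av _ sA; have := fintype.subsetP Av _ tA.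
  rewrite !in_prod_inc; case: s sA => [[i b]|a] sA; case: t tA => [[j b']|c] tA //=.
    rewrite !inE /= => /eqP <- /eqP <-; case: eqVneq => // ->.
    by rewrite eqxx.
  rewrite !inE => cw aw; rewrite negbK; apply/hasP.
  by exists (nth [::] (xinc X) w); [apply: mem_nth|rewrite aw].
pose f : {ffun 'I_n -> bool} := [ffun j => inl (j, true) \in A].
pose s := [seq x <- iota 0 (xsize X) | [exists a : 'I_(xsize X), (inr a \in A) && (x == val a)]].
have sP x : x \in s -> exists2 a : 'I_(xsize X), inr a \in A & x = a.
  by rewrite mem_filter => /andP[/existsP[a /andP[aA /eqP xa]] _]; exists a.
have /andP[_ /allP/(_ s (filter_sublists _ _))/implyP] := Xflag.
have sindep : all (fun a => all (fun b => ~~ xadj X a b) s) s.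
  apply/allP => x /sP[a aA ->]; apply/allP => y /sP[b bA ->].
  exact: (indep (inr a) (inr b)).
move=> /(_ sindep)/hasP[I IX /allP sI].
have wX : (index I (xinc X) < xverts X)%N by rewrite index_mem.
exists (f, Ordinal wX); apply/fintype.subsetP => -[[j b]|a] tA; rewrite in_prod_inc inE /=.
  rewrite ffunE; case: b tA => tA; first by rewrite tA.
  by apply/eqP/negbTE/negP => tA'; have := indep _ _ tA tA'; rewrite /= eqxx.
rewrite nth_index//; apply: sI; rewrite mem_filter; apply/andP; split.
  by apply/existsP; exists a; rewrite tA eqxx.
by rewrite mem_iota ltn_ord.
Qed.

Lemma prod_adj_irr t : ~~ prod_adj t t.
Proof.
case: t => [[j b]|a]; rewrite /= ?eqxx//.
by case/andP: Xflag => /allP H _; apply: H; rewrite mem_iota ltn_ord.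
Qed.

Lemma prod_complex_cover t : exists v, t \in prod_inc (@cube_inc n) (@xincs X) v.
Proof.
have /prod_complexP/tight_complexP[v] : forall s s', s \in [set t]%SET ->
    s' \in [set t]%SET -> ~~ prod_adj s s'.
  by move=> s s'; rewrite !inE => /eqP -> /eqP ->; apply: prod_adj_irr.
by rewrite finset.sub1set; exists v.
Qed.

Variables (R : realType) (Y : nestdata).
Hypothesis Yok : nestdata_ok X Y.

Let v0 : {ffun 'I_n -> bool} * 'I_(xverts X).
Proof. by case/and5P: Xok => _ X0 _ _ _; split; [exact: [ffun=> true]|exists 0%N]. Defined.

Lemma prod_complex_realizes (G : set 'rV[R]_(xdim X)) :
  (forall v, G (xpt R v)) ->
  (forall t x, G x -> dot x (xdir R t) <= xbnd R t) ->
  realizes prod_complex (polytope_prod (cube R n) G).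
Proof.
move=> Gp Gl.
exact: (presents_realizes (presents_prod (presents_cube R n) (presents_polydata Xok Gp Gl)) v0).
Qed.

Lemma prod_complex_polytopal (t0 : T) : exists (P : set 'rV[R]_(n + xdim X)),
  [/\ polytope P, realizes prod_complex P, nestohedron P &
   exists Q : set 'rV[R]_(n + xdim X), [/\ simplicial_polytope Q,
     complex_iso prod_complex (boundary_complex Q) & comb_dual P Q]].
Proof.
have pr := presents_conv (presents_prod (presents_cube R n) (presents_polydata_conv R Xok)) v0.
set P := conv_hull _ in pr.
have rP : realizes prod_complex P := presents_realizes pr v0.
have polP : polytope P by apply: polytope_conv v0.
exists P; split=> //.
  split=> //; exists (n + xdim X)%N, (nest_building X Y n).
  split; first exact: nest_building_connected Yok.
  have [p [l [beta prB]]] := presents_nestohedron n Xok Yok R.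
  exact: realizes_comb_equiv rP (presents_realizes prB v0).
have [Q [sQ cQ iQ]] := presents_dual pr v0 t0 prod_complex_cover.
by exists Q; split=> //; apply: realizes_comb_dual rP cQ.
Qed.

End CubeTimesPoly.

Section Data.

(** One vertex and no facet: the factor that leaves a pure cube. *)
Definition point_data := PolyData 0 [:: [::]]%N 1 [:: [::]]%Z [::]%Z [::]%Z.
Definition point_nest := NestData [::]%N [:: [:: 0]]%N.

Definition pentagon_data := PolyData 2
  [:: [:: 0; 1]; [:: 0; 4]; [:: 1; 2]; [:: 2; 3]; [:: 3; 4]]%N 1
  [:: [:: -1; -1]; [:: -1; 1]; [:: 1; -1]; [:: 1; 0]; [:: 0; 1]]%Z
  [:: [:: -1; 0]; [:: 0; -1]; [:: 1; 0]; [:: 1; 1]; [:: 0; 1]]%Z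
  [:: 1; 1; 1; 1; 1]%Z.
(** The proper connected subsets of the path 1 - 0 - 2: the pentagon as the two-dimensional
    associahedron. *)
Definition pentagon_nest := NestData
  [:: [:: 0]; [:: 0; 1]; [:: 1]; [:: 2]; [:: 0; 2]]%N
  [:: [:: 0; 1; 2]; [:: 0; 2; 1]; [:: 1; 0; 2]; [:: 2; 0; 1]; [:: 1; 2; 0]]%N.

Definition hexagon_data := PolyData 2
  [:: [:: 0; 1]; [:: 0; 5]; [:: 1; 2]; [:: 2; 3]; [:: 3; 4]; [:: 4; 5]]%N 1
  [:: [:: 1; 1]; [:: 1; 0]; [:: 0; 1]; [:: -1; 0]; [:: -1; -1]; [:: 0; -1]]%Z
  [:: [:: 1; 0]; [:: 0; 1]; [:: -1; 1]; [:: -1; 0]; [:: 0; -1]; [:: 1; -1]]%Z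
  [:: 1; 1; 1; 1; 1; 1]%Z.
(** All proper nonempty subsets of {0,1,2}: the hexagon as the two-dimensional permutohedron. *)
Definition hexagon_nest := NestData
  [:: [:: 0]; [:: 0; 1]; [:: 1]; [:: 1; 2]; [:: 2]; [:: 0; 2]]%N
  [:: [:: 0; 1; 2]; [:: 0; 2; 1]; [:: 1; 0; 2]; [:: 2; 0; 1]; [:: 2; 1; 0]; [:: 1; 2; 0]]%N.

(** The cube after the first cut x + y >= 1/2 only, used as the intermediate polytope in [Q23]. *)
Definition cube_cut_data := PolyData 3
  [:: [:: 0; 2; 4]; [:: 0; 2; 6]; [:: 0; 4; 5]; [:: 0; 5; 6]; [:: 1; 2; 3];
      [:: 1; 2; 6]; [:: 1; 3; 5]; [:: 1; 5; 6]; [:: 2; 3; 4]; [:: 3; 4; 5]]%N 4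
  [:: [:: 0; 4; 0]; [:: 0; 2; 0]; [:: 0; 4; 4]; [:: 0; 2; 4]; [:: 4; 0; 0];
      [:: 2; 0; 0]; [:: 4; 0; 4]; [:: 2; 0; 4]; [:: 4; 4; 0]; [:: 4; 4; 4]]%Z
  [:: [:: -1; 0; 0]; [:: 0; -1; 0]; [:: 0; 0; -1]; [:: 1; 0; 0]; [:: 0; 1; 0];
      [:: 0; 0; 1]; [:: -2; -2; 0]]%Z
  [:: 0; 0; 0; 1; 1; 1; -1]%Z.

(* The 3-cube cut by x + y >= 1/2 and then by y + z >= 1/4. *)
Definition cube_cut2_data := PolyData 3
  [:: [:: 0; 2; 4]; [:: 0; 2; 6]; [:: 0; 4; 5]; [:: 0; 5; 6]; [:: 1; 3; 5];
      [:: 1; 3; 7]; [:: 1; 5; 6]; [:: 1; 6; 7]; [:: 2; 3; 4]; [:: 2; 3; 7];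
      [:: 2; 6; 7]; [:: 3; 4; 5]]%N 4
  [:: [:: 0; 4; 0]; [:: 0; 2; 0]; [:: 0; 4; 4]; [:: 0; 2; 4]; [:: 4; 0; 4];
      [:: 4; 0; 1]; [:: 2; 0; 4]; [:: 2; 0; 1]; [:: 4; 4; 0]; [:: 4; 1; 0];
      [:: 1; 1; 0]; [:: 4; 4; 4]]%Z
  [:: [:: -1; 0; 0]; [:: 0; -1; 0]; [:: 0; 0; -1]; [:: 1; 0; 0]; [:: 0; 1; 0];
      [:: 0; 0; 1]; [:: -2; -2; 0]; [:: 0; -4; -4]]%Z
  [:: 0; 0; 0; 1; 1; 1; -1; -1]%Z.
(** Opposite facets of the cube carry {2} and {0}, {0,1} and {0,2}, {3} and {0,1,2}; the two cuts
    carry {1} and {0,1,3}. *)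
Definition cube_cut2_nest := NestData
  [:: [:: 2]; [:: 0; 1]; [:: 3]; [:: 0]; [:: 0; 2]; [:: 0; 1; 2]; [:: 1];
      [:: 0; 1; 3]]%N
  [:: [:: 1; 3; 0; 2]; [:: 3; 0; 1; 2]; [:: 1; 2; 0; 3]; [:: 2; 0; 1; 3];
      [:: 0; 1; 2; 3]; [:: 0; 1; 3; 2]; [:: 1; 0; 2; 3]; [:: 1; 0; 3; 2];
      [:: 0; 3; 1; 2]; [:: 0; 2; 3; 1]; [:: 2; 0; 3; 1]; [:: 0; 2; 1; 3]]%N.

Lemma point_ok : polydata_ok point_data && polyflag_ok point_data &&
  nestdata_ok point_data point_nest.
Proof. by vm_compute. Qed.
Lemma pentagon_ok : polydata_ok pentagon_data && polyflag_ok pentagon_data &&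
  nestdata_ok pentagon_data pentagon_nest.
Proof. by vm_compute. Qed.
Lemma hexagon_ok : polydata_ok hexagon_data && polyflag_ok hexagon_data &&
  nestdata_ok hexagon_data hexagon_nest.
Proof. by vm_compute. Qed.
Lemma cube_cut_ok : polydata_ok cube_cut_data.
Proof. by vm_compute. Qed.
Lemma cube_cut2_ok : polydata_ok cube_cut2_data && polyflag_ok cube_cut2_data &&
  nestdata_ok cube_cut2_data cube_cut2_nest.
Proof. by vm_compute. Qed.

End Data.

(** * The models *)

Section Models.
Variable R : realType.

Lemma card_range_ord (T : choiceType) n (f : 'I_n -> T) :
  injective f -> (range f #= `I_n)%card.
Proof.
move=> finj; have -> : range f = [set` [fset f i | i in 'I_n]%fset].
  apply/seteqP; split => [_ [i _ <-]|x /= /imfsetP[i _ ->]]; last by exists i.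
  by apply/imfsetP; exists i.
by apply/card_eq_fsetP; rewrite card_imfset//= -cardE card_ord.
Qed.

(** No tight set contains another one, so the points are distinct and counting them counts the
    vertices. *)
Lemma card_vertices_polydata (X : polydata) (Xok : polydata_ok X) :
  all (fun v => all (fun w =>
    subl (nth [::] (xinc X) v) (nth [::] (xinc X) w) ==> (v == w))
    (iota 0 (xverts X))) (iota 0 (xverts X)) ->
  (vertices (conv_hull (range (@xpt R X))) #= `I_(xverts X))%card.
Proof.
move=> /allP Xinj; have pr := presents_polydata_conv R Xok.
have /and5P[_ X0 /allP H _ _] := Xok.
rewrite (presents_vertices pr (Ordinal X0)); apply: card_range_ord => v w vw.
have vX : val v \in iota 0 (xverts X) by rewrite mem_iota ltn_ord.
have wX : val w \in iota 0 (xverts X) by rewrite mem_iota ltn_ord.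
apply: val_inj; apply/eqP; have /allP/(_ _ wX)/implyP := Xinj _ vX; apply.
have /and3P[_ _ /allP aX] := H _ (mem_nth [::] (ltn_ord v)).
apply/allP => a av; have := pres_tight pr v (Ordinal (aX a av)).
by rewrite vw (pres_tight pr) !inE /= av => ->.
Qed.

(** [Q23] cuts by half-spaces, so the cut cubes are taken as solution sets of inequalities. *)
Definition hpoly (X : polydata) : set 'rV[R]_(xdim X) :=
  [set x | forall t, dot x (xdir R (X := X) t) <= xbnd R (X := X) t].

Lemma hpoly_pt X (Xok : polydata_ok X) v : hpoly (xpt R (X := X) v).
Proof. by move=> t; have [] := xdata_dot R Xok v t. Qed.

Lemma presents_hpoly X (Xok : polydata_ok X) :
  presents (@hpoly X) (@xpt R X) (@xdir R X) (@xbnd R X) (@xincs X) (0 : 'M_(xdim X, 0)).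
Proof. by apply: presents_polydata => // v; apply: hpoly_pt. Qed.

Notation o0 := (ord0 : 'I_3).
Notation o1 := (lift ord0 (ord0 : 'I_2) : 'I_3).
Notation o2 := (lift ord0 (lift ord0 (ord0 : 'I_1)) : 'I_3).

Lemma dot3 (x : 'rV[R]_3) (u : 'cV[R]_3) :
  dot x u = x 0 o0 * u o0 0 + x 0 o1 * u o1 0 + x 0 o2 * u o2 0.
Proof. by rewrite /dot mxE !big_ord_recl big_ord0 addr0 addrA. Qed.

Let cut1 : 'cV[R]_3 := xdir R (X := cube_cut_data) (Ordinal (isT : (6 < 7)%N)).
Let cut2 : 'cV[R]_3 := xdir R (X := cube_cut2_data) (Ordinal (isT : (7 < 8)%N)).

Let cut1E x : dot x cut1 = -2 * x 0 o0 - 2 * x 0 o1.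
Proof. rewrite dot3 !mxE /=; ring. Qed.
Let cut2E x : dot x cut2 = -4 * x 0 o1 - 4 * x 0 o2.
Proof. rewrite dot3 !mxE /=; ring. Qed.

Lemma hpoly_cube_cut : @hpoly cube_cut_data = cube R 3 `&` [set x | dot x cut1 <= -1].
Proof.
apply/seteqP; split => x.
  move=> H; split; last exact: (H (Ordinal (isT : (6 < 7)%N))).
  have := H (Ordinal (isT : (0 < 7)%N)); have := H (Ordinal (isT : (1 < 7)%N)).
  have := H (Ordinal (isT : (2 < 7)%N)); have := H (Ordinal (isT : (3 < 7)%N)).
  have := H (Ordinal (isT : (4 < 7)%N)); have := H (Ordinal (isT : (5 < 7)%N)).
  rewrite !dot3 !mxE /xbnd /= => h5 h4 h3 h2 h1 h0 i.
  case: (unliftP o0 i) => [j ->|->]; last by apply/andP; split; lra.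
  case: (unliftP (ord0 : 'I_2) j) => [l ->|->]; last by apply/andP; split; lra.
  by rewrite (ord1 l); apply/andP; split; lra.
move=> [H c1] [[|[|[|[|[|[|[|t]]]]]]] tX] //; rewrite /xbnd /=;
  have /andP[h0 h0'] := H o0; have /andP[h1 h1'] := H o1; have /andP[h2 h2'] := H o2;
  move: c1; rewrite /= !dot3 !mxE /=; lra.
Qed.

Lemma hpoly_cube_cut2 :
  @hpoly cube_cut2_data = @hpoly cube_cut_data `&` [set x | dot x cut2 <= -1].
Proof.
apply/seteqP; split => x.
  move=> H; split; last exact: (H (Ordinal (isT : (7 < 8)%N))).
  move=> t; have tX : (t < 8)%N by apply: leq_trans (ltn_ord t) _.
  have := H (Ordinal tX); rewrite !dot3 !mxE /xbnd /=.
  by case: t tX => [[|[|[|[|[|[|[|t]]]]]]] tX].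
move=> [H c2] t; have [tX|tX] := ltnP t 7.
  have := H (Ordinal tX); rewrite !dot3 !mxE /xbnd /=.
  by case: t tX => [[|[|[|[|[|[|[|t]]]]]]] tX].
have -> : t = Ordinal (isT : (7 < 8)%N); last exact: c2.
by apply: val_inj => /=; have : (t < 8)%N := ltn_ord t; lia.
Qed.

Let F (j : 'I_3) : set 'rV[R]_3 :=
  cube R 3 `&` [set x | dot x (cube_dir R (j, false)) = cube_bound R (j, false)].

Let FE j x : F j x <-> cube R 3 x /\ x 0 j = 0.
Proof.
rewrite /F /cube_bound; split => -[cx]; rewrite /= dotZr dot_delta mulN1r => E.
  by split=> //; apply/eqP; rewrite -oppr_eq0 E.
by split=> //=; rewrite E oppr0.
Qed.

Let f0 : {ffun 'I_3 -> bool} := [ffun=> false].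
Let cubeV : vertices (cube R 3) = range (@cube_vertex R 3) :=
  presents_vertices (presents_cube R 3) f0.

Let F_facet j : facet (cube R 3) (F j).
Proof.
by apply: (presents_facet (presents_cube R 3) f0 (v := f0)); rewrite inE ffunE.
Qed.

Let F_neq i j : i != j -> F i <> F j.
Proof.
move=> ij E; pose f : {ffun 'I_3 -> bool} := [ffun l => l == j].
have : F i (cube_vertex R f).
  apply/FE; split; last by rewrite mxE ffunE (negPf ij).
  exact: (pres_pt (presents_cube R 3)).
by rewrite E => /FE[_ /eqP]; rewrite mxE ffunE eqxx oner_eq0.
Qed.

(** The second cut is shallower than the first: (0, 1/2, 0) is a vertex created by the first cut,
    lies off the edge y = z = 0, and must satisfy y + z > 1/4 strictly. *)
Lemma Q23_cube_cut2 : Q23 (@hpoly cube_cut2_data).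
Proof.
exists (F o0), (F o1), (F o2), (@hpoly cube_cut_data).
have vz j : (cube_vertex R f0) 0 j = 0 by rewrite mxE ffunE.
have cubez : cube R 3 (cube_vertex R f0) := pres_pt (presents_cube R 3) f0.
split.
- by split; apply: F_facet.
- by split; apply: F_neq.
- by exists (cube_vertex R f0); [rewrite cubeV; exists f0|split; [split|]; apply/FE; split].
- exists cut1, (-1); rewrite cubeV -/(dot _ _); split.
  + move=> _ [f _ <-] [/FE[_ x0] /FE[_ x1]]; rewrite -/(dot _ _) cut1E x0 x1; lra.
  + move=> _ [f _ <-] nF; rewrite -/(dot _ _) cut1E !mxE.
    have : f o0 || f o1.
      apply: contra_notT nF; rewrite negb_or => /andP[f0' f1'].
      have cf := pres_pt (presents_cube R 3) f.
      by split; apply/FE; split=> //; rewrite mxE; case: (f _) f0' f1' => //; case: (f _).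
    by case: (f o0); case: (f o1) => //= _; lra.
  + exact: hpoly_cube_cut.
- exists cut2, (-1).
  rewrite (presents_vertices (presents_hpoly cube_cut_ok) (Ordinal (isT : (0 < 10)%N))).
  split.
  + move=> _ [v _ <-] [[/FE[_ x1] /FE[_ x2]] _]; rewrite -/(dot _ _) cut2E x1 x2; lra.
  + move=> _ [v _ <-] nG; rewrite -/(dot _ _) cut2E.
    have cv : cube R 3 (xpt R v).
      by have := hpoly_pt cube_cut_ok v; rewrite hpoly_cube_cut => -[].
    have : ~ ((xpt R v) 0 o1 = 0 /\ (xpt R v) 0 o2 = 0).
      move=> [x1 x2]; apply: nG; split; last exact: hpoly_pt cube_cut_ok v.
      by split; apply/FE.
    clear nG cv; case: v => [[|[|[|[|[|[|[|[|[|[|v]]]]]]]]]] vX] //;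
      rewrite !mxE /= => H; (try lra); exfalso; apply: H; split; lra.
  + exact: hpoly_cube_cut2.
Qed.

(** A product with the point would live in dimension n + 0. The cube is presented directly instead,
    with the index types of that product. *)
Lemma cube_realizes n :
  realizes (prod_complex point_data n) (cube R n).
Proof.
have /andP[/andP[Xok _] _] := point_ok.
have pr : presents (cube R n)
    (fun v : {ffun 'I_n -> bool} * 'I_(xverts point_data) => cube_vertex R v.1)
    (fun t : 'I_n * bool + 'I_(xsize point_data) =>
       match t with inl t => cube_dir R t | inr _ => 0 end)
    (fun t => match t with inl t => cube_bound R t | inr _ => 0 end)
    (prod_inc (@cube_inc n) (@xincs point_data)) (0 : 'M_(n, 0)).
  split.
  - by move=> v; apply: (pres_pt (presents_cube R n)).
  - by move=> [t|[]//] x; apply: (pres_le (presents_cube R n)).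
  - by move=> v [t|[]//]; rewrite in_prod_inc; apply: (pres_tight (presents_cube R n)).
  - apply: flips_prod; first exact: flips_cube.
    exact: flips_xincs Xok.
  - by move=> x y _ _; rewrite !mulmx0.
  - move=> v; rewrite card_prod_inc card_cube_inc card_xincs//.
    by rewrite mxrank0 !addn0.
exact: (presents_realizes pr ([ffun=> true], ord0)).
Qed.

End Models.

(** * Faces of Murai spheres *)

Section MuraiFaces.
Variables (m : nat) (c : 'I_m -> nat).
Notation mono := (cmonomial c).
Notation symb := (csymbol c).

(** Equivalently [A] lies in [Fc g]; in this form faces become statements about exponents. *)
Definition avoids (g : mono) (A : {set symb}) : Prop :=
  forall s, s \in A -> g (tag s) <> tagged s :> nat.

Lemma symb_inj (s p : symb) : tag s = tag p -> tagged s = tagged p :> nat -> s = p.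
Proof.
case: s p => i j [i' j'] /= E; case: i' / E j' => j' /= /val_inj ->; by [].
Qed.

Lemma Tagged_eq (g : mono) (s : symb) :
  g (tag s) = tagged s :> nat -> s = Tagged (fun i => 'I_(c i).+1) (g (tag s)).
Proof. by case: s => i j /= E; congr existT; apply: val_inj. Qed.

Lemma sub_Fc (g : mono) (A : {set symb}) : avoids g A -> A \subset Fc g.
Proof.
move=> av; apply/fintype.subsetP => s sA; rewrite inE; apply/imsetP => -[i _ sE].
by apply: (av s sA); rewrite sE.
Qed.

Lemma Fc_avoids (g : mono) (A : {set symb}) : A \subset Fc g -> avoids g A.
Proof.
move=> AF s sA E; have := fintype.subsetP AF s sA; rewrite inE => /imsetP; apply.
by exists (tag s) => //; apply: Tagged_eq.
Qed.

Lemma cupdateE (a : mono) (p : symb) i :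
  cupdate a p i = (if i == tag p then tagged p : nat else a i) :> nat.
Proof.
rewrite /cupdate ffunE; case: eqP => [->|/eqP ip]; first by rewrite dfwith_in.
by rewrite dfwith_out// eq_sym.
Qed.

Definition lower_closed (M : {set mono}) : Prop :=
  forall a b : mono, b \in M -> (forall i, a i <= b i)%N -> a \in M.

(* Changing g into h one coordinate at a time leaves M at some step, which
   gives the facet. *)
Lemma murai_sphereP (M : {set mono}) (A : {set symb}) : lower_closed M ->
  A \in murai_sphere M <->
  exists g h, [/\ g \in M, h \notin M, avoids g A & avoids h A].
Proof.
move=> dn; rewrite inE; split.
  move=> /exists_inP[G]; rewrite inE => /existsP[a /existsP[p]].
  case/and4P => aM ap upM /eqP -> AG; exists a, (cupdate a p); split=> //.
    by apply: Fc_avoids; apply: fintype.subset_trans AG (subD1set _ _).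
  move=> s sA; rewrite cupdateE; have := fintype.subsetP AG s sA.
  rewrite finset.in_setD1 => /andP[sp sF]; case: eqP => [E ps|_].
    by move/eqP: sp; apply; apply: symb_inj.
  have := @Fc_avoids a [set s]%SET; rewrite finset.sub1set => /(_ sF) H.
  by apply: (H s); rewrite inE.
move=> [g [h [gM hM ga ha]]].
pose f i : mono := [ffun k : 'I_m => if (k < i)%N then h k else g k].
have f0 : f 0%N = g by apply/ffunP => k; rewrite ffunE ltn0.
have fm : f m = h by apply/ffunP => k; rewrite ffunE ltn_ord.
have [i [im fi fSi]] : exists i, [/\ (i < m)%N, f i \in M & f i.+1 \notin M].
  apply: contrapT => H; have : forall i, (i <= m)%N -> f i \in M.
    elim=> [_|i IH im]; first by rewrite f0.
    by apply: contraT => fSi; case: H; exists i; split=> //; apply: IH; apply: ltnW.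
  by move=> /(_ m (leqnn _)); rewrite fm (negPf hM).
pose k := Ordinal im; pose p : symb := Tagged (fun i => 'I_(c i).+1) (h k).
have fa : avoids (f i) A.
  by move=> s sA; rewrite ffunE; case: ifP => _; [apply: ha|apply: ga].
have up : cupdate (f i) p = f i.+1.
  apply/ffunP => l; apply: val_inj; rewrite /= cupdateE.
  have [->|lk] := eqVneq l k; first by rewrite ffunE /= ltnSn.
  by rewrite !ffunE ltnS [in RHS]leq_eqVlt -[_ == i]/(val l == val k) val_eqE (negPf lk).
(* Closure under divisors: a step that leaves [M] must raise the exponent. *)
have lt : (f i k < h k)%N.
  rewrite ltnNge; apply/negP => le; move/negP: fSi; apply; apply: dn fi _ => l.
  by rewrite -up cupdateE; case: eqP => [->|].
apply/exists_inP; exists (Fc (f i) :\ p)%SET.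
  rewrite inE; apply/existsP; exists (f i); apply/existsP; exists p.
  by rewrite fi up fSi eqxx /= lt.
apply/fintype.subsetP => s sA; rewrite finset.in_setD1 (fintype.subsetP (sub_Fc fa))// andbT.
by apply/eqP => sp; apply: (ha s sA); rewrite sp.
Qed.

Lemma murai_sphere_sub (M : {set mono}) (A B : {set symb}) :
  A \subset B -> B \in murai_sphere M -> A \in murai_sphere M.
Proof.
move=> AB; rewrite !inE => /exists_inP[G GF BG]; apply/exists_inP; exists G => //.
exact: fintype.subset_trans BG.
Qed.

Definition mono_of (f : 'I_m -> nat) : mono :=
  [ffun i => inord (minn (f i) (c i))].

Lemma mono_ofE f i : mono_of f i = minn (f i) (c i) :> nat.
Proof. by rewrite ffunE inordK// ltnS geq_minr. Qed.

Lemma mono_le (g : mono) i : (g i <= c i)%N.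
Proof. by rewrite -ltnS. Qed.

Section Proper.
Variable M : {set mono}.
Hypothesis Mproper : proper_multicomplex M.

Let Mdn : lower_closed M.
Proof. by case: Mproper => -[_ H] _ a b bM ab; apply: H bM ab. Qed.

Let one_mem : mono_of (fun=> 0%N) \in M.
Proof.
case: Mproper => -[/set0Pn[a aM] _] _; apply: Mdn aM _ => i.
by rewrite mono_ofE min0n.
Qed.

Let top_notin : mono_of c \notin M.
Proof.
case: Mproper => _; apply: contraNN => tM; apply/eqP/setP => a.
rewrite inE; apply: Mdn tM _ => i; rewrite mono_ofE minnn; exact: mono_le.
Qed.

Hypothesis Mflag : flag_complex (murai_sphere M).

Let small_nonface (A : {set symb}) : A \notin murai_sphere M ->
  exists2 B : {set symb}, B \subset A & B \notin murai_sphere M /\ (#|B| <= 2)%N.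
Proof.
move=> AK; have [B Bmin BA] :=
  @minset_exists _ [pred B : {set symb} | B \notin murai_sphere M] A AK.
exists B => //; split; last exact: Mflag.
exact: minsetp Bmin.
Qed.

(** Stated for any [N] so as to serve for members and for non-members; the two symbols may
    coincide. *)
Let hit_pair (N : mono -> Prop) (A : {set symb}) :
  (exists g, N g) -> (#|A| <= 2)%N -> (forall g, N g -> ~ avoids g A) ->
  exists s t, [/\ s \in A, t \in A & forall g, N g ->
    g (tag s) = tagged s :> nat \/ g (tag t) = tagged t :> nat].
Proof.
move=> [g0 g0N] A2 hit; have [A0|[s sA]] := set_0Vmem A.
  by case: (hit _ g0N) => s; rewrite A0 inE.
have [E|[t tA]] := set_0Vmem (A :\ s)%SET.
  exists s, s; split=> // g gM; left; apply: contrapT => ns; apply: (hit g gM).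
  move=> s' s'A; suff -> : s' = s by [].
  apply/eqP; apply: contraT => ss'; have : s' \in (A :\ s)%SET by rewrite !inE ss'.
  by rewrite E inE.
move: (tA); rewrite !inE => /andP[ts tA'].
exists s, t; split=> // g gM; apply: contrapT => nst; apply: (hit g gM).
move=> s' s'A E; apply: nst.
have [<-|ns] := eqVneq s' s; first by left.
have [<-|nt] := eqVneq s' t; first by right.
have := subset_leq_card (_ : [set s; t; s'] \subset A)%SET.
rewrite !finset.subUset !finset.sub1set sA tA' s'A => /(_ isT)/leq_trans/(_ A2).
rewrite finset.setUC cardsU1 !inE (negPf ns) (negPf nt) /= cards2.
by rewrite (eq_sym s t) ts.
Qed.

(** The symbols with exponent below [b] form a non-face, since a member avoiding them would be
    divisible by x^b. At most two of them already form a non-face; the top monomial avoids these and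
    is no member, so every member hits one of them. As 1 is a member, one of them is some
    x_i^(0). *)
Lemma nonmember_generators (b : mono) : b \notin M ->
  [\/ exists2 i, (0 < b i)%N & forall g, g \in M -> g i = 0%N :> nat,
      exists2 i, (1 < b i)%N & forall g, g \in M -> (g i <= 1)%N |
      exists i j, [/\ i != j, (0 < b i)%N, (0 < b j)%N
        & forall g, g \in M -> g i = 0%N :> nat \/ g j = 0%N :> nat]].
Proof.
move=> bM; pose A : {set symb} := [set s : symb | tagged s < b (tag s)]%N%SET.
have AK : A \notin murai_sphere M.
  apply/negP => /(murai_sphereP _ Mdn)[g [_ [gM _ ga _]]]; move/negP: bM; apply.
  apply: Mdn gM _ => i; rewrite leqNgt; apply/negP => gb.
  by apply: (ga (Tagged (fun i => 'I_(c i).+1) (g i))); rewrite ?inE.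
have [B BA [BK B2]] := small_nonface AK.
have [||s [t [sB tB hit]]] := hit_pair (N := fun g => g \in M) _ B2.
- by exists (mono_of (fun=> 0%N)).
- move=> g gM.
  move=> ga; move/negP: BK; apply; apply/(murai_sphereP _ Mdn).
  exists g, (mono_of c); split=> // s /(fintype.subsetP BA); rewrite inE mono_ofE minnn.
  by move=> lt E; move: lt; rewrite -E ltnNge mono_le.
have := fintype.subsetP BA s sB; have := fintype.subsetP BA t tB; rewrite !inE.
wlog : s t sB tB hit / tagged s = 0%N :> nat.
  move=> H; case: (hit _ one_mem); rewrite mono_ofE min0n => /esym E tb sb.
    exact: (H s t).
  by apply: (H t s) => // g /hit[]; [right|left].
case: s sB hit => i u sB hit; case: t tB hit => j v tB hit /= u0 vb ub.
rewrite {}u0 /= in ub hit *.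
have low (g : mono) l x : g \in M -> (x <= g l)%N ->
    mono_of (fun k => if k == l then x else g k) \in M.
  move=> gM xg; apply: Mdn gM _ => k; rewrite mono_ofE geq_min.
  by case: eqP => [->|]; rewrite ?xg ?leqnn.
have lowE (g : mono) l x k : (x <= g l)%N ->
    mono_of (fun k => if k == l then x else g k) k = (if k == l then x else g k) :> nat.
  move=> xg; rewrite mono_ofE; apply/minn_idPl; case: eqP => [->|_]; last exact: mono_le.
  exact: leq_trans xg (mono_le _ _).
have [ij|ij] := eqVneq i j; last first.
  have [v0|v0] := posnP v.
    apply: Or33; exists i, j; split=> // [|g /hit]; first exact: leq_ltn_trans (leq0n _) vb.
    by rewrite v0.
  apply: Or31; exists i => [|g gM]; first exact: ub.
  apply/eqP; apply: contraT => gi.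
  (* Lowering the exponent of x_j to 0 keeps a member and misses the second symbol, so the first one
     must be hit. *)
  have := hit _ (low g j 0%N gM isT); rewrite !lowE// (negPf ij) eqxx.
  by case=> E; [move: gi; rewrite E|move: v0; rewrite -E].
subst j; have [v1|v1] := leqP v 1; last first.
  apply: Or31; exists i => [|g gM]; first exact: ub.
  case: (hit g gM) => // E.
  (* With exponent lowered to 1 the member would miss both symbols, x_i^(0) and x_i^(v) with v >
     1. *)
  have := hit _ (low g i 1%N gM _); rewrite !lowE ?eqxx E ?(ltnW v1)//.
  by case=> // // E1; move: v1; rewrite -E1.
have [v0|v0] := posnP v.
  apply: Or31; exists i => [|g gM]; first exact: ub.
  by case: (hit g gM); rewrite ?v0.
apply: Or32; exists i => [|g gM]; first exact: leq_ltn_trans v0 vb.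
by case: (hit g gM) => ->.
Qed.

(** All symbols of x_k together form a non-face, so at most two of them are hit by all members or by
    all non-members. A member with exponent at least 2 yields members with exponents 0 and 1 as
    well, three values for two symbols; dually with c_k and c_k - 1 for non-members. *)
Lemma coordinate_dichotomy k : (1 < c k)%N ->
  (forall g, g \in M -> (g k <= 1)%N) \/
  (forall h, h \notin M -> (c k <= (h k).+1)%N).
Proof.
move=> ck; pose A : {set symb} := [set s : symb | tag s == k]%SET.
have AK : A \notin murai_sphere M.
  apply/negP => /(murai_sphereP _ Mdn)[g [_ [_ _ ga _]]].
  by apply: (ga (Tagged (fun i => 'I_(c i).+1) (g k))); rewrite ?inE.
have [B BA [BK B2]] := small_nonface AK.
have tagB s : s \in B -> tag s = k by move=> /(fintype.subsetP BA); rewrite inE => /eqP.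
have tr (g : mono) (s : symb) : tag s = k -> g (tag s) = g k :> nat by move=> ->.
have upd (g : mono) x : (x <= c k)%N ->
    exists g' : mono, g' k = x :> nat /\ forall l, l != k -> g' l = g l :> nat.
  move=> xc; exists (mono_of (fun l => if l == k then x else g l)).
  split=> [|l lk]; rewrite mono_ofE ?eqxx ?(negPf lk); apply/minn_idPl => //.
  exact: mono_le.
have [hitM|noM] := pselect (forall g, g \in M -> ~ avoids g B).
  have [|s [t [/tagB sk /tagB tk hit]]] := hit_pair _ B2 hitM.
    by exists (mono_of (fun=> 0%N)).
  left=> g gM; rewrite leqNgt; apply/negP => g1.
  have [g0' [g0k g0l]] := upd g 0%N isT; have [g1' [g1k g1l]] := upd g 1%N (ltnW ck).
  have le0 : g0' \in M.
    apply: Mdn gM _ => l; have [->|/g0l->//] := eqVneq l k; by rewrite g0k.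
  have le1 : g1' \in M.
    apply: Mdn gM _ => l; have [->|/g1l->//] := eqVneq l k; by rewrite g1k ltnW.
  by move: (hit _ gM) (hit _ le0) (hit _ le1); rewrite !(tr _ _ sk) !(tr _ _ tk); lia.
have [|h hM nh|s [t [/tagB sk /tagB tk hit]]] := hit_pair (N := fun h => h \notin M) _ B2.
- by exists (mono_of c).
- apply: noM => g gM ng; move/negP: BK; apply; apply/(murai_sphereP _ Mdn).
  by exists g, h.
right=> h hM; rewrite leqNgt; apply/negP => h1.
have [h0' [h0k h0l]] := upd h (c k) (leqnn _).
have [h1' [h1k h1l]] := upd h (c k).-1 (leq_pred _).
have le0 : h0' \notin M.
  apply: contra hM => hM; apply: Mdn hM _ => l.
  have [->|/h0l->//] := eqVneq l k; rewrite h0k; exact: mono_le.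
have le1 : h1' \notin M.
  apply: contra hM => hM; apply: Mdn hM _ => l.
  have [->|/h1l->//] := eqVneq l k; rewrite h1k; lia.
by move: (hit _ hM) (hit _ le0) (hit _ le1); rewrite !(tr _ _ sk) !(tr _ _ tk); lia.
Qed.

End Proper.
End MuraiFaces.

(** * Duality of Murai spheres *)

Section MuraiDuality.
Variables (m : nat) (c : 'I_m -> nat).
Notation mono := (cmonomial c).
Notation symb := (csymbol c).

Definition mono_rev (a : mono) : mono := [ffun i => rev_ord (a i)].
Definition symb_rev (s : symb) : symb :=
  Tagged (fun i => 'I_(c i).+1) (rev_ord (tagged s)).
(** The Alexander dual. *)
Definition dual_multicomplex (M : {set mono}) : {set mono} :=
  [set a | mono_rev a \notin M]%SET.

Lemma mono_revE a i : mono_rev a i = (c i - a i)%N :> nat.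
Proof. by rewrite ffunE /= subSS. Qed.

Lemma mono_revK : involutive mono_rev.
Proof. by move=> a; apply/ffunP => i; rewrite !ffunE rev_ordK. Qed.

Lemma symb_revK : involutive symb_rev.
Proof. by case=> i j; rewrite /symb_rev /= rev_ordK. Qed.

Lemma proper_lower_closed (M : {set mono}) : proper_multicomplex M -> lower_closed M.
Proof. by case=> -[_ H] _ a b bM ab; apply: H bM ab. Qed.

Lemma dual_proper (M : {set mono}) :
  proper_multicomplex M -> proper_multicomplex (dual_multicomplex M).
Proof.
move=> Mp; have dn := proper_lower_closed Mp.
case: Mp => -[/set0Pn[b bM] _] MT; split; first split.
- apply: contraNneq MT => E; apply/eqP/setP => a; rewrite inE.
  apply: contraT => aM; have : mono_rev a \in dual_multicomplex M by rewrite inE mono_revK.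
  by rewrite E inE.
- move=> a a'; rewrite !inE => a'M aa'; apply: contra a'M => aM; apply: dn aM _ => i.
  by rewrite !mono_revE leq_sub2l.
- by apply/eqP => /setP/(_ (mono_rev b)); rewrite !inE mono_revK bM.
Qed.

Lemma avoids_rev (g : mono) (A : {set symb}) :
  avoids (mono_rev g) (symb_rev @: A) <-> avoids g A.
Proof.
have E s : mono_rev g (tag (symb_rev s)) = tagged (symb_rev s) :> nat <->
    g (tag s) = tagged s :> nat.
  rewrite mono_revE /= subSS; have := mono_le g (tag s).
  have : (tagged s <= c (tag s))%N by rewrite -ltnS.
  move: (nat_of_ord (tagged s)) (nat_of_ord (g (tag s))) => x y xz yz.
  by split=> [h|->//]; rewrite -(subKn yz) h subKn.
split=> H s; first by move=> sA /E; apply: H; apply: imset_f.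
by move=> /imsetP[s' s'A ->] /E; apply: H.
Qed.

(** The criterion [murai_sphereP] is symmetric in its two monomials, and reversal exchanges members
    with non-members. *)
Lemma murai_dual_iso (M : {set mono}) : proper_multicomplex M ->
  complex_iso (murai_sphere M) (murai_sphere (dual_multicomplex M)).
Proof.
move=> Mp; have dn := proper_lower_closed Mp.
have dn' := proper_lower_closed (dual_proper Mp).
have E (A : {set symb}) :
    (A \in murai_sphere M) = ((symb_rev @: A)%SET \in murai_sphere (dual_multicomplex M)).
  apply/idP/idP; rewrite !murai_sphereP// => -[g [h [gM hM gA hA]]].
    exists (mono_rev h), (mono_rev g); rewrite !inE !mono_revK gM hM.
    by split=> //; apply/avoids_rev.
  rewrite !inE negbK in gM hM; exists (mono_rev h), (mono_rev g).
  by split=> //; apply/avoids_rev; rewrite mono_revK.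
have inj : injective symb_rev := inv_inj symb_revK.
exists symb_rev; split.
- by move=> s t _ _; apply: inj.
- apply/setP => s; rewrite -(symb_revK s) mem_imset//.
  by rewrite [LHS]inE [RHS]inE E imset_set1.
- by move=> A _; apply: E.
Qed.

Lemma dual_flag (M : {set mono}) : proper_multicomplex M ->
  flag_complex (murai_sphere M) -> flag_complex (murai_sphere (dual_multicomplex M)).
Proof. by move=> Mp Mf; exact (proj1 (complex_iso_flagP (murai_dual_iso Mp)) Mf). Qed.

Lemma member_cogenerators (M : {set mono}) (a : mono) :
  proper_multicomplex M -> flag_complex (murai_sphere M) -> a \in M ->
  [\/ exists2 i, (a i < c i)%N & forall h, h \notin M -> h i = c i :> nat,
      exists2 i, ((a i).+1 < c i)%N & forall h, h \notin M -> (c i <= (h i).+1)%N |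
      exists i j, [/\ i != j, (a i < c i)%N, (a j < c j)%N
        & forall h, h \notin M -> h i = c i :> nat \/ h j = c j :> nat]].
Proof.
move=> Mp Mflag aM.
have Mflag' := dual_flag Mp Mflag.
have memd h : h \notin M -> mono_rev h \in dual_multicomplex M.
  by rewrite inE mono_revK.
have aM' : mono_rev a \notin dual_multicomplex M by rewrite inE mono_revK aM.
have le (h : mono) i : (h i <= c i)%N := mono_le h i.
case: (nonmember_generators (dual_proper Mp) Mflag' aM').
- move=> [i]; rewrite mono_revE => ai H; apply: Or31; exists i; first lia.
  by move=> h /memd/H; rewrite mono_revE; have := le h i; lia.
- move=> [i]; rewrite mono_revE => ai H; apply: Or32; exists i; first lia.
  by move=> h /memd/H; rewrite mono_revE; have := le h i; lia.
- move=> [i [j []]]; rewrite !mono_revE => ij ai aj H; apply: Or33; exists i, j.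
  split=> //; try lia; move=> h /memd/H; rewrite !mono_revE.
  by have := le h i; have := le h j; lia.
Qed.

End MuraiDuality.

(** * Multicomplexes with a flag Murai sphere *)

Definition pulled (m : nat) (c : 'I_m -> nat) (M : {set cmonomial c})
    (c0 : seq nat) (M0 : seq nat -> bool) : Prop :=
  exists ws : seq 'I_m, [/\ uniq ws, [seq c i | i <- ws] = c0,
    forall l, l \notin ws -> c l = 1%N
    & forall g : cmonomial c, (g \in M) = M0 [seq (g i : nat) | i <- ws]].

(* The labels place the symbols of the coordinates ws in prod_complex; None marks
   ghost vertices. *)
Record murai_type := MuraiType {
  mt_c : seq nat; mt_M : seq nat -> bool;
  mt_poly : polydata; mt_cube : nat;
  mt_label : seq (seq (option (nat * bool + nat))) }.

Section Types.
Local Open Scope nat_scope.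
Notation q i j := (Some (inl (i, j))).
Notation t i := (Some (inr i)).
Notation x v i := (nth 0 v i).

(* Up to the duality g -> c - g, the multicomplexes with a flag Murai sphere,
   restricted to the coordinates they depend on. *)
Definition murai_types : seq murai_type := [::
  MuraiType [:: 1] (fun v => x v 0 < 1) point_data 0
    [:: [:: None; None]];
  MuraiType [:: 2] (fun v => x v 0 < 2) point_data 1
    [:: [:: q 0 false; q 0 true; None]];
  MuraiType [:: 1; 1] (fun v => (x v 0 < 1) && (x v 1 < 1)) point_data 1
    [:: [:: None; q 0 false]; [:: None; q 0 true]];
  MuraiType [:: 2; 1] (fun v => (x v 0 < 2) && (x v 1 < 1)) point_data 2
    [:: [:: q 0 false; q 0 true; q 1 false]; [:: None; q 1 true]];
  MuraiType [:: 2; 2] (fun v => (x v 0 < 2) && (x v 1 < 2)) point_data 3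
    [:: [:: q 0 false; q 0 true; q 1 false]; [:: q 2 false; q 2 true; q 1 true]];
  MuraiType [:: 1; 1; 1]
    (fun v => (x v 0 < 1) && ((x v 1 == 0) || (x v 2 == 0))) pentagon_data 0
    [:: [:: None; t 0]; [:: t 1; t 3]; [:: t 4; t 2]];
  MuraiType [:: 2; 1; 1]
    (fun v => (x v 0 < 2) && ((x v 1 == 0) || (x v 2 == 0))) pentagon_data 1
    [:: [:: q 0 false; q 0 true; t 0]; [:: t 1; t 3]; [:: t 4; t 2]];
  MuraiType [:: 2] (fun v => x v 0 == 0) point_data 1
    [:: [:: None; q 0 false; q 0 true]];
  MuraiType [:: 3] (fun v => x v 0 < 2) point_data 2
    [:: [:: q 0 false; q 0 true; q 1 false; q 1 true]];
  MuraiType [:: 2; 1] (fun v => (x v 0 == 0) || ((x v 0 == 1) && (x v 1 == 0)))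
    pentagon_data 0
    [:: [:: t 0; t 2; t 4]; [:: t 3; t 1]];
  MuraiType [:: 1; 1; 1] (fun v => [&& (x v 0 == 0) || (x v 1 == 0),
      (x v 0 == 0) || (x v 2 == 0) & (x v 1 == 0) || (x v 2 == 0)])
    hexagon_data 0
    [:: [:: t 0; t 3]; [:: t 2; t 5]; [:: t 4; t 1]];
  MuraiType [:: 1; 1; 1; 1]
    (fun v => ((x v 0 == 0) || (x v 1 == 0)) && ((x v 2 == 0) || (x v 3 == 0)))
    cube_cut2_data 0
    [:: [:: t 2; t 1]; [:: t 5; t 7]; [:: t 3; t 0]; [:: t 6; t 4]];
  MuraiType [:: 1; 1; 1; 1]
    (fun v => ((x v 0 == 0) && (x v 1 == 0)) || ((x v 2 == 0) && (x v 3 == 0)))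
    cube_cut2_data 0
    [:: [:: t 0; t 3]; [:: t 4; t 6]; [:: t 1; t 2]; [:: t 7; t 5]];
  MuraiType [:: 1; 1; 1; 1]
    (fun v => [&& (x v 0 == 0) || (x v 1 == 0), (x v 1 == 0) || (x v 2 == 0)
      & (x v 2 == 0) || (x v 3 == 0)])
    cube_cut2_data 0
    [:: [:: t 2; t 5]; [:: t 1; t 0]; [:: t 4; t 7]; [:: t 6; t 3]]].

Definition murai_type0 := MuraiType [::] (fun=> true) point_data 0 [::].

End Types.

Section Classification.
Variables (m : nat) (c : 'I_m -> nat).
Notation mono := (cmonomial c).
Variable M : {set mono}.
Hypothesis c_gt0 : forall i, (0 < c i)%N.
Hypothesis Mproper : proper_multicomplex M.
Hypothesis Mflag : flag_complex (murai_sphere M).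

Definition typed : Prop := exists i, (i < size murai_types)%N /\
  let T := nth murai_type0 murai_types i in pulled M (mt_c T) (mt_M T).

Let dn : lower_closed M := proper_lower_closed Mproper.
Let F1 b := @nonmember_generators _ _ _ Mproper Mflag b.
Let F2 a := @member_cogenerators _ _ _ a Mproper Mflag.
Let F3 k := @coordinate_dichotomy _ _ _ Mproper Mflag k.

Let ray k r : mono := mono_of c (fun l => if l == k then r else 0%N).
Let coray k r : mono := mono_of c (fun l => if l == k then r else c l).
Let pair i j : mono := mono_of c (fun l => ((l == i) || (l == j)) : nat).

Let rayE k r l : (r <= c k)%N -> ray k r l = (if l == k then r else 0%N) :> nat.
Proof. by rewrite mono_ofE; case: eqP => [->|_]; lia. Qed.
Let corayE k r l : (r <= c k)%N -> coray k r l = (if l == k then r else c l) :> nat.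
Proof. by rewrite mono_ofE; case: eqP => [->|_]; lia. Qed.
Let pairE i j l : pair i j l = ((l == i) || (l == j)) :> nat.
Proof. by rewrite mono_ofE; have := c_gt0 l; case: (_ || _); lia. Qed.

Let le (g : mono) i : (g i <= c i)%N := mono_le g i.

Let dn_ray (g : mono) k r : g \in M -> (r <= g k)%N -> ray k r \in M.
Proof.
move=> gM rg; apply: dn gM _ => l.
by rewrite rayE ?(leq_trans rg)//; case: eqP => [->|].
Qed.
Let dn_coray (g : mono) k r : coray k r \in M -> (r <= c k)%N -> (g k <= r)%N -> g \in M.
Proof.
move=> gM rc gr; apply: dn gM _ => l.
by rewrite corayE//; case: eqP => [->|] // _; apply: le.
Qed.
Let dn_pair (g : mono) i j : g \in M -> (0 < g i)%N -> (0 < g j)%N -> pair i j \in M.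
Proof.
move=> gM gi gj; apply: dn gM _ => l.
by rewrite pairE; case: eqP => [->|] //=; case: eqP => [->|].
Qed.
Let zero_mem : mono_of c (fun=> 0%N) \in M.
Proof.
case: Mproper => -[/set0Pn[a aM] _] _; apply: dn aM _ => i.
by rewrite mono_ofE min0n.
Qed.
Let zeroE l : (mono_of c (fun=> 0%N) : mono) l = 0%N :> nat.
Proof. by rewrite mono_ofE min0n. Qed.

(** * Multicomplexes omitting the top power of a variable *)

Section TopLiteral.
Variable k : 'I_m.
Hypothesis ck : (c k <= 2)%N.
Hypothesis top_k : forall g, g \in M -> (g k < c k)%N.
Hypothesis nc0 : coray k 0 \notin M.

Let ray_top : ray k (c k) \notin M.
Proof. by apply/negP => /top_k; rewrite rayE// eqxx ltnn. Qed.

(** Outside x_k the non-member x_k^(c_k) has exponents 0, and [coray k 0] has exponent 0 at x_k.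
    Hence no condition on a single variable holds for all non-members: the one belonging to [a]
    involves a pair, and the pair contains [k]. *)
Let clause a : a \in M -> exists j, [/\ j != k, (a j < c j)%N &
  forall h, h \notin M -> h k = c k :> nat \/ h j = c j :> nat].
Proof.
move=> aM; case: (F2 aM) => [[l al H]|[l al H]|[l [l' [ll al al' H]]]].
- have := H _ ray_top; have := H _ nc0; rewrite rayE// corayE//.
  by case: eqP => [->|_]; have := c_gt0 l; have := c_gt0 k; lia.
- have := H _ ray_top; have := H _ nc0; rewrite rayE// corayE//.
  by case: eqP => [lk|_]; [move: al; rewrite lk|]; lia.
- have := H _ ray_top; rewrite !rayE//.
  have [lk|lk] := eqVneq l k.
    by move=> _; exists l'; rewrite -lk eq_sym; split.
  have [lk' _|lk'] := eqVneq l' k; last by case=> E; [move: (c_gt0 l)|move: (c_gt0 l')]; first [by rewrite E | by rewrite -E].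
  by exists l; split=> // h /H; rewrite lk' => -[]; [right|left].
Qed.

(** For c_l > 1 the dichotomy applies at x_l; [q] rules out its first alternative and the non-member
    x_k^(c_k) the second. *)
Let others (q : mono) l : q \in M -> l != k -> q l = c l :> nat -> c l = 1%N.
Proof.
move=> qM lk ql; have := c_gt0 l; have [cl|cl] := ltnP 1 (c l); last by lia.
case: (F3 cl) => [/(_ _ qM)|/(_ _ ray_top)]; first by lia.
by rewrite rayE// (negPf lk); lia.
Qed.

Lemma typed_two i : i != k -> (c i <= 2)%N -> ((c k <= c i)%N || (c i == 1%N)) ->
  (forall g, (g \in M) = (g k < c k)%N && (g i < c i)%N) -> typed.
Proof.
move=> ik ci ki ME.
have oth l : l != k -> l != i -> c l = 1%N.
  move=> lk li; apply: (others (q := mono_of c (fun l => if (l == k) || (l == i) then 0%N else c l))) => //.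
    by rewrite ME !mono_ofE !eqxx orbT /= !min0n !c_gt0.
  by rewrite mono_ofE (negPf lk) (negPf li) minnn.
have [ci1|ci2] : c i = 1%N \/ c i = 2 by have := c_gt0 i; lia.
  have pl c0 M0 : [:: c k; c i] = c0 -> (forall g : mono, (g \in M) = M0 [:: g k : nat; g i : nat]) ->
      pulled M c0 M0.
    move=> c0E M0E; exists [:: k; i]; split=> //=; first by rewrite inE eq_sym ik.
    by move=> l; rewrite !inE negb_or => /andP[lk li]; apply: oth.
  have [ck1|ck2] : c k = 1%N \/ c k = 2 by have := c_gt0 k; lia.
    by exists 2%N; split=> //; apply: pl => [|g]; rewrite ?ME ?[X in (_ < X)%N && _]ck1 ?[X in _ && (_ < X)%N]ci1 ?ck1 ?ci1.
  by exists 3%N; split=> //; apply: pl => [|g]; rewrite ?ME ?[X in (_ < X)%N && _]ck2 ?[X in _ && (_ < X)%N]ci1 ?ck2 ?ci1.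
have pl c0 M0 : [:: c i; c k] = c0 -> (forall g : mono, (g \in M) = M0 [:: g i : nat; g k : nat]) ->
    pulled M c0 M0.
  move=> c0E M0E; exists [:: i; k]; split=> //=; first by rewrite inE ik.
  by move=> l; rewrite !inE negb_or => /andP[li lk]; apply: oth.
have [ck1|ck2] : c k = 1%N \/ c k = 2 by have := c_gt0 k; lia.
  by exists 3%N; split=> //; apply: pl => [|g]; rewrite ?ME ?[X in (_ < X)%N && _]ck1 ?[X in _ && (_ < X)%N]ci2 ?ck1 ?ci2 // andbC.
by exists 4%N; split=> //; apply: pl => [|g]; rewrite ?ME ?[X in (_ < X)%N && _]ck2 ?[X in _ && (_ < X)%N]ci2 ?ck2 ?ci2 // andbC.
Qed.

Lemma typed_three i j : i != k -> j != k -> i != j -> c i = 1%N -> c j = 1%N ->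
  (forall g, (g \in M) = (g k < c k)%N && ((g i == 0 :> nat) || (g j == 0 :> nat))) ->
  typed.
Proof.
move=> ik jk ij ci cj ME.
have oth l : l != k -> l != i -> l != j -> c l = 1%N.
  move=> lk li lj; apply: (others (q := mono_of c (fun l => if (l == k) || (l == i) then 0%N else c l))) => //.
    by rewrite ME !mono_ofE !eqxx orbT /= !min0n c_gt0.
  by rewrite mono_ofE (negPf lk) (negPf li) minnn.
have pl c0 M0 : [:: c k; c i; c j] = c0 ->
    (forall g : mono, (g \in M) = M0 [:: g k : nat; g i : nat; g j : nat]) -> pulled M c0 M0.
  move=> c0E M0E; exists [:: k; i; j]; split=> //=.
    by rewrite !inE negb_or ![k == _]eq_sym ik jk ij.
  by move=> l; rewrite !inE !negb_or => /and3P[lk li lj]; apply: oth.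
have [ck1|ck2] : c k = 1%N \/ c k = 2 by have := c_gt0 k; lia.
  by exists 5%N; split=> //; apply: pl => [|g]; rewrite ?ME ?[X in (_ < X)%N && _]ck1 ?ck1 ?ci ?cj.
by exists 6%N; split=> //; apply: pl => [|g]; rewrite ?ME ?[X in (_ < X)%N && _]ck2 ?ck2 ?ci ?cj.
Qed.

(** The generator dividing [coray k 0] is x_i, x_i^2 or x_i x_i' and does not involve x_k. As a
    non-member it obeys the clause on k and j, so j is one of its variables. *)
Lemma typed_top_literal : typed.
Proof.
have [j [jk _ Wj]] := clause zero_mem.
have ck0 := c_gt0 k.
have single i : i != k -> (forall g, g \in M -> g i = 0%N :> nat) -> typed.
  move=> ik Zi; have : ray i 1 \notin M.
    by apply/negP => /Zi; rewrite rayE ?c_gt0// eqxx.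
  move=> /Wj; rewrite !rayE ?c_gt0// (eq_sym k) (negPf ik).
  have [ji|_] := eqVneq j i; last by have := c_gt0 j; lia.
  subst j => -[E|E]; first by lia.
  have ci : c i = 1%N by rewrite -E.
  apply: (typed_two ik); rewrite ?ci ?orbT// => g.
  apply/idP/idP => [gM|]; first by rewrite top_k//= (Zi g gM) c_gt0.
  by apply: contraLR => /Wj[] E'; rewrite E' ltnn ?andbF.
case: (F1 nc0) => [[i bi Zi]|[i bi Zi]|[i [i' [ii bi bi' Zi]]]].
- apply: (single i) => //; apply: contraTneq bi => ->; by rewrite corayE// eqxx.
- have ik : i != k by apply: contraTneq bi => ->; rewrite corayE// eqxx.
  rewrite corayE// (negPf ik) in bi.
  have /Wj : ray i 2 \notin M by apply/negP => /Zi; rewrite rayE// eqxx.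
  rewrite !rayE// (eq_sym k) (negPf ik).
  have [ji|_] := eqVneq j i; last by have := c_gt0 j; lia.
  subst j => -[E|E]; first by lia.
  have ci : c i = 2%N by rewrite -E.
  apply: (typed_two ik); rewrite ?ci// ?ck// => g.
  apply/idP/idP => [gM|]; first by rewrite top_k//= (leq_ltn_trans (Zi g gM)) ?ci.
  by apply: contraLR => /Wj[] E'; rewrite E' ltnn ?andbF.
have ik : i != k by apply: contraTneq bi => ->; rewrite corayE// eqxx.
have ik' : i' != k by apply: contraTneq bi' => ->; rewrite corayE// eqxx.
have nP : pair i i' \notin M.
  by apply/negP => /Zi; rewrite !pairE !eqxx orbT; case.
wlog ji : i i' ii bi bi' Zi ik ik' nP / j = i.
  move=> H; have := Wj _ nP; rewrite !pairE (eq_sym k) (negPf ik) (eq_sym k) (negPf ik') /=.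
  have [ji|ji] := eqVneq j i; first by move=> _; apply: (H i i').
  have [ji'|_] := eqVneq j i'; last by case=> E; [move: ck0|move: (c_gt0 j)]; rewrite -E.
  move=> _; apply: (H i' i) => //; first by rewrite eq_sym.
    by move=> g /Zi[]; [right|left].
  by apply: contra nP => nP; apply: dn nP _ => l; rewrite !pairE orbC.
subst j; have ci : c i = 1%N.
  have := Wj _ nP; rewrite !pairE (eq_sym k) (negPf ik) (eq_sym k) (negPf ik') eqxx /=.
  by case=> [E|<-//]; move: ck0; rewrite -E.
have [eM|eM] := boolP (ray i 1 \in M); last first.
  apply: (single i) => // g gM; apply/eqP; rewrite -leqn0 leqNgt; apply: contra eM.
  exact: dn_ray.
(* The clause belonging to the member x_i cannot use x_i, whose exponent is full, so it uses
   x_i'. *)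
have [j' [jk' aj' Wj']] := clause eM.
rewrite rayE ?c_gt0// in aj'.
have ji' : j' = i'.
  have := Wj' _ nP; rewrite !pairE (eq_sym k) (negPf ik) (eq_sym k) (negPf ik') /=.
  move: aj'; have [->|_] := eqVneq j' i; first by rewrite ci.
  have [->//|_] := eqVneq j' i'.
  by move=> cj' [] E; [move: ck0|move: cj']; rewrite -E.
subst j'; have ci' : c i' = 1%N.
  have := Wj' _ nP; rewrite !pairE (eq_sym k) (negPf ik) (eq_sym k) (negPf ik') eqxx orbT /=.
  by case=> [E|<-//]; move: ck0; rewrite -E.
apply: (typed_three ik ik') => // g; apply/idP/idP => [gM|].
  by rewrite top_k//=; apply/orP; case: (Zi g gM) => ->; [left|right].
apply: contraLR => gM; case: (Wj _ gM) => [->|gi]; first by rewrite ltnn.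
case: (Wj' _ gM) => [->|gi']; first by rewrite ltnn.
by rewrite gi gi' ci ci' andbF.
Qed.

End TopLiteral.

Let ray_le g k r : ray k r \notin M -> (r <= c k)%N -> g \in M -> (g k < r)%N.
Proof. by move=> nr rc gM; rewrite ltnNge; apply: contra nr; apply: dn_ray. Qed.

(** * A variable with c_k > 1 whose square is not in the multicomplex *)

Section Thin.
Variable k : 'I_m.
Hypothesis ck : (1 < c k)%N.
Hypothesis thin : forall g, g \in M -> (g k <= 1)%N.

Let ray2 : ray k 2 \notin M.
Proof. by apply/negP => /thin; rewrite rayE// eqxx. Qed.

Let others (q : mono) l : q \in M -> l != k -> q l = c l :> nat -> c l = 1%N.
Proof.
move=> qM lk ql; have := c_gt0 l; have [cl|cl] := ltnP 1 (c l); last by lia.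
case: (F3 cl) => [/(_ _ qM)|/(_ _ ray2)]; first by lia.
by rewrite rayE// (negPf lk); lia.
Qed.

Let typed_one r : coray k 0 \in M -> (r < size murai_types)%N ->
  let T := nth murai_type0 murai_types r in
  [:: c k] = mt_c T -> (forall g : mono, (g \in M) = mt_M T [:: g k : nat]) -> typed.
Proof.
move=> c0M rs T cE ME; exists r; split=> //; exists [:: k]; split=> // l.
rewrite inE => lk; apply: (others c0M) => //; by rewrite corayE// (negPf lk).
Qed.

(** [coray k r] is the largest monomial with exponent r at x_k. If [coray k 1] is in [M], then [M]
    depends on x_k alone; if [coray k 0] is not, then c_k = 2 and the top power is omitted; in
    between, at most one further variable matters. *)
Lemma typed_thin : typed.
Proof.
have ck1 := ltnW ck.
have [c1M|c1M] := boolP (coray k 1 \in M).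
  have c0M : coray k 0 \in M.
    by apply: dn c1M _ => l; rewrite !corayE//; case: eqP.
  have ME g : (g \in M) = (g k < 2)%N.
    by apply/idP/idP => [/thin//|gk]; apply: dn_coray c1M _ _.
  case: (F2 c1M) => [[l al H]|[l al H]|[l [l' [ll al al' H]]]].
  - have lk : l = k by apply/eqP; move: al; rewrite corayE//; case: eqP => //; lia.
    have nc2 : coray k 2 \notin M by rewrite ME corayE// eqxx.
    have := H _ nc2; rewrite lk corayE// eqxx => c2.
    by apply: (@typed_one 1) => //; rewrite -c2.
  - have lk : l = k by apply/eqP; move: al; rewrite corayE//; case: eqP => //; lia.
    have nc2 : coray k 2 \notin M by rewrite ME corayE// eqxx.
    move: al (H _ nc2); rewrite lk !corayE// eqxx => c3 c3'.
    have c3E : c k = 3%N by lia.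
    by apply: (@typed_one 8) => //; rewrite c3E.
  - have lk : l = k by apply/eqP; move: al; rewrite corayE//; case: eqP => //; lia.
    have lk' : l' = k by apply/eqP; move: al'; rewrite corayE//; case: eqP => //; lia.
    by rewrite lk lk' eqxx in ll.
have [c0M|c0M] := boolP (coray k 0 \in M); last first.
  suff c2 : c k = 2%N.
    by apply: (@typed_top_literal k); rewrite ?c2// => g gM; rewrite [X in (_ < X)%N]c2 ltnS thin.
  case: (F2 zero_mem) => [[l al H]|[l al H]|[l [l' [ll al al' H]]]].
  - have := H _ ray2; have := H _ c0M; rewrite rayE// corayE//.
    by case: eqP => [->|_]; have := c_gt0 l; lia.
  - have := H _ ray2; have := H _ c0M; rewrite rayE// corayE//.
    rewrite zeroE in al; case: eqP => [lk|_]; last by lia.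
    by rewrite lk in al *; lia.
  - have := H _ ray2; rewrite !rayE//.
    have [->|lk] := eqVneq l k; have [->|lk'] := eqVneq l' k; case=> E;
      first [by rewrite -E | by move: (c_gt0 l); rewrite -E | by move: (c_gt0 l'); rewrite -E].
(* All other exponents of [coray k 0] are full, so the condition on non-members belonging to it
   concerns x_k alone; the non-member [coray k 1] then forces c_k = 2. *)
have [c2 W1] : c k = 2%N /\ forall h, h \notin M -> (1 <= h k)%N.
  case: (F2 c0M) => [[l al H]|[l al H]|[l [l' [ll al al' H]]]].
  - have lk : l = k by apply/eqP; move: al; rewrite corayE//; case: eqP => //; lia.
    by have := H _ c1M; rewrite lk corayE// eqxx; lia.
  - have lk : l = k by apply/eqP; move: al; rewrite corayE//; case: eqP => //; lia.
    have := H _ c1M; rewrite lk corayE// eqxx => c2.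
    have c2E : c k = 2%N by lia.
    by split=> // h /H; rewrite lk [X in (X <= _)%N]c2E.
  - have lk : l = k by apply/eqP; move: al; rewrite corayE//; case: eqP => //; lia.
    have lk' : l' = k by apply/eqP; move: al'; rewrite corayE//; case: eqP => //; lia.
    by rewrite lk lk' eqxx in ll.
have [e1M|e1M] := boolP (ray k 1 \in M); last first.
  have ME g : (g \in M) = (g k == 0 :> nat).
    apply/idP/idP => [gM|/eqP gk]; first by have := ray_le e1M ck1 gM; lia.
    by apply: contraT => /W1; rewrite gk.
  by apply: (@typed_one 7) => //; rewrite c2.
have [i ik Zi] : exists2 i, i != k &
    forall g, g \in M -> g k = 0%N :> nat \/ g i = 0%N :> nat.
  case: (F1 c1M) => [[l al H]|[l al H]|[l [l' [ll al al' H]]]].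
  - have := H _ e1M; have := H _ c0M; rewrite rayE// corayE//.
    by case: eqP => //; have := c_gt0 l; lia.
  - have := H _ c0M; move: al; rewrite !corayE//; case: eqP => //; lia.
  - have := H _ c0M; rewrite !corayE//.
    have [lk|lk] := eqVneq l k.
      by move=> _; exists l'; rewrite -?lk 1?eq_sym.
    have [lk'|lk'] := eqVneq l' k; last by case=> E; [move: (c_gt0 l)|move: (c_gt0 l')]; first [by rewrite E | by rewrite -E].
    move=> _; exists l => // g /H; rewrite lk'; case; [by right|by left].
have eiM : pair k i \notin M by apply/negP => /Zi; rewrite !pairE !eqxx orbT; case.
have [ci Wi] : c i = 1%N /\
    forall h, h \notin M -> h k = c k :> nat \/ h i = c i :> nat.
  have key l : l != k -> (forall h, h \notin M -> h k = c k :> nat \/ h l = c l :> nat) ->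
      c i = 1%N /\ forall h, h \notin M -> h k = c k :> nat \/ h i = c i :> nat.
    move=> lk H; have := H _ eiM; rewrite !pairE eqxx /= (negPf lk) /=.
    case=> [E|]; first by exfalso; move: ck; rewrite -E.
    have [li E|_ E] := eqVneq l i; last by exfalso; move: (c_gt0 l); rewrite -E.
    by subst l; split=> //; rewrite -E.
  case: (F2 e1M) => [[l al H]|[l al H]|[l [l' [ll al al' H]]]].
  - have := H _ ray2; have := H _ c1M; rewrite rayE// corayE//.
    by case: eqP => [->|_]; have := c_gt0 l; lia.
  - have := H _ ray2; move: al; rewrite !rayE//.
    case: eqP => [lk|_]; last by lia.
    by rewrite lk; lia.
  - have := H _ ray2; rewrite !rayE//.
    have [lk|lk] := eqVneq l k.
      by move=> _; apply: (key l'); rewrite -?lk 1?eq_sym.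
    have [lk'|lk'] := eqVneq l' k; last by case=> E; [move: (c_gt0 l)|move: (c_gt0 l')]; first [by rewrite E | by rewrite -E].
    move=> _; apply: (key l) => // h /H; rewrite lk'; case; [by right|by left].
have ME g : (g \in M) = (g k == 0 :> nat) || ((g k == 1 :> nat) && (g i == 0 :> nat)).
  apply/idP/idP => [gM|]; first by have := thin gM; have := Zi _ gM; lia.
  apply: contraLR => gM; case: (Wi _ gM) => ->; first by rewrite c2.
  by rewrite ci andbF orbF -lt0n W1.
exists 9%N; split=> //; exists [:: k; i]; split=> //=.
- by rewrite inE eq_sym ik.
- by rewrite c2 ci.
- move=> l; rewrite !inE negb_or => /andP[lk li].
  by apply: (others c0M) => //; rewrite corayE// (negPf lk).
Qed.

End Thin.

(** * All c_i = 1: graphs and their vertex covers *)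

Section Squarefree.
Hypothesis c1 : forall i, c i = 1%N.

Lemma typed_zero k : (forall g, g \in M -> g k = 0%N :> nat) -> typed.
Proof.
move=> Zk; have [c0M|c0M] := boolP (coray k 0 \in M); last first.
  by apply: (@typed_top_literal k); rewrite ?c1// => g /Zk ->; apply: c_gt0.
exists 0%N; split=> //; exists [:: k]; split=> //=; first by rewrite c1.
move=> g; apply/idP/idP => [/Zk ->//|gk].
by apply: dn_coray c0M _ _; rewrite // -ltnS.
Qed.

Hypothesis noZ : forall i, ray i 1 \in M.
Hypothesis noW : forall i, coray i 0 \notin M.

(** [M] consists of the independent sets of the graph of [edge], and [clause] says that two elements
    form a vertex cover. So the graphs sought are those whose minimal vertex covers all have two
    elements; up to isolated vertices they turn out to be K_3, 2K_2, C_4 and P_4. *)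
Let edge i j := forall g, g \in M -> (g i == 0 :> nat) || (g j == 0 :> nat).
Let clause i j := forall h, h \notin M -> (h i == 1 :> nat) || (h j == 1 :> nat).

Let edgeC i j : edge i j -> edge j i.
Proof. by move=> H g /H; rewrite orbC. Qed.
Let clauseC i j : clause i j -> clause j i.
Proof. by move=> H h /H; rewrite orbC. Qed.

Let edge_of b : b \notin M -> exists i j,
  [/\ i != j, (0 < b i)%N, (0 < b j)%N & edge i j].
Proof.
move=> bM; case: (F1 bM) => [[i bi H]|[i bi H]|[i [j [ij bi bj H]]]].
- by have := H _ (noZ i); rewrite rayE ?c1// eqxx.
- by have := leq_trans bi (le b i); rewrite c1.
- by exists i, j; split=> // g /H[] ->; rewrite ?eqxx ?orbT.
Qed.

Let clause_of a : a \in M -> exists i j,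
  [/\ i != j, a i = 0%N :> nat, a j = 0%N :> nat & clause i j].
Proof.
move=> aM; case: (F2 aM) => [[i ai H]|[i ai H]|[i [j [ij ai aj H]]]].
- by have := H _ (noW i); rewrite corayE// eqxx c1.
- by have := leq_ltn_trans (ltn0Sn (a i)) ai; rewrite c1.
- exists i, j; split=> //.
  + by move: ai; rewrite [X in (_ < X)%N]c1 ltnS leqn0 => /eqP.
  + by move: aj; rewrite [X in (_ < X)%N]c1 ltnS leqn0 => /eqP.
  + by move=> h /H[] ->; [rewrite (c1 i) eqxx|rewrite (c1 j) eqxx orbT].
Qed.

Let edge_or i j : i != j -> pair i j \in M \/ edge i j.
Proof.
move=> ij; have [|nP] := boolP (pair i j \in M); first by left.
right=> g gM; rewrite !eqn0Ngt -negb_and; apply: contra nP => /andP[].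
exact: dn_pair gM.
Qed.

Let meet i j p q : edge i j -> clause p q ->
  [|| p == i, p == j, q == i | q == j].
Proof.
move=> Eij Cpq; have nP : pair i j \notin M.
  by apply/negP => /Eij; rewrite !pairE !eqxx orbT.
by have := Cpq _ nP; rewrite !pairE; case: (p == i); case: (p == j); case: (q == i); case: (q == j).
Qed.

Let le1 (g : mono) i : (g i <= 1)%N.
Proof. by have := le g i; rewrite [X in (_ <= X)%N]c1. Qed.

Lemma typed_squarefree r (ws : seq 'I_m) : (r < size murai_types)%N -> uniq ws ->
  let T := nth murai_type0 murai_types r in
  mt_c T = [seq 1%N | _ <- ws] ->
  (forall g : mono, (g \in M) = mt_M T [seq (g i : nat) | i <- ws]) -> typed.
Proof.
move=> rs us T cE ME; exists r; split=> //; exists ws; split=> //.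
by rewrite [RHS]cE; apply: eq_map => i; rewrite c1.
Qed.

Let typed_K3 a b p : edge a b -> edge a p -> edge b p ->
  clause a b -> clause a p -> clause b p -> uniq [:: a; b; p] -> typed.
Proof.
move=> E1 E2 E3 C1 C2 C3 u; apply: (@typed_squarefree 10 [:: a; b; p]) => //= g.
apply/idP/idP => [gM|]; first by rewrite E1 ?E2 ?E3.
apply: contraLR => gM; move: (C1 g gM) (C2 g gM) (C3 g gM) (le1 g a) (le1 g b) (le1 g p).
move: (g a : nat) (g b : nat) (g p : nat) => x y z; lia.
Qed.

Let typed_2K2 a b p s : edge a b -> edge p s ->
  clause a p -> clause a s -> clause b p -> clause b s ->
  uniq [:: a; b; p; s] -> typed.
Proof.
move=> E1 E2 C1 C2 C3 C4 u; apply: (@typed_squarefree 11 [:: a; b; p; s]) => //= g.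
apply/idP/idP => [gM|]; first by rewrite E1 ?E2.
apply: contraLR => gM; move: (C1 g gM) (C2 g gM) (C3 g gM) (C4 g gM).
move: (g a : nat) (g b : nat) (g p : nat) (g s : nat) => x y z w; lia.
Qed.

Let typed_C4 a b p s : clause a b -> clause p s ->
  edge a p -> edge a s -> edge b p -> edge b s ->
  uniq [:: a; b; p; s] -> typed.
Proof.
move=> C1 C2 E1 E2 E3 E4 u; apply: (@typed_squarefree 12 [:: a; b; p; s]) => //= g.
apply/idP/idP => [gM|].
  move: (E1 g gM) (E2 g gM) (E3 g gM) (E4 g gM).
  move: (g a : nat) (g b : nat) (g p : nat) (g s : nat) => x y z w; lia.
apply: contraLR => gM; move: (C1 g gM) (C2 g gM).
move: (g a : nat) (g b : nat) (g p : nat) (g s : nat) => x y z w; lia.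
Qed.

Let typed_P4 b a p s : edge b a -> edge a p -> edge p s ->
  clause a p -> clause a s -> clause b p -> uniq [:: b; a; p; s] -> typed.
Proof.
move=> E1 E2 E3 C1 C2 C3 u; apply: (@typed_squarefree 13 [:: b; a; p; s]) => //= g.
apply/idP/idP => [gM|]; first by rewrite E1 ?E2 ?E3.
apply: contraLR => gM; move: (C1 g gM) (C2 g gM) (C3 g gM).
move: (g a : nat) (g b : nat) (g p : nat) (g s : nat) => x y z w; lia.
Qed.

(** A cover disjoint from the support of [a] must meet the edge on u and e, and can do so only in
    u. *)
Let clause_one (a : mono) u e : a \in M -> edge u e -> a e != 0 :> nat ->
  exists q, [/\ q != u, a q = 0%N :> nat & clause u q].
Proof.
move=> aM Eue ae; have [i [j [ij ai aj C]]] := clause_of aM.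
have ie : i != e by apply: contraNneq ae => <-; apply/eqP.
have je : j != e by apply: contraNneq ae => <-; apply/eqP.
case/or4P: (meet Eue C) => /eqP E; subst; last by rewrite eqxx in je.
- by exists j; rewrite eq_sym.
- by rewrite eqxx in ie.
- by exists i; split=> //; apply: clauseC.
Qed.

(** Dually, an edge inside the support of [b] must meet the cover {u, e}, and e is not in that
    support. *)
Let edge_one b u e : b \notin M -> clause u e -> b e = 0%N :> nat ->
  exists q, [/\ q != u, b q != 0 :> nat & edge u q].
Proof.
move=> bM Cue be; have [i [j [ij bi bj E]]] := edge_of bM.
have ie : e != i by apply: contraTneq bi => <-; rewrite be.
have je : e != j by apply: contraTneq bj => <-; rewrite be.
case/or4P: (meet E Cue) => /eqP U; subst; rewrite ?eqxx// in ie je.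
- by exists j; rewrite eq_sym -lt0n.
- by exists i; rewrite -lt0n; split=> //; apply: edgeC.
Qed.

(** Two edges force u and v into the two-element cover disjoint from the support of [a], which is
    then {u, v}. *)
Let clause_force (a : mono) u v e f : a \in M -> u != v -> edge u e -> a e != 0 :> nat ->
  edge v f -> a f != 0 :> nat -> clause u v.
Proof.
move=> aM uv Eue ae Evf af; have [i [j [ij ai aj C]]] := clause_of aM.
have zero l w : a l = 0%N :> nat -> a w != 0 :> nat -> (l == w) = false.
  by move=> al; apply: contraNF => /eqP <-; apply/eqP.
move: (meet Eue C) (meet Evf C); rewrite !(zero _ _ ai ae, zero _ _ aj ae, zero _ _ ai af, zero _ _ aj af).
rewrite !orbF /=; move=> /orP[]/eqP E1 /orP[]/eqP E2; subst; rewrite ?eqxx// in uv *.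
exact: clauseC.
Qed.

Let rayk i l : (ray i 1 l != 0 :> nat) = (l == i).
Proof. by rewrite rayE ?c1//; case: (l == i). Qed.

Let ray0 i l : ray i 1 l = 0%N :> nat -> l != i.
Proof. by rewrite rayE ?c1//; case: eqP. Qed.

Let coray0 i : coray i 0 i = 0%N :> nat.
Proof. by rewrite corayE// eqxx. Qed.

Let coray_neq i l : coray i 0 l != 0 :> nat -> l != i.
Proof. by rewrite corayE//; case: (l == i). Qed.

Let pair1 i j : pair i j i != 0 :> nat.
Proof. by rewrite pairE eqxx. Qed.
Let pair2 i j : pair i j j != 0 :> nat.
Proof. by rewrite pairE eqxx orbT. Qed.

Ltac distinct := rewrite /= !inE !negb_or;
  repeat (apply/andP; split); first [done | by rewrite eq_sym].

(** Given an edge ab, the members x_a and x_b force covers bq and ap. If p = q, a further edge at p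
    leads to K_3, P_4 or 2K_2. Otherwise four vertices are present, and whether aq and bp are edges
    leads to P_4, C_4 or 2K_2. *)
Lemma typed_no_literal : typed.
Proof.
have rii i : ray i 1 i != 0 :> nat by rewrite rayk.
have [a [b [ab _ _ Eab]]] : exists i j, [/\ i != j, true, true & edge i j].
  have topN : mono_of c c \notin M.
    case: Mproper => _; apply: contraNN => tM; apply/eqP/setP => g; rewrite inE.
    by apply: dn tM _ => i; rewrite mono_ofE minnn; apply: le.
  by have [i [j [ij _ _ E]]] := edge_of topN; exists i, j.
have ba : b != a by rewrite eq_sym.
have Eba := edgeC Eab.
have [q [qb /ray0 qa Cbq]] := clause_one (noZ a) Eba (rii a).
have [p [pa /ray0 pb Cap]] := clause_one (noZ b) Eab (rii b).
have [pq|pq] := eqVneq p q.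
  subst q; have Cbp := Cbq.
  have [s [sp /coray_neq sb Eps]] := edge_one (noW b) (clauseC Cbp) (coray0 b).
  have [sa|sa] := eqVneq s a.
    subst s; have Epa := Eps.
    have [s [sp' /coray_neq sa Eps']] := edge_one (noW a) (clauseC Cap) (coray0 a).
    have [sb'|sb'] := eqVneq s b.
      subst s; have Cab : clause a b.
        exact: clause_force (noZ p) ab (edgeC Epa) (rii p) (edgeC Eps') (rii p).
      by apply: (typed_K3 Eab (edgeC Epa) (edgeC Eps') Cab Cap Cbp); distinct.
    have as' : a != s by rewrite eq_sym.
    have Cas := clause_force (noZ p) as' (edgeC Epa) (rii p) (edgeC Eps') (rii p).
    by apply: (typed_P4 Eba (edgeC Epa) Eps' Cap Cas Cbp); distinct.
  have as' : a != s by rewrite eq_sym.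
  have bs : b != s by rewrite eq_sym.
  have [q [qs /ray0 qp Csq]] := clause_one (noZ p) (edgeC Eps) (rii p).
  have [ap bp] : a != p /\ b != p by rewrite !(eq_sym _ p).
  case/or4P: (meet Eab (clauseC Csq)) => [/eqP E|/eqP E|E|E]; last by rewrite (negPf sb) in E.
  - subst q; have Cas := clauseC Csq; case: (edge_or pa) => [pM|Epa].
      have Csb := clause_force pM sb (edgeC Eps) (pair1 p a) Eba (pair2 p a).
      by apply: (typed_2K2 Eab Eps Cap Cas Cbp (clauseC Csb)); distinct.
    by apply: (typed_P4 Eba (edgeC Epa) Eps Cap Cas Cbp); distinct.
  - subst q; have Cbs := clauseC Csq; case: (edge_or pb) => [pM|Epb].
      have Csa := clause_force pM sa (edgeC Eps) (pair1 p b) Eab (pair2 p b).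
      by apply: (typed_2K2 Eab Eps Cap (clauseC Csa) Cbp Cbs); distinct.
    by apply: (typed_P4 Eab (edgeC Epb) Eps Cbp Cbs Cap); distinct.
  - by rewrite (negPf sa) in E.
have qp : q != p by rewrite eq_sym.
have [aq bp] : a != q /\ b != p by rewrite !(eq_sym a, eq_sym b).
have uniqs : [/\ uniq [:: b; q; a; p], uniq [:: b; a; q; p], uniq [:: a; b; p; q]
    & uniq [:: q; a; b; p]] by split; distinct.
have [u1 u2 u3 u4] := uniqs.
have [[Eaq|pM] [Ebp|pM']] : (edge a q \/ pair a q \in M) /\ (edge b p \/ pair b p \in M).
  by split; [case: (edge_or aq)|case: (edge_or bp)]; by [left|right].
- case: (edge_or qp) => [qpM|Eqp].
    have Cab := clause_force qpM ab Eaq (pair1 q p) Ebp (pair2 q p).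
    exact: (typed_P4 (edgeC Eaq) Eab Ebp Cab Cap (clauseC Cbq)).
  exact: (typed_C4 Cbq Cap Eba Ebp (edgeC Eaq) Eqp).
- have [s [sq /coray_neq sb Eqs]] := edge_one (noW b) (clauseC Cbq) (coray0 b).
  have [t [tp /coray_neq ta Ept]] := edge_one (noW a) (clauseC Cap) (coray0 a).
  have Epq : edge p q.
    have := meet Ept Cbq; rewrite (negPf bp) (eq_sym b) (negPf qp) /=.
    case/orP=> /eqP E; subst t => //.
    by have := Ept _ pM'; rewrite (negPf (pair1 b p)) (negPf (pair2 b p)).
  have Caq := clause_force pM' aq Eab (pair1 b p) (edgeC Epq) (pair2 b p).
  exact: (typed_P4 Eba Eaq (edgeC Epq) Caq Cap Cbq).
- have [s [sq /coray_neq sb Eqs]] := edge_one (noW b) (clauseC Cbq) (coray0 b).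
  have Eqp : edge q p.
    have := meet Eqs Cap; rewrite (negPf aq) (negPf pq) (eq_sym a) /=.
    case/orP=> /eqP E; subst s => //.
    by have := Eqs _ pM; rewrite (negPf (pair1 a q)) (negPf (pair2 a q)).
  have Cbp := clause_force pM bp Eba (pair1 a q) (edgeC Eqp) (pair2 a q).
  exact: (typed_P4 Eab Ebp (edgeC Eqp) Cbp Cbq Cap).
- have [s [sq /coray_neq sb Eqs]] := edge_one (noW b) (clauseC Cbq) (coray0 b).
  have Eqp : edge q p.
    have := meet Eqs Cap; rewrite (negPf aq) (negPf pq) (eq_sym a) /=.
    case/orP=> /eqP E; subst s => //.
    by have := Eqs _ pM; rewrite (negPf (pair1 a q)) (negPf (pair2 a q)).
  have Cbp := clause_force pM bp Eba (pair1 a q) (edgeC Eqp) (pair2 a q).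
  have Caq := clause_force pM' aq Eab (pair1 b p) Eqp (pair2 b p).
  exact: (typed_2K2 Eab (edgeC Eqp) Cap Caq Cbp Cbq).
Qed.

End Squarefree.

Lemma typed_cases :
  [\/ typed, exists2 k, (1 < c k)%N & forall h, h \notin M -> (c k <= (h k).+1)%N
   | (forall i, c i = 1%N) /\ exists k, forall h, h \notin M -> h k = c k :> nat].
Proof.
have [[k ck]|nc] := pselect (exists k, (1 < c k)%N).
  by case: (F3 ck) => H; [apply: Or31; apply: (typed_thin ck)|apply: Or32; exists k].
have c1 i : c i = 1%N.
  apply/eqP; rewrite eqn_leq c_gt0 andbT leqNgt; apply/negP => ci.
  by apply: nc; exists i.
have [[k nk]|noZ] := pselect (exists k, ray k 1 \notin M).
  apply: Or31; apply: (typed_zero c1 (k := k)) => g gM.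
  by apply/eqP; rewrite -leqn0 -ltnS; apply: ray_le nk _ gM; rewrite c1.
have [[k nk]|noW] := pselect (exists k, coray k 0 \in M).
  apply: Or33; split=> //; exists k => h hM; apply/eqP.
  rewrite eqn_leq le /= [X in (X <= _)%N]c1.
  by rewrite lt0n; apply: contra hM => /eqP h0; apply: dn_coray nk _ _; rewrite ?h0.
apply: Or31; apply: typed_no_literal => // i.
  by apply: contraT => ni; case: noZ; exists i.
by apply/negP => iM; case: noW; exists i.
Qed.

End Classification.

Lemma murai_classification (m : nat) (c : 'I_m -> nat) (M : {set cmonomial c}) :
  (forall i, 0 < c i)%N -> proper_multicomplex M -> flag_complex (murai_sphere M) ->
  typed M \/ typed (dual_multicomplex M).
Proof.
move=> c0 Mp Mf; have Mp' := dual_proper Mp.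
have Mf' := dual_flag Mp Mf.
have dualE g : g \in dual_multicomplex M -> mono_rev g \notin M by rewrite inE.
case: (typed_cases c0 Mp Mf) => [|[k ck H]|[c1 [k H]]]; [by left|right|right].
  apply: (typed_thin c0 Mp' Mf' ck) => g /dualE/H; rewrite mono_revE.
  by have := mono_le g k; lia.
apply: (typed_zero c0 Mp' Mf' c1 (k := k)) => g /dualE/H; rewrite mono_revE.
by have := mono_le g k; have := c0 k; lia.
Qed.

(** * Isomorphism types of flag Murai spheres *)

Definition points (c0 : seq nat) : seq (seq nat) :=
  foldr (fun k ps => [seq j :: v | j <- iota 0 k.+1, v <- ps]) [:: [::]] c0.

Lemma mem_points c0 v : (v \in points c0) = all2 leq v c0.
Proof.
elim: c0 v => [|k c0 IH] v; first by case: v.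
change (v \in [seq j :: w | j <- iota 0 k.+1, w <- points c0] = all2 leq v (k :: c0)).
apply/allpairsP/idP => [[[j w] [jk wc ->]]|].
  by move: jk; rewrite (mem_iota 0 k.+1) ltnS /= -IH wc andbT.
case: v => [|j w] //= /andP[jk wc].
by exists (j, w); split=> //=; rewrite ?IH// (mem_iota 0 k.+1) ltnS.
Qed.

Definition label := (nat * bool + nat)%type.

Definition label_adj (X : polydata) (L L' : label) : bool :=
  match L, L' with
  | inl (i, b), inl (j, b') => (i == j) && (b != b')
  | inr a, inr b => xadj X a b
  | _, _ => false
  end.

Section MuraiTypeCheck.
Variable T : murai_type.

Definition type_label (e j : nat) : option label := nth None (nth [::] (mt_label T) e) j.

(** [Some (e, j)] is the symbol with exponent j at the essential coordinate number e; [None] is a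
    symbol of an inessential coordinate and imposes nothing. *)
Definition type_avoids (v : seq nat) (o : option (nat * nat)) : bool :=
  if o is Some (e, j) then nth 0%N v e != j else true.

Definition type_has (b : bool) (o o' : option (nat * nat)) : bool :=
  has (fun v => [&& mt_M T v == b, type_avoids v o & type_avoids v o']) (points (mt_c T)).

Definition type_face o o' : bool := type_has true o o' && type_has false o o'.

Definition type_codes : seq (nat * nat) :=
  [seq (e, j) | e <- iota 0 (size (mt_c T)), j <- iota 0 (nth 0%N (mt_c T) e).+1].

Definition label_valid (L : label) : bool :=
  match L with inl (j, _) => (j < mt_cube T)%N | inr a => (a < xsize (mt_poly T))%N end.

Definition type_labels : seq (option label) := [seq type_label x.1 x.2 | x <- type_codes].

(** Both complexes being flag, it suffices to compare vertices and pairs: the labelled symbols are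
    the vertices, labels are valid and distinct, pairs are faces iff their labels are compatible,
    and every label occurs. *)
Definition murai_type_ok : bool :=
  [&& type_face None None,
   all (fun x => type_face (Some x) (Some x) == isSome (type_label x.1 x.2)) type_codes,
   all (fun x => if type_label x.1 x.2 is Some L then label_valid L else true) type_codes,
   all (fun x => all (fun y =>
     match type_label x.1 x.2, type_label y.1 y.2 with
     | Some L, Some L' => (type_face (Some x) (Some y) == ~~ label_adj (mt_poly T) L L')
                          && ((L == L') ==> (x == y))
     | _, _ => true
     end) type_codes) type_codes &
   all (fun j => (Some (inl (j, false)) \in type_labels) && (Some (inl (j, true)) \in type_labels))
     (iota 0 (mt_cube T)) &&
   all (fun a => Some (inr a) \in type_labels) (iota 0 (xsize (mt_poly T)))].

End MuraiTypeCheck.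

Lemma murai_types_ok : all murai_type_ok murai_types.
Proof. by vm_compute. Qed.

Section PulledIso.
Variables (m : nat) (c : 'I_m -> nat) (M : {set cmonomial c}).
Notation mono := (cmonomial c).
Notation symb := (csymbol c).
Hypothesis Mproper : proper_multicomplex M.
Hypothesis Mflag : flag_complex (murai_sphere M).
Variable T : murai_type.
Hypothesis Tok : murai_type_ok T.
Variable ws : seq 'I_m.
Hypothesis ws_uniq : uniq ws.
Hypothesis wsc : [seq c i | i <- ws] = mt_c T.
Hypothesis wsN : forall l, l \notin ws -> c l = 1%N.
Hypothesis wsM : forall g : mono, (g \in M) = mt_M T [seq (g i : nat) | i <- ws].

Let dn : lower_closed M := proper_lower_closed Mproper.

(** Outside [ws] the exponent does not affect membership in [M]; all that such a coordinate forbids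
    is using both of its symbols, recorded by [clash]. *)
Let code (s : symb) : option (nat * nat) :=
  if tag s \in ws then Some (index (tag s) ws, tagged s : nat) else None.

Let clash (s t : symb) : bool :=
  [&& tag s == tag t, tag s \notin ws & (tagged s : nat) != tagged t].

Let nth_ws (f : 'I_m -> nat) i : i \in ws -> nth 0%N [seq f i | i <- ws] (index i ws) = f i.
Proof. by move=> iws; rewrite (nth_map i) ?index_mem// nth_index. Qed.

Let type_avoidsP (g : mono) s : avoids g [set s]%SET ->
  type_avoids [seq (g i : nat) | i <- ws] (code s).
Proof.
move=> gs; rewrite /code; case: ifP => //= sws; apply/eqP.
by rewrite (nth_ws (fun i => g i)) //; apply: gs; rewrite inE.
Qed.

Let small l j : l \notin ws -> (j < (c l).+1)%N -> (j <= 1)%N.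
Proof. by move=> /wsN ->. Qed.

Let pair_avoid b s t :
  (exists g : mono, (g \in M) = b /\ avoids g [set s; t]%SET) <->
  type_has T b (code s) (code t) && ~~ clash s t.
Proof.
split=> [[g [gM ga]]|/andP[/hasP[v vp /and3P[vM vs vt]] ncl]].
  have gs : avoids g [set s]%SET by move=> s' s's; apply: ga; rewrite !inE in s's *; rewrite s's.
  have gt : avoids g [set t]%SET by move=> s' s's; apply: ga; rewrite !inE in s's *; rewrite s's orbT.
  apply/andP; split.
    apply/hasP; exists [seq (g i : nat) | i <- ws]; last first.
      by rewrite -wsM gM eqxx !type_avoidsP.
    rewrite mem_points -wsc; elim: (ws) => //= i w ->.
    by rewrite mono_le.
  apply/negP => /and3P[/eqP st sws /eqP nst].
  have h1 := gs s (set11 _); have h2 := gt t (set11 _).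
  have g1 := small sws (ltn_ord (g (tag s))); have s1 := small sws (ltn_ord (tagged s)).
  have sws' : tag t \notin ws by rewrite -st.
  have t1 := small sws' (ltn_ord (tagged t)).
  have E : g (tag t) = g (tag s) :> nat by rewrite st.
  move: h1 h2 g1 s1 t1 nst; rewrite E.
  move: (g (tag s) : nat) (tagged s : nat) (tagged t : nat) => x y z; clear; lia.
(* Outside [ws] the exponent is whichever of 0 and 1 differs from the symbol to be avoided; two
   symbols of one such coordinate agree since they do not clash. *)
pose g : mono := mono_of c (fun i => if i \in ws then nth 0%N v (index i ws)
  else if i == tag s then (tagged s == 0%N :> nat) : nat
  else (i == tag t) && (tagged t == 0%N :> nat)).
have gws i : i \in ws -> g i = nth 0%N v (index i ws) :> nat.
  move=> iws; rewrite mono_ofE iws; apply/minn_idPl.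
  have : all2 leq v (mt_c T) by rewrite -mem_points.
  rewrite -wsc all2E => /andP[/eqP sz /all_nthP H].
  have il : (index i ws < size (zip v [seq c i | i <- ws]))%N.
    by rewrite size_zip sz minnn size_map index_mem.
  have /= := H (0%N, 0%N) _ il; rewrite nth_zip//= (nth_map i) ?index_mem//.
  by rewrite nth_index.
have sv : size v = size ws.
  have : all2 leq v (mt_c T) by rewrite -mem_points.
  by rewrite -wsc all2E size_map => /andP[/eqP].
exists g; split.
  rewrite wsM (_ : [seq _ | _ <- _] = v) ?(eqP vM)//.
  apply: (@eq_from_nth _ 0%N) => [|j]; rewrite size_map ?sv// => jw.
  have [d _] : exists d : 'I_m, True by case: (ws) jw => // d; exists d.
  by rewrite (nth_map d)// gws ?mem_nth// index_uniq.
have gN l (x : symb) : l \notin ws -> (x = s \/ x = t) -> tag x = l -> g l <> tagged x :> nat.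
  move=> lws xst xl; rewrite mono_ofE (negPf lws) (wsN lws).
  have x1 : (tagged x <= 1)%N.
    by apply: (@small (tag x)); [rewrite xl|apply: ltn_ord].
  have xE : (if l == tag s then (tagged s == 0%N :> nat) : nat
      else (l == tag t) && (tagged t == 0%N :> nat)) = (tagged x == 0%N :> nat) :> nat.
    case: xst => xE; subst x; first by rewrite -xl eqxx.
    case: eqP => [ls|_]; last by rewrite -xl eqxx.
    have st : tag s == tag t by rewrite -ls -xl.
    have sN : tag s \notin ws by rewrite -ls.
    by move: ncl; rewrite /clash st sN /= negbK => /eqP ->.
  rewrite xE; move: (tagged x : nat) x1 => y; case: y => [|[|y]] //.
move=> x xst; have {}xst : x = s \/ x = t.
  by move: xst; rewrite !inE => /orP[/eqP|/eqP]; [left|right].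
have [xws|xws] := boolP (tag x \in ws); last exact: (gN (tag x) x).
rewrite gws// => E; case: xst => xE; subst x.
  by move: vs; rewrite /code xws /= E eqxx.
by move: vt; rewrite /code xws /= E eqxx.
Qed.

Let pair_face s t : ([set s; t]%SET \in murai_sphere M) =
  type_face T (code s) (code t) && ~~ clash s t.
Proof.
apply/idP/idP; rewrite murai_sphereP// /type_face.
  move=> [g [h [gM hM ga ha]]].
  have /andP[-> ->] : type_has T true (code s) (code t) && ~~ clash s t.
    by apply/pair_avoid; exists g.
  have /andP[-> _] : type_has T false (code s) (code t) && ~~ clash s t.
    by apply/pair_avoid; exists h; split=> //; apply/negbTE.
  by [].
move=> /andP[/andP[h1 h2] h3].
have [g [gM ga]] := (pair_avoid true s t).2 (introT andP (conj h1 h3)).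
have [h [hM ha]] := (pair_avoid false s t).2 (introT andP (conj h2 h3)).
by exists g, h; split=> //; rewrite hM.
Qed.

(** Each inessential coordinate supplies one cube direction, numbered after those of the type. *)
Let us : seq 'I_m := [seq l <- enum 'I_m | l \notin ws].
Let X : polydata := mt_poly T.
Let n : nat := (mt_cube T + size us)%N.
Notation vert := ('I_n * bool + 'I_(xsize X))%type.

Let lcode (s : symb) : option label :=
  if tag s \in ws then type_label T (index (tag s) ws) (tagged s)
  else Some (inl (mt_cube T + index (tag s) us, tagged s == 1 :> nat)%N).

Let vlabel (x : vert) : label :=
  match x with inl (j, b) => inl (j : nat, b) | inr a => inr (a : nat) end.

Let mem_codes (s : symb) : tag s \in ws ->
  (index (tag s) ws, tagged s : nat) \in type_codes T.
Proof.
move=> sws; apply/allpairsPdep; exists (index (tag s) ws), (tagged s : nat).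
rewrite !mem_iota -wsc nth_ws// size_map index_mem sws; split=> //.
by rewrite /= add0n; apply: ltn_ord.
Qed.

Let mem_us l : (l \in us) = (l \notin ws).
Proof. by rewrite mem_filter mem_enum andbT. Qed.

Let codes_symb e j : (e, j) \in type_codes T -> exists s : symb,
  [/\ tag s \in ws, index (tag s) ws = e & tagged s = j :> nat].
Proof.
move=> /allpairsPdep[e' [j' [/[!mem_iota]/= ee jj [-> ->]]]].
have ew : (e' < size ws)%N by move: ee; rewrite add0n -wsc size_map.
have [d _] : exists d : 'I_m, True by case: (ws) ew => // d; exists d.
have jc : (j' < (c (nth d ws e')).+1)%N.
  by move: jj; rewrite -wsc (nth_map d) ?add0n.
exists (Tagged (fun i => 'I_(c i).+1) (Ordinal jc)).
by rewrite /= mem_nth// index_uniq.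
Qed.

Let type_faceNone o : type_face T o None = type_face T o o.
Proof.
by rewrite /type_face /type_has; congr (_ && _);
  apply: eq_has => v /=; rewrite ?andbT ?andbb; case: (type_avoids v o).
Qed.

Let type_faceC o o' : type_face T o o' = type_face T o' o.
Proof.
by rewrite /type_face /type_has; congr (_ && _);
  apply: eq_has => v /=; rewrite [type_avoids v o && _]andbC.
Qed.

Let vertexE s : (s \in complex_vertices (murai_sphere M)) = (lcode s : bool).
Proof.
have /and5P[fN /allP fV _ _ _] := Tok.
rewrite inE -[X in X \in _]finset.setUid pair_face /clash /code /lcode.
case: ifP => sws; rewrite ?eqxx ?andbF ?andbT; last by rewrite fN.
by rewrite (eqP (fV _ (mem_codes sws))).
Qed.

Let labels_valid s L : lcode s = Some L -> exists x, vlabel x = L.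
Proof.
have /and5P[_ _ /allP val _ _] := Tok.
rewrite /lcode; case: ifP => sws E.
  have := val _ (mem_codes sws); rewrite /= E; case: L {E} => [[j b]|a] /= lt.
    by exists (inl (Ordinal (ltn_addr (size us) lt), b)).
  by exists (inr (Ordinal lt)).
case: E => <-; have lt : (mt_cube T + index (tag s) us < n)%N.
  by rewrite ltn_add2l index_mem mem_us sws.
by exists (inl (Ordinal lt, tagged s == 1 :> nat)%N).
Qed.

Let small_tagged (s : symb) : tag s \notin ws -> (tagged s <= 1)%N.
Proof. by move=> sws; apply: small sws (ltn_ord _). Qed.

Let eq_index (s t : symb) : tag s \notin ws -> tag t \notin ws ->
  (index (tag s) us == index (tag t) us) = (tag s == tag t).
Proof.
move=> sws tws; apply/eqP/eqP => [E|->//].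
by rewrite -(nth_index (tag s) (_ : tag s \in us)) ?mem_us// E nth_index ?mem_us.
Qed.

Let cube_label_lt s j b : tag s \in ws -> lcode s = Some (inl (j, b)) -> (j < mt_cube T)%N.
Proof.
have /and5P[_ _ /allP val _ _] := Tok; rewrite /lcode => sws; rewrite sws => E.
by have := val _ (mem_codes sws); rewrite /= E.
Qed.

Let edgeE s t L L' : lcode s = Some L -> lcode t = Some L' ->
  ([set s; t]%SET \in murai_sphere M) = ~~ label_adj X L L'.
Proof.
move=> sL tL; rewrite pair_face.
have sV : type_face T (code s) (code s).
  have : s \in complex_vertices (murai_sphere M) by rewrite vertexE sL.
  by rewrite inE -[Y in Y \in _]finset.setUid pair_face => /andP[].
have tV : type_face T (code t) (code t).
  have : t \in complex_vertices (murai_sphere M) by rewrite vertexE tL.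
  by rewrite inE -[Y in Y \in _]finset.setUid pair_face => /andP[].
have mixed x y Lx Ly : tag x \in ws -> tag y \notin ws -> lcode x = Some Lx ->
    lcode y = Some Ly -> ~~ label_adj X Lx Ly /\ ~~ label_adj X Ly Lx.
  move=> xws yws xL; rewrite /lcode (negPf yws) => -[<-].
  case: Lx xL => [[j b]|a] // xL; have := cube_label_lt xws xL => jT /=.
  split; apply/negP => /andP[/eqP E _]; move: jT; [rewrite E|rewrite -E];
    by rewrite ltnNge leq_addr.
have [sws|sws] := boolP (tag s \in ws); have [tws|tws] := boolP (tag t \in ws).
- have /and5P[_ _ _ /allP/(_ _ (mem_codes sws))/allP/(_ _ (mem_codes tws)) + _] := Tok.
  move: sL tL; rewrite /lcode sws tws => -> -> /andP[/eqP + _].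
  by rewrite /code sws tws /clash sws andbF andbT.
- have [-> _] := mixed _ _ _ _ sws tws sL tL.
  rewrite {2}/code (negPf tws) type_faceNone sV.
  by rewrite /clash sws /= andbF.
- have [_ ->] := mixed _ _ _ _ tws sws tL sL.
  rewrite {1}/code (negPf sws) type_faceC type_faceNone tV /clash.
  by have /negPf-> : tag s != tag t by apply: contraNneq sws => ->.
have /and5P[fN _ _ _ _] := Tok.
move: sL tL; rewrite /lcode /code (negPf sws) (negPf tws) fN => -[<-] [<-] /=.
rewrite eqn_add2l eq_index// /clash sws /=; congr (~~ (_ && _)).
have := small_tagged sws; have := small_tagged tws.
by case: (tagged s : nat) => [|[|]] //; case: (tagged t : nat) => [|[|]].
Qed.

Let lcode_inj s t L : lcode s = Some L -> lcode t = Some L -> s = t.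
Proof.
have cross x y : tag x \in ws -> tag y \notin ws -> lcode x = Some L -> lcode y = Some L -> False.
  move=> xws yws xL; rewrite /lcode (negPf yws) => -[E]; subst L.
  by have := cube_label_lt xws xL; rewrite ltnNge leq_addr.
move=> sL tL.
have [sws|sws] := boolP (tag s \in ws); have [tws|tws] := boolP (tag t \in ws).
- have /and5P[_ _ _ /allP/(_ _ (mem_codes sws))/allP/(_ _ (mem_codes tws)) + _] := Tok.
  move: sL tL; rewrite /lcode sws tws => -> -> /andP[_]; rewrite eqxx /=.
  move=> /eqP[E1 E2]; apply: symb_inj => //.
  by rewrite -(nth_index (tag s) sws) E1 nth_index.
- by case: (cross s t).
- by case: (cross t s).
move: sL tL; rewrite /lcode (negPf sws) (negPf tws) => -[<-] [/eqP].
rewrite eqn_add2l eq_index// => /eqP E1 E2; apply: symb_inj => //.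
have := small_tagged sws; have := small_tagged tws; move: E2.
by case: (tagged s : nat) => [|[|]] //; case: (tagged t : nat) => [|[|]].
Qed.

Let lcode_surj x : exists s, lcode s = Some (vlabel x).
Proof.
have /and5P[_ _ _ _ /andP[/allP sq /allP st]] := Tok.
have lab L : Some L \in type_labels T -> exists s, lcode s = Some L.
  move=> /mapP[[e j] /codes_symb[s [sws <- <-]] LE]; exists s.
  by rewrite /lcode sws LE.
case: x => [[j b]|a] /=; last by apply/lab/st; rewrite mem_iota /= ltn_ord.
have [jT|Tj] := ltnP j (mt_cube T).
  have /andP[h1 h2] : (Some (inl (j : nat, false)) \in type_labels T) &&
      (Some (inl (j : nat, true)) \in type_labels T) by apply: sq; rewrite mem_iota.
  by apply: lab; case: (b).
have ju : (j - mt_cube T < size us)%N 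
  by rewrite -(ltn_add2l (mt_cube T)) subnKC//; apply: (ltn_ord j).
have [d _] : exists d : 'I_m, True by case: (us) ju => // d; exists d.
pose l := nth d us (j - mt_cube T).
have lws : l \notin ws by rewrite -mem_us mem_nth.
have bc : (b < (c l).+1)%N by rewrite wsN//; case: (b).
exists (Tagged (fun i => 'I_(c i).+1) (Ordinal bc)).
have li : index l us = (j - mt_cube T)%N.
  by rewrite index_uniq// filter_uniq// enum_uniq.
rewrite /lcode /= (negPf lws) li subnKC//.
by case: (b).
Qed.

(** Flagness of the sphere enters here: a minimal non-face has at most two elements, and properness
    of [M] makes the empty set a face. *)
Let face_pairs (A : {set symb}) :
  (forall s t, s \in A -> t \in A -> [set s; t]%SET \in murai_sphere M) ->
  A \in murai_sphere M.
Proof.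
move=> AP; apply: contraT => AK.
have [B Bmin BA] := @minset_exists _ [pred B : {set symb} | B \notin murai_sphere M] A AK.
have B2 := Mflag Bmin; move: (minsetp Bmin) => /= /negP; case.
have [B0|[s sB]] := set_0Vmem B.
  apply/murai_sphereP => //; case: (Mproper) => -[/set0Pn[g gM] _] MT.
  have /existsP[h hM] : [exists h, h \notin M].
    by apply: contraR MT; rewrite negb_exists => /forallP H; apply/eqP/setP => a;
      have := H a; rewrite negbK inE.
  by exists g, h; split=> // x; rewrite B0 inE.
have [E|[t tB]] := set_0Vmem (B :\ s)%SET.
  have -> : B = [set s; s]%SET; last by apply: AP; apply: (fintype.subsetP BA).
  by rewrite finset.setUid -(finset.setD1K sB) E finset.setU0.
move: (tB); rewrite finset.in_setD1 => /andP[ts tB'].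
suff -> : B = [set s; t]%SET by apply: AP; apply: (fintype.subsetP BA).
apply/esym/eqP; rewrite finset.eqEcard finset.subUset !finset.sub1set sB tB'.
by rewrite cards2 eq_sym ts.
Qed.

Lemma pulled_iso (x0 : vert) : polyflag_ok X -> polydata_ok X ->
  complex_iso (murai_sphere M) (prod_complex X n).
Proof.
move=> Xflag Xok.
have H s : exists x : vert, forall L, lcode s = Some L -> vlabel x = L.
  case E: (lcode s) => [L|]; last by exists x0.
  by have [x xL] := labels_valid E; exists x => _ [<-].
have [phi phiP] := choice H.
have vlabel_inj : injective vlabel.
  move=> [[i b]|a] [[j b']|a'] //= []; first by move=> /ord_inj -> ->.
  by move/ord_inj ->.
have adjE x y : prod_adj x y = label_adj X (vlabel x) (vlabel y).
  by case: x => [[i b]|a]; case: y => [[j b']|a'] //=; rewrite -val_eqE.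
have phi_lab s : s \in complex_vertices (murai_sphere M) -> lcode s = Some (vlabel (phi s)).
  by rewrite vertexE; case E: (lcode s) => [L|] // _; rewrite (phiP _ _ E).
have phi_of s x : lcode s = Some (vlabel x) -> phi s = x.
  by move=> E; apply: vlabel_inj; apply: phiP.
exists phi; split.
- move=> s t /phi_lab sL /phi_lab tL E; apply: (lcode_inj sL); by rewrite E.
- apply/setP => x; have [s sx] := lcode_surj x.
  have sV : s \in complex_vertices (murai_sphere M) by rewrite vertexE sx.
  rewrite -(phi_of _ _ sx) imset_f//; apply/esym; rewrite inE.
  apply/prod_complexP => // y z; rewrite !inE => /eqP -> /eqP ->.
  exact: prod_adj_irr.
move=> A AV; apply/idP/prod_complexP => // [AK _ _ /imsetP[s sA ->] /imsetP[t tA ->]|indep].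
  rewrite adjE -(edgeE (phi_lab s _) (phi_lab t _)); try exact: (fintype.subsetP AV).
  by apply: murai_sphere_sub AK; rewrite finset.subUset !finset.sub1set sA.
apply: face_pairs => s t sA tA.
rewrite (edgeE (phi_lab s _) (phi_lab t _)); try exact: (fintype.subsetP AV).
by rewrite -adjE; apply: indep; apply: imset_f.
Qed.

End PulledIso.

Lemma typed_iso (m : nat) (c : 'I_m -> nat) (M : {set cmonomial c}) :
  (2 <= \sum_(i < m) c i)%N -> proper_multicomplex M ->
  flag_complex (murai_sphere M) -> typed M ->
  exists X n, [/\ exists2 i, (i < size murai_types)%N
      & X = mt_poly (nth murai_type0 murai_types i),
    exists x : 'I_n * bool + 'I_(xsize X), True
    & complex_iso (murai_sphere M) (prod_complex X n)].
Proof.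
move=> c2 Mp Mf [i [is_i /= [ws [wsu wsc wsN wsM]]]].
set T := nth murai_type0 murai_types i in wsc wsM *.
have Tok : murai_type_ok T by move/all_nthP: murai_types_ok; apply.
have [Xok Xflag] : polydata_ok (mt_poly T) /\ polyflag_ok (mt_poly T).
  by move: (i) is_i {wsc wsM Tok} @T; do 14![case=> [_|]; first by vm_compute] => j.
(* Only the type with c = (1) has neither a cube direction nor a facet. It alone would give the
   empty sphere and a point, which is not in the list; the bound on |c| then supplies an inessential
   coordinate. *)
have T0 : [|| 0 < mt_cube T, 0 < xsize (mt_poly T) | mt_c T == [:: 1]]%N.
  by move: (i) is_i {wsc wsM Tok Xok Xflag} @T; do 14![case=> [_|]; first by vm_compute] => j.
set n := (mt_cube T + size [seq l <- enum 'I_m | l \notin ws])%N.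
have [x _] : exists x : 'I_n * bool + 'I_(xsize (mt_poly T)), True.
  have cube0 : (0 < n)%N -> exists x : 'I_n * bool + 'I_(xsize (mt_poly T)), True.
    by move=> n0; exists (inl (Ordinal n0, true)).
  case/or3P: T0 => [q0|x0|/eqP T1]; first by apply: cube0; rewrite ltn_addr.
    by exists (inr (Ordinal x0)).
  apply: cube0; rewrite addn_gt0 orbC lt0n size_eq0; apply/orP; left.
  apply/eqP => us0; clear n; move: wsc; rewrite T1; case: ws wsu wsN wsM us0 => [|k [|]] // _ _ _ us0 [ck].
  move: c2; rewrite (bigD1 k) //= ck big1 // => j jk.
  have : j \in [seq l <- enum 'I_m | l \notin [:: k]].
    by rewrite mem_filter mem_enum inE jk.
  by rewrite us0.
exists (mt_poly T), n; split; [by exists i|by exists x|].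
exact: (pulled_iso Mp Mf Tok wsu wsc wsN wsM x Xflag Xok).
Qed.

Section Main.
Variable R : realType.

Lemma simple_polytope_model (X : polydata) (Y : nestdata) (n : nat) (T : finType)
    (K : {set {set T}}) (x : 'I_n * bool + 'I_(xsize X)) :
  polydata_ok X && polyflag_ok X && nestdata_ok X Y ->
  flag_complex K -> complex_iso K (prod_complex X n) ->
  exists P : set 'rV[R]_(n + xdim X),
    [/\ simple_polytope_of K P, flag_polytope P, nestohedron P
      & realizes (prod_complex X n) P].
Proof.
move=> /andP[/andP[Xok Xflag] Yok] Kflag Kiso.
have [P [polP rP nP [Q [sQ iQ dQ]]]] := prod_complex_polytopal Xok Xflag R Yok x.
have KQ := complex_iso_trans Kiso iQ.
exists P; split=> //; split=> //; exists (n + xdim X)%N, Q; split=> //.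
exact: (proj1 (complex_iso_flagP KQ) Kflag).
Qed.

Lemma flag_complex_models (T : finType) (K : {set {set T}}) X n i
    (x : 'I_n * bool + 'I_(xsize X)) :
  (i < size murai_types)%N -> X = mt_poly (nth murai_type0 murai_types i) ->
  flag_complex K -> complex_iso K (prod_complex X n) ->
  exists (d : nat) (P : set 'rV[R]_d),
    simple_polytope_of K P /\
    flag_polytope P /\
    nestohedron P /\
    ((exists n : nat, (1 <= n)%N /\ comb_equiv P (cube R n)) \/
     (exists (n : nat) (G : set 'rV[R]_2),
         polygon 5 G /\ comb_equiv P (polytope_prod (cube R n) G)) \/
     (exists (n : nat) (G : set 'rV[R]_2),
         polygon 6 G /\ comb_equiv P (polytope_prod (cube R n) G)) \/
     (exists (n : nat) (Q : set 'rV[R]_3),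
         Q23 Q /\ comb_equiv P (polytope_prod (cube R n) Q))).
Proof.
move=> is_i XE Kflag Kiso.
have : [\/ X = point_data, X = pentagon_data, X = hexagon_data | X = cube_cut2_data].
  rewrite {}XE {x Kiso}; move: i is_i.
  by do 14![case=> [_|]; first by [apply: Or41|apply: Or42|apply: Or43|apply: Or44]] => j.
case=> {}XE; subst X.
- have [P [h1 h2 h3 rP]] := simple_polytope_model x point_ok Kflag Kiso.
  exists (n + 0)%N, P; do 3![split=> //]; left; exists n; split.
    by case: x => [[j _]|[]//]; apply: leq_ltn_trans (ltn_ord j).
  exact: realizes_comb_equiv rP (cube_realizes R n).
- have [P [h1 h2 h3 rP]] := simple_polytope_model x pentagon_ok Kflag Kiso.
  have /andP[/andP[Xok _] _] := pentagon_ok.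
  have pr := presents_polydata_conv R Xok.
  exists (n + 2)%N, P; do 3![split=> //]; right; left.
  exists n, (conv_hull (range (xpt R (X := pentagon_data)))); split.
    split; first exact: (polytope_conv (xpt R (X := pentagon_data)) (ord0 : 'I_5)).
    exact: (card_vertices_polydata R Xok).
  exact: realizes_comb_equiv rP (prod_complex_realizes n Xok (pres_pt pr) (pres_le pr)).
- have [P [h1 h2 h3 rP]] := simple_polytope_model x hexagon_ok Kflag Kiso.
  have /andP[/andP[Xok _] _] := hexagon_ok.
  have pr := presents_polydata_conv R Xok.
  exists (n + 2)%N, P; do 3![split=> //]; right; right; left.
  exists n, (conv_hull (range (xpt R (X := hexagon_data)))); split.
    split; first exact: (polytope_conv (xpt R (X := hexagon_data)) (ord0 : 'I_6)).
    exact: (card_vertices_polydata R Xok).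
  exact: realizes_comb_equiv rP (prod_complex_realizes n Xok (pres_pt pr) (pres_le pr)).
- have [P [h1 h2 h3 rP]] := simple_polytope_model x cube_cut2_ok Kflag Kiso.
  have /andP[/andP[Xok _] _] := cube_cut2_ok.
  have pr := presents_hpoly R Xok.
  exists (n + 3)%N, P; do 3![split=> //]; right; right; right.
  exists n, (@hpoly R cube_cut2_data); split; first exact: Q23_cube_cut2.
  exact: realizes_comb_equiv rP (prod_complex_realizes n Xok (pres_pt pr) (pres_le pr)).
Qed.

End Main.

Theorem theorem1p3 (R : realType) (m : nat) (c : 'I_m -> nat)
    (M : {set cmonomial c})
    (m_ge1 : (1 <= m)%N)
    (c_gt0 : forall i, (0 < c i)%N)
    (c_norm_ge2 : (2 <= \sum_(i < m) c i)%N)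
    (M_proper : proper_multicomplex M) :
  flag_complex (murai_sphere M) <->
  exists (d : nat) (P : set 'rV[R]_d),
    simple_polytope_of (murai_sphere M) P /\
    flag_polytope P /\
    nestohedron P /\
    ((exists n : nat, (1 <= n)%N /\ comb_equiv P (cube R n)) \/
     (exists (n : nat) (G : set 'rV[R]_2),
         polygon 5 G /\ comb_equiv P (polytope_prod (cube R n) G)) \/
     (exists (n : nat) (G : set 'rV[R]_2),
         polygon 6 G /\ comb_equiv P (polytope_prod (cube R n) G)) \/
     (exists (n : nat) (Q : set 'rV[R]_3),
         Q23 Q /\ comb_equiv P (polytope_prod (cube R n) Q))).
Proof.
split=> [Mf|[d [P [sP [fP _]]]]]; last exact: flag_polytope_flag_complex sP fP.
have Mf' := dual_flag M_proper Mf.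
case: (murai_classification c_gt0 M_proper Mf) => typ.
  have [X [n [[i i_s XE] [x _] iso]]] := typed_iso c_norm_ge2 M_proper Mf typ.
  exact: (flag_complex_models R x i_s XE Mf iso).
(* Only the dual is in the table; its sphere is isomorphic, so the same polytope serves. *)
have [X [n [[i i_s XE] [x _] iso]]] := typed_iso c_norm_ge2 (dual_proper M_proper) Mf' typ.
exact: (flag_complex_models R x i_s XE Mf (complex_iso_trans (murai_dual_iso M_proper) iso)).
Qed.
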